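(* Let $p \in [2,\infty)$ and let $q$ be defined by $\frac1p + \frac1q = 1$. Let $c \in (-2(p+q),0)$, let $\xi_3 < \xi_2 < \xi_1$ be the three real roots of the cubic polynomial $c^2+4(p+q)(\xi-1)(\xi+p)(\xi+q)$ in $\xi$ (one has $0<\xi_1<1$), and set \[ G(\zeta) = \left( \frac{1}{\zeta^2 + \xi_1 - 1} - \frac{1}{p(\zeta^2 + \xi_1 + p)} - \frac{1}{q(\zeta^2 + \xi_1 + q)} \right) \left(\zeta+\frac{c}{2\sqrt{(p+q)(\zeta^2 + \xi_1 - \xi_2)(\zeta^2 + \xi_1 - \xi_3)}}\right). \] Then (after removing the removable singularity at $\zeta=\sqrt{1-\xi_1}$) $G$ is a positive analytic function on $(-\sqrt{1-\xi_1},+\infty)$ and a negative analytic function on $(-\infty,-\sqrt{1-\xi_1})$, with a simple pole with residue $1$ at $\zeta = -\sqrt{1-\xi_1}$. Define $\alpha > 0$ by \[ \log\alpha = -\int_0^{+\infty} \left[ G(\zeta-\sqrt{1-\xi_1}) + G(-\zeta-\sqrt{1-\xi_1})\right] d\zeta , \] where the integral is finite because the pole of $G$ cancels out. Define $t: \mathbb R \to (-\alpha,1)$ by \[ t(\zeta) = \begin{cases} \exp\left(-\int_{\zeta}^{+\infty} G(s)\, ds\right), & \zeta > -\sqrt{1-\xi_1}, \\ 0, & \zeta = -\sqrt{1-\xi_1}, \\ -\alpha \exp\left(\int_{-\infty}^{\zeta} G(s)\, ds\right), & \zeta < -\sqrt{1-\xi_1}, \end{cases} \] and define $\phi: \mathbb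 R \to \mathbb R$ by \[ \phi(\zeta) = \log\frac{-c+2\zeta\sqrt{(p+q)(\zeta^2 + \xi_1 - \xi_2)(\zeta^2 + \xi_1 - \xi_3)}}{2(p+q)\,t(\zeta)} \] for $\zeta \neq -\sqrt{1-\xi_1}$, and by continuity at $\zeta = -\sqrt{1-\xi_1}$. (The integrals can be expressed by elliptic functions.) Then $\alpha < 1$, and for the cone \[ K = \{ (x,y,z)^T \in \mathbb R^3 \mid -\alpha x^{1/p}y^{1/q} \leq z \leq x^{1/p}y^{1/q},\ x \geq 0,\ y \geq 0\} \] with canonical potential $F$, the level set $\{F = 0\}$, which is a complete hyperbolic affine sphere asymptotic to $\partial K$, is given by the hypersurface immersion \[ \mathbb R^2 \ni \begin{pmatrix} \zeta \\ \mu \end{pmatrix} \mapsto \begin{pmatrix} x \\ y \\ z \end{pmatrix} = e^{\frac{\phi(\zeta)}{3}} \begin{pmatrix} e^{\frac{q+1}{3q}\mu} \\ e^{-\frac{p+1}{3p}\mu} \\ e^{-\frac{\mu(p-q)}{3(p+q)}}t(\zeta) \end{pmatrix}. \]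
   Context: A convex cone in $\mathbb R^n$ is regular if it is closed, has non-empty interior, and contains no line. The canonical potential of a regular convex cone $K\subset\mathbb R^n$ is the unique solution $F: K^o \to \mathbb R$ ($K^o$ the interior of $K$) of the Monge-Ampère problem $\det F'' = e^{2F}$, $F|_{\partial K} = +\infty$, $F'' \succ 0$, where $F''$ is the Hessian in the standard coordinates and the boundary condition means that $F(x) \to +\infty$ as $x$ tends to a boundary point of $K$. It is known that this solution exists and is unique, and that the complete hyperbolic affine spheres asymptotic to the boundary of $K$ (in the sense of equiaffine differential geometry: convex hypersurfaces whose affine normals all meet at the vertex of $K$, which separate their convex hull from that point, and which are complete in the affine metric) are exactly the level sets of $F$; they are related to each other by homotheties.
   Formalization: The canonical potential is also required to be logarithmically homogeneous, F(λx) = F(x) − n log λ, since the Monge-Ampère problem alone is not uniquely solvable (orthant: Σ log(a_i/sinh(a_i x_i))); the parenthetical on elliptic functions is left out. *)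

(* Defs.v *)
From HB Require Import structures.
From mathcomp Require Import all_boot all_order all_algebra.
From mathcomp Require Import all_classical all_reals all_analysis.

Set Implicit Arguments.
Unset Strict Implicit.
Unset Printing Implicit Defensive.

Import Order.TTheory GRing.Theory Num.Theory.
Import numFieldNormedType.Exports.

Local Open Scope classical_set_scope.
Local Open Scope ring_scope.

(* [f] is of class C^k on the open set [D]; [f] may be arbitrary outside [D].
   The domain [V] is meant to be finite-dimensional. *)
Fixpoint Ck_on (R : realType) (V W : normedModType R) (D : set V) (k : nat)
    (f : V -> W) : Prop :=
  match k with
  | 0 => forall x, D x -> {for x, continuous f}
  | k'.+1 => (forall x, D x -> differentiable f x) /\
             (forall v : V, Ck_on D k' ('D_v f))
  end.

Definition smooth (R : realType) (V W : normedModType R) (f : V -> W) : Prop :=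
  forall k, Ck_on setT k f.

Definition Hessian (R : realType) (n : nat) (F : 'rV[R]_n -> R)
    (x : 'rV[R]_n) : 'M[R]_n :=
  \matrix_(i, j) 'D_('e_j) ('D_('e_i) F) x.

Definition posdefmx (R : realType) (n : nat) (A : 'M[R]_n) : Prop :=
  A^T = A /\ forall v : 'rV[R]_n, v != 0 -> 0 < (v *m A *m v^T) 0 0.

Definition fill (R : realType) (f : R -> R) (a : R) : R -> R :=
  fun x => if x == a then lim (f y @[y --> a^']) else f x.

Definition analytic_at (R : realType) (f : R -> R) (x : R) : Prop :=
  exists (a : nat -> R) (r : R), 0 < r /\
    forall h, `|h| < r -> pseries a h @ \oo --> f (x + h).

Definition simple_pole_with_residue (R : realType) (f : R -> R) (a r : R) :
    Prop :=
  r != 0 /\ exists g : R -> R, analytic_at g a /\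
    \forall x \near a^', f x = r / (x - a) + g x.

Definition boundary (T : topologicalType) (A : set T) : set T :=
  closure A `\` interior A.

Definition regular_convex_cone (R : realType) (n : nat) (K : set 'rV[R]_n) :
    Prop :=
  [/\ convex_set (K : set (convex_lmodType 'rV[R]_n)),
      forall (a : R) x, 0 < a -> K x -> K (a *: x),
      closed K,
      interior K !=set0 &
      ~ exists (x v : 'rV[R]_n), v != 0 /\ forall s : R, K (x + s *: v)].

(* [F] solves det F'' = e^(2F), F'' > 0 in the interior of [K], F = +oo on the
   boundary; the values of [F] outside the interior are irrelevant.
   These conditions alone do not determine [F]: on the orthant, every
   F = \sum_i log (a_i / sinh (a_i x_i)) with a_i > 0 satisfies them.  The
   solution meant is the one whose level sets are related by homotheties, that
   is, the logarithmically homogeneous one.  (If F solves the problem, so does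
   x |-> F (l x) + n log l, so uniqueness includes the last condition.) *)
Definition canonical_potential (R : realType) (n : nat) (K : set 'rV[R]_n)
    (F : 'rV[R]_n -> R) : Prop :=
  [/\ Ck_on (interior K) 2 F,
      forall x, interior K x -> posdefmx (Hessian F x),
      forall x, interior K x -> \det (Hessian F x) = expR (2 * F x),
      forall b, boundary K b -> F x @[x --> within (interior K) (nbhs b)] --> +oo &
      forall (l : R) x, 0 < l -> interior K x -> F (l *: x) = F x - n%:R * ln l].

Definition conv_hull (R : realType) (n : nat) (M : set 'rV[R]_n) :
    set 'rV[R]_n :=
  smallest (fun A : set 'rV[R]_n =>
    convex_set (A : set (convex_lmodType 'rV[R]_n))) M.

Definition immersion (R : realType) (m n : nat) (f : 'rV[R]_m -> 'rV[R]_n) :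
    Prop :=
  smooth f /\ forall u, row_free ('J f u).

(* [xi] is the affine normal field and [h] the affine (Blaschke) metric of the
   locally strongly convex immersion [f].  The rows of ['J f u] are the partial
   derivatives of [f] and span the tangent plane.  The conditions are: the Gauss
   formula f_ij = (tangent) + h_ij xi; the derivatives of xi are tangent; the
   volume form det(f_1, f_2, xi) is that of h.  The orientation of xi is fixed
   by h > 0, and xi is transversal because det h > 0. *)
Definition affine_normal_metric (R : realType) (f xi : 'rV[R]_2 -> 'rV[R]_3)
    (h : 'rV[R]_2 -> 'M[R]_2) : Prop :=
  forall u,
  [/\ posdefmx (h u),
      forall i j, ('D_('e_j) ('D_('e_i) f) u - h u i j *: xi u <= 'J f u)%MS,
      differentiable xi u,
      ('J xi u <= 'J f u)%MS &
      \det (h u) = (\det (col_mx ('J f u) (xi u) : 'M[R]_3)) ^+ 2].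

(* Every C^1 curve [0, +oo[ -> R^m leaving all compact sets has infinite length.
   (Any such curve extends to a C^1 curve on the real line.) *)
Definition complete_metric (R : realType) (m : nat)
    (h : 'rV[R]_m -> 'M[R]_m) : Prop :=
  forall g : R -> 'rV[R]_m,
    (forall s, derivable g s 1) -> continuous (derive1 g) ->
    (forall C : set 'rV[R]_m, compact C -> \forall s \near +oo, ~ C (g s)) ->
    (\int[@lebesgue_measure R]_(s in `[0%R, +oo[)
       (Num.sqrt ((derive1 g s *m h (g s) *m (derive1 g s)^T) 0 0))%:E)%E = +oo%E.

(* The affine normals all pass through 0.  The last two conditions say that
   M separates its convex hull from 0: the segment from 0 to any point of the
   hull meets M. *)
Definition complete_hyperbolic_affine_sphere (R : realType)
    (f : 'rV[R]_2 -> 'rV[R]_3) : Prop :=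
  let M := range f in
  [/\ immersion f,
      exists (xi : 'rV[R]_2 -> 'rV[R]_3) (h : 'rV[R]_2 -> 'M[R]_2),
        [/\ affine_normal_metric f xi h,
            forall u, exists s : R, f u + s *: xi u = 0 &
            complete_metric h],
      M `<=` boundary (conv_hull M),
      ~ conv_hull M 0 &
      forall y, conv_hull M y -> exists s : R, 0 < s <= 1 /\ M (s *: y)].

Definition asymptotic_to_boundary (R : realType) (n : nat)
    (M K : set 'rV[R]_n) : Prop :=
  M `<=` interior K /\
  forall e : R, 0 < e -> exists N : R, forall y, M y -> N < `|y| ->
    exists b, boundary K b /\ `|y - b| < e.

Definition cubic (R : realType) (p q c : R) : {poly R} :=
  (c ^+ 2)%:P + (4 * (p + q)) *: (('X - 1) * ('X + p%:P) * ('X + q%:P)).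

Definition rad (R : realType) (p q xi1 xi2 xi3 z : R) : R :=
  Num.sqrt ((p + q) * (z ^+ 2 + xi1 - xi2) * (z ^+ 2 + xi1 - xi3)).

Definition G_formula (R : realType) (p q c xi1 xi2 xi3 z : R) : R :=
  (1 / (z ^+ 2 + xi1 - 1) - 1 / (p * (z ^+ 2 + xi1 + p))
     - 1 / (q * (z ^+ 2 + xi1 + q)))
  * (z + c / (2 * rad p q xi1 xi2 xi3 z)).

Definition G_fun (R : realType) (p q c xi1 xi2 xi3 : R) : R -> R :=
  fill (G_formula p q c xi1 xi2 xi3) (Num.sqrt (1 - xi1)).

(* In the next two definitions z0 = - sqrt (1 - xi1) is the pole of G. *)
Definition alpha_of (R : realType) (G : R -> R) (z0 : R) : R :=
  expR (- \int[@lebesgue_measure R]_(s in `[0, +oo[)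
            (G (s + z0) + G (- s + z0))).

Definition t_of (R : realType) (G : R -> R) (z0 z : R) : R :=
  if z0 < z then expR (- \int[@lebesgue_measure R]_(s in `[z, +oo[) G s)
  else if z == z0 then 0
  else - alpha_of G z0 * expR (\int[@lebesgue_measure R]_(s in `]-oo, z]) G s).

Definition phi_arg (R : realType) (p q c xi1 xi2 xi3 : R) (t : R -> R) (z : R)
    : R :=
  (- c + 2 * z * rad p q xi1 xi2 xi3 z) / (2 * (p + q) * t z).

Definition phi_of (R : realType) (p q c xi1 xi2 xi3 : R) (t : R -> R) (z0 : R)
    : R -> R :=
  fill (fun z => ln (phi_arg p q c xi1 xi2 xi3 t z)) z0.

Definition cone (R : realType) (p q alpha : R) : set 'rV[R]_3 :=
  [set v | let: (x, y, z) := (v 0 0, v 0 1, v 0 2) in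
     [/\ - alpha * (x `^ p^-1 * y `^ q^-1) <= z,
         z <= x `^ p^-1 * y `^ q^-1, 0 <= x & 0 <= y]].

Definition sphere_map (R : realType) (p q : R) (t phi : R -> R)
    (u : 'rV[R]_2) : 'rV[R]_3 :=
  let: (zeta, mu) := (u 0 0, u 0 1) in
  expR (phi zeta / 3) *:
  \row_(i < 3)
    [:: expR ((q + 1) / (3 * q) * mu);
        expR (- ((p + 1) / (3 * p)) * mu);
        expR (- (mu * (p - q) / (3 * (p + q)))) * t zeta]`_i.

(* Main.v *)
Require Import Defs.
From HB Require Import structures.
From mathcomp Require Import all_boot all_order all_algebra.
From mathcomp Require Import all_classical all_reals all_analysis.
From mathcomp Require Import measurable_realfun.
From mathcomp Require Import ring lra.

(** Put W = zeta^2 + xi1, L = 3 W + 2 (p + q) - 2, S for the square root,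
    N = 2 zeta S - c and H = 2 zeta S + c.  As the xi's are the roots of the
    cubic, N H = 4 (p + q) (W - 1) (W + p) (W + q) and N' = 2 (p + q) W L / S,
    whence G = 2 (p + q) L / (S N).  So t and phi are elementary up to the
    antiderivative Th, vanishing at +oo, of the positive integrable function
    theta = - c L / (2 S (W + p) (W + q)):
      phi = (1 + 1/p)/2 ln (W + p) + (1 + 1/q)/2 ln (W + q) - Th - ln (p + q)/2,
      t = N / (2 (p + q) e^phi),   ln alpha = lim_(-oo) Th < 0.

    The cone is invariant under the diagonal matrices (a, b, a^(1/p) b^(1/q)),
    which suggests F = psi (z x^(-1/p) y^(-1/q)) - (1 + 1/p) ln x - (1 + 1/q) ln y.
    With psi = phi o t^-1 the equation det F'' = e^(2F) becomes algebraic, because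
    psi' = chi o t^-1 for chi = H e^phi / (2 (W + p) (W + q)), and chi t = W - 1.
    The immersion parametrizes {F = 0}.  Its conormal is the gradient of F, which
    pairs to the constant -3 with the position vector; together with
    det h = const * det (f_zeta, f_mu, f)^2 this makes f proportional to the
    affine normal.  The metric h dominates d zeta^2 / (1 + zeta^2) and d mu^2 up to
    constants, so it is complete.

    The potential is unique: for linear maps A_e -> 1 pushing K \ {0} into the
    interior, F1 - F2 o A_e attains its minimum on the interior of K (modulo
    dilations), where the monotonicity of the determinant on positive definite
    Hessians gives F1 >= F2 o A_e + ln det A_e; then let e -> 0. *)

Import Order.TTheory GRing.Theory Num.Theory.
Import numFieldNormedType.Exports.

Local Open Scope classical_set_scope.
Local Open Scope ring_scope.

Set Implicit Arguments.
Unset Strict Implicit.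
Unset Printing Implicit Defensive.

(** * Derivatives along directions and algebras of smooth functions *)

(** All regularity claims rest on one device: if the derivatives of finitely many generators are
    polynomials in those generators, smoothness of every order is an induction, and counting degrees
    and coefficients bounds the k-th derivative by C rho^k k!, hence analyticity. The generators are
    chosen for this closure; for the potential, differentiating with respect to t makes the square
    root drop out, so 1/[L] suffices.

    The singular data of the statement are removed before anything is integrated. [Ghat] keeps the
    pole but not the removable singularity, and it is T'/T. Writing T = (z - z0) [T1] makes the
    divergent halves of the integral for log alpha cancel in closed form: only the limits of ln |T|
    at both ends survive. The constant in phi is fixed by T -> 1 at +oo, so alpha is minus the limit
    at -oo, and alpha < 1 is the monotonicity of Th.

    K is not visibly convex or closed. Both follow from writing the geometric mean as an infimum of
    linear forms. The hull of the sphere is controlled from outside only, by the convex set where F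
    <= 0.

    Logarithmic homogeneity of the potentials is what makes the comparison compact: their difference
    is constant on rays and lives on a bounded slice of K. *)

Section calculus.
Context {R : realType}.

(** The two difference quotients at 0 are the same function. This carries the one-variable chain
    rule over to directional derivatives. *)
Lemma is_derive_lineP (V W : normedModType R) (f : V -> W) (x v : V) (d : W) :
  is_derive x v f d <-> is_derive (0 : R) 1 (fun s : R => f (s *: v + x)) d.
Proof.
have E : 'D_1 (fun s : R => f (s *: v + x)) 0 = 'D_v f x.
  rewrite /derive; set a := (fun h => _); set b := (fun h => _).
  suff -> : a = b by [].
  by apply/funext => h; rewrite /a /b /= addr0 scale0r add0r [_%:A]mulr1.
split=> -[fx fd]; apply: DeriveDef.
- exact: (derivable1P f x v).1 fx.
- by rewrite E.
- exact: (derivable1P f x v).2 fx.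
- by rewrite -E.
Qed.

Lemma is_derive_scomp (V : normedModType R) (h : V -> R) (g : R -> R) x v (a b : R) :
  is_derive (h x) 1 g a -> is_derive x v h b ->
  is_derive x v (fun y => g (h y)) (a * b).
Proof.
move=> dg /is_derive_lineP dh; apply/is_derive_lineP.
by apply: is_derive1_comp => //=; rewrite scale0r add0r.
Qed.

Lemma is_derive_differentiable (f : R -> R) (x d : R) :
  is_derive x 1 f d -> differentiable f x.
Proof. by move=> [+ _] => /derivable1_diffP. Qed.

Lemma is_derive_unique (V W : normedModType R) (f : V -> W) x v d e :
  is_derive x v f d -> is_derive x v f e -> d = e.
Proof. by move=> [_ <-] [_ <-]. Qed.

Lemma is_derive_continuous (f : R -> R) (x d : R) :
  is_derive x 1 f d -> {for x, continuous f}.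
Proof. by move=> /is_derive_differentiable/differentiable_continuous. Qed.

(** The primed rules are stated on pointwise bodies with real products instead of scaling, so that a
    derivative can be assembled as a term and its value left to unification. *)
Lemma is_deriveD' (V : normedModType R) (f g : V -> R) x v a b :
  is_derive x v f a -> is_derive x v g b ->
  is_derive x v (fun y => f y + g y) (a + b).
Proof. by move=> df dg; apply: (@is_deriveD _ _ _ f g). Qed.

Lemma is_deriveM' (V : normedModType R) (f g : V -> R) x v a b :
  is_derive x v f a -> is_derive x v g b ->
  is_derive x v (fun y => f y * g y) (f x * b + a * g x).
Proof.
move=> df dg; have -> : f x * b + a * g x = f x *: b + g x *: a.
  by rewrite /GRing.scale /= [g x * a]mulrC.
exact: (@is_deriveM _ _ f g x v a b df dg).
Qed.

Lemma is_deriveN' (V : normedModType R) (f : V -> R) x v (a : R) :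
  is_derive x v f a -> is_derive x v (fun y => - f y) (- a).
Proof. by move=> df; apply: (@is_deriveN _ _ _ f). Qed.

Lemma is_deriveB' (V : normedModType R) (f g : V -> R) x v (a b : R) :
  is_derive x v f a -> is_derive x v g b ->
  is_derive x v (fun y => f y - g y) (a - b).
Proof. by move=> df dg; apply: (@is_deriveB _ _ _ f g). Qed.

Lemma is_derive_cst' (V : normedModType R) (x v : V) (a : R) :
  is_derive x v (fun=> a) 0.
Proof. exact: is_derive_cst. Qed.

Lemma is_derive_id' (x : R) : is_derive x 1 (fun y : R => y) 1.
Proof. exact: is_derive_id. Qed.

Lemma is_deriveX' (V : normedModType R) (f : V -> R) x v (a : R) n :
  is_derive x v f a -> is_derive x v (fun y => f y ^+ n.+1) (n.+1%:R * f x ^+ n * a).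
Proof.
move=> df; have := @is_deriveX _ _ f n.+1 x v a df; rewrite /GRing.scale /=.
have -> : f ^+ n.+1 = (fun y => f y ^+ n.+1) by apply/funext => y; rewrite fctE.
by rewrite mulr_natl.
Qed.

Lemma is_deriveV' (V : normedModType R) (f : V -> R) x v (a : R) :
  is_derive x v f a -> f x != 0 ->
  is_derive x v (fun y => (f y)^-1) (- a / f x ^+ 2).
Proof.
move=> df fx; have -> : - a / f x ^+ 2 = (- (f x) ^- 2 * 1) * a.
  by rewrite mulr1 !mulNr mulrC.
apply: is_derive_scomp df.
exact: (@is_deriveV _ id (f x) 1 1 fx (is_derive_id' (f x))).
Qed.

Lemma is_derive_expR' (V : normedModType R) (f : V -> R) x v (a : R) :
  is_derive x v f a -> is_derive x v (fun y => expR (f y)) (expR (f x) * a).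
Proof. by apply: is_derive_scomp; exact: is_derive_expR. Qed.

Lemma is_derive_ln' (V : normedModType R) (f : V -> R) x v (a : R) :
  is_derive x v f a -> 0 < f x -> is_derive x v (fun y => ln (f y)) ((f x)^-1 * a).
Proof. by move=> df fx; move: df; apply: is_derive_scomp; exact: is_derive1_ln. Qed.

Lemma is_derive_sqrt' (V : normedModType R) (f : V -> R) x v (a : R) :
  is_derive x v f a -> 0 < f x ->
  is_derive x v (fun y => Num.sqrt (f y)) ((2 * Num.sqrt (f x))^-1 * a).
Proof. by move=> df fx; move: df; apply: is_derive_scomp; exact: is_derive1_sqrt. Qed.

(** The differential of [g] is still a first-order expansion of [f], and such an expansion
    determines the differential. *)
Lemma near_eq_differentiable (V W : normedModType R) (f g : V -> W) (x : V) :
  (\near x, f x = g x) -> differentiable g x -> differentiable f x.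
Proof.
move=> fg dg; have fgx := nbhs_singleton fg.
have cd : continuous ('d g x) by exact: diff_continuous.
have H : f \o shift x = cst (f x) + 'd g x +o_ 0 id.
  apply/eqaddoP => e e0.
  have /eqaddoP/(_ e e0) gE := diff_locally dg.
  have fg0 : \forall y \near (0 : V), f (y + x) = g (y + x).
    by move: fg; rewrite (near_shift 0 x); apply: filterS => y /=; rewrite subr0.
  apply: filterS2 fg0 gE => y /= Ey.
  by rewrite !fctE /= Ey fgx.
have E := diff_unique cd H.
by apply/diff_locallyP; rewrite E.
Qed.

End calculus.

Section falg.
Context {R : realType} {V : normedModType R} (gen : (V -> R) -> Prop).

(** The algebra of functions generated by [gen]. Inverses and square roots enter only as generators,
    so closure under differentiation has to be checked on generators alone. *)
Inductive falg : (V -> R) -> Prop :=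
| falg_gen f : gen f -> falg f
| falg_cst a : falg (fun=> a)
| falg_add f g : falg f -> falg g -> falg (fun x => f x + g x)
| falg_mul f g : falg f -> falg g -> falg (fun x => f x * g x).

Lemma falg_opp f : falg f -> falg (fun x => - f x).
Proof.
move=> ff; suff -> : (fun x => - f x) = (fun x => (-1) * f x).
  by apply: falg_mul => //; exact: falg_cst.
by apply/funext => x; rewrite mulN1r.
Qed.

Lemma falg_exp f n : falg f -> falg (fun x => f x ^+ n).
Proof.
move=> ff; elim: n => [|n IH].
  under eq_fun do rewrite expr0.
  exact: falg_cst.
by under eq_fun do rewrite exprS; exact: falg_mul.
Qed.

End falg.

Section falg_smooth.
Context {R : realType} {V : normedModType R} (D : set V) (oD : open D).
Variable gen : (V -> R) -> Prop.
Hypothesis genD : forall f, gen f ->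
  (forall x, D x -> differentiable f x) /\
  forall v, exists2 g, falg gen g & forall x, D x -> 'D_v f x = g x.

Lemma falg_derive f : falg gen f ->
  (forall x, D x -> differentiable f x) /\
  forall v, exists2 g, falg gen g & forall x, D x -> 'D_v f x = g x.
Proof.
elim=> [//|a|{}f g ff [df Hf] fg [dg Hg]|{}f g ff [df Hf] fg [dg Hg]].
- split=> [x _|v]; first exact: differentiable_cst.
  by exists (fun=> 0) => [|x _]; [exact: falg_cst|exact: derive_cst].
- split=> [x Dx|v]; first by apply: (@differentiableD _ _ _ f g); auto.
  have [f' ff' Ef] := Hf v; have [g' fg' Eg] := Hg v.
  exists (fun x => f' x + g' x) => [|x Dx]; first exact: falg_add.
  rewrite -Ef// -Eg//; apply: (@deriveD _ _ _ f g); apply: diff_derivable; auto.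
- split=> [x Dx|v]; first by apply: (@differentiableM _ _ f g); auto.
  have [f' ff' Ef] := Hf v; have [g' fg' Eg] := Hg v.
  exists (fun x => f x * g' x + g x * f' x) => [|x Dx].
    by apply: falg_add; apply: falg_mul.
  rewrite -Ef// -Eg//; apply: (@deriveM _ _ f g); apply: diff_derivable; auto.
Qed.

(** The induction needs a function [f] that agrees with an algebra element only on [D]: after one
    differentiation nothing is known outside [D]. *)
Lemma falg_Ck_on k f g : falg gen g -> (forall x, D x -> f x = g x) ->
  Ck_on D k f.
Proof.
elim: k f g => [|k IH] f g ag fg /=.
  move=> x Dx; have [dg _] := falg_derive ag.
  have nfg : \near x, f x = g x by apply: filterS (open_nbhs_nbhs (conj oD Dx)) => y; exact: fg.
  rewrite /prop_for /continuous_at (fg x Dx).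
  apply: cvg_trans (differentiable_continuous (dg x Dx)).
  by apply: near_eq_cvg; apply: filterS nfg.
have [dg Hg] := falg_derive ag; split=> [x Dx|v].
  apply: near_eq_differentiable (dg x Dx).
  by apply: filterS (open_nbhs_nbhs (conj oD Dx)) => y; exact: fg.
have [g' ag' Eg] := Hg v; apply: (IH _ _ ag') => x Dx.
rewrite -Eg//; apply: near_eq_derive.
by apply: filterS (open_nbhs_nbhs (conj oD Dx)) => y; exact: fg.
Qed.

End falg_smooth.

Section vector_valued.
Context {R : realType}.

Lemma differentiable_rV (V : normedModType R) n (f : V -> 'rV[R]_n) (x : V) :
  (forall i, differentiable (fun u => f u 0 i) x) -> differentiable f x.
Proof.
move=> df; suff -> : f = \sum_i (fun u => f u 0 i *: delta_mx 0 i).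
  by apply: differentiable_sum => i; exact: differentiableZl.
by apply/funext => u; rewrite fct_sumE [LHS]row_sum_delta.
Qed.

Lemma derive_rV (V : normedModType R) n (f : V -> 'rV[R]_n) (x v : V) i :
  differentiable f x -> ('D_v f x) 0 i = 'D_v (fun u => f u 0 i) x.
Proof. by move=> /diff_derivable df; rewrite derive_mx// mxE. Qed.

Lemma falg_smooth (V : normedModType R) (gen : (V -> R) -> Prop) :
  (forall f, gen f -> (forall x, differentiable f x) /\
                     forall v, falg gen ('D_v f)) ->
  forall n (f : V -> 'rV[R]_n), (forall i, falg gen (fun u => f u 0 i)) ->
  smooth f.
Proof.
move=> genD n f + k.
have gD g : gen g -> (forall x, setT x -> differentiable g x) /\
  forall v, exists2 h, falg gen h & forall x, setT x -> 'D_v g x = h x.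
  move=> /genD[dg Hg]; split=> [x _|v]; first exact: dg.
  by exists ('D_v g).
elim: k f => [|k IH] f fa /=.
  move=> x _; apply: differentiable_continuous; apply: differentiable_rV => i.
  by have [+ _] := falg_derive gD (fa i); exact.
have df x : differentiable f x.
  by apply: differentiable_rV => i; have [+ _] := falg_derive gD (fa i); exact.
split=> [x _ //|v]; apply: IH => i.
have [_ /(_ v)[g ag Eg]] := falg_derive gD (fa i).
suff -> : (fun u => ('D_v f u) 0 i) = g by [].
by apply/funext => u; rewrite derive_rV// Eg.
Qed.

End vector_valued.

(** * Mean value theorem and monotone functions with limits at infinity *)

Section monotonicity.
Context {R : realType}.

Lemma is_derive_MVT (f f' : R -> R) (x y : R) : x <= y ->
  (forall z, x <= z <= y -> is_derive z 1 f (f' z)) ->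
  exists2 c, x <= c <= y & f y - f x = f' c * (y - x).
Proof.
move=> xy df.
have [||c cxy E] := @MVT_segment _ f f' x y xy.
- by move=> z; rewrite in_itv /= => /andP[/ltW xz /ltW zy]; apply: df; rewrite xz.
- apply: derivable_within_continuous => z zxy.
  by have [] : is_derive z 1 f (f' z) by apply: df; rewrite in_itv in zxy.
- by exists c => //; rewrite in_itv in cxy.
Qed.

Lemma is_derive_homo (f f' : R -> R) : (forall z : R, is_derive z 1 f (f' z)) ->
  (forall z, 0 < f' z) -> {homo f : x y / x < y}.
Proof.
move=> df f0 x y xy; have [c _ E] := is_derive_MVT (ltW xy) (fun z _ => df z).
by rewrite -subr_gt0 E mulr_gt0// subr_gt0.
Qed.

Lemma ndecr_cvgy_le (f f' : R -> R) (a l : R) :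
  (forall z, a <= z -> is_derive z 1 f (f' z)) ->
  (forall z, a <= z -> 0 <= f' z) -> f z @[z --> +oo] --> l ->
  forall z, a <= z -> f z <= l.
Proof.
move=> df f0 fl z az; rewrite leNgt; apply/negP => lt.
have : \forall y \near +oo, f y < f z by apply: (cvgr_lt _ fl _ lt).
move=> /(filterI (nbhs_pinfty_ge (num_real z))) /filter_ex[y [zy]].
have df' u : z <= u <= y -> is_derive u 1 f (f' u).
  by case/andP => zu _; apply: df; exact: le_trans zu.
have [c /andP[zc _] E] := is_derive_MVT zy df'.
by rewrite -subr_lt0 E ltNge mulr_ge0// ?subr_ge0// f0// (le_trans az).
Qed.

Lemma nincr_cvgNy_le (f f' : R -> R) (a l : R) :
  (forall z, z <= a -> is_derive z 1 f (f' z)) ->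
  (forall z, z <= a -> f' z <= 0) -> f z @[z --> -oo] --> l ->
  forall z, z <= a -> f z <= l.
Proof.
move=> df f0 fl z az.
have H := @ndecr_cvgy_le (fun y => f (- y)) (fun y => - f' (- y)) (- a) l.
rewrite -[z]opprK; apply: H.
- move=> y ay; rewrite -mulrN1; have d := is_deriveN' (is_derive_id' y).
  by apply: (@is_derive_scomp _ _ -%R f y 1 (f' (- y)) (-1)) d; apply: df; rewrite lerNl.
- by move=> y ay; rewrite oppr_ge0; apply: f0; rewrite lerNl.
- exact/cvgNy_compNP.
- by rewrite lerN2.
Qed.

End monotonicity.

(** * Analyticity *)

Section taylor.
Context {R : realType}.
Variables (f : R -> R) (x0 r C rho : R).
Hypothesis r0 : 0 < r.
Hypothesis rho0 : 0 < rho.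
Hypothesis fD : forall n x, `|x - x0| < r -> derivable (derive1n n f) x 1.
Hypothesis fB : forall n x, `|x - x0| < r ->
  `|derive1n n f x| <= C * rho ^+ n * n`!%:R.

(** Taylor polynomial evaluated at [b], as a function of its centre [y]. Its derivative in [y]
    telescopes to one term, so the mean value theorem in [y] gives Cauchy's form of the
    remainder. *)
Let P (b : R) n (y : R) : R :=
  \sum_(k < n) derive1n k f y * ((b - y) ^+ k / k`!%:R).

Let dP (b : R) n (y : R) : `|y - x0| < r ->
  is_derive y 1 (P b n.+1) (derive1n n.+1 f y * ((b - y) ^+ n / n`!%:R)).
Proof.
move=> yr; have dg k : is_derive y 1 (derive1n k f) (derive1n k.+1 f y).
  by rewrite derive1nS derive1E; apply: DeriveDef => //; exact: fD.
elim: n => [|n IH].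
  rewrite /P; under eq_fun do rewrite big_ord1 /= expr0 fact0 divr1 mulr1.
  by rewrite expr0 fact0 divr1 mulr1; exact: (dg 0%N).
rewrite /P; under eq_fun do rewrite big_ord_recr /=.
have dpow : is_derive y 1 (fun z => (b - z) ^+ n.+1 / n.+1`!%:R)
    (- ((b - y) ^+ n / n`!%:R)).
  have dbz := is_deriveX' n (is_deriveB' (is_derive_cst' y 1 b) (is_derive_id' y)).
  have dc := is_derive_cst' y 1 (n.+1`!%:R^-1).
  apply: (is_derive_eq (is_deriveM' dbz dc)); rewrite factS natrM invfM.
  have n0 : (n.+1%:R : R) != 0 by rewrite pnatr_eq0.
  have m0 : (n`!%:R : R) != 0 by rewrite pnatr_eq0 -lt0n fact_gt0.
  by field; rewrite m0 addrC natr1 n0.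
have H := is_deriveD' IH (is_deriveM' (dg n.+1) dpow).
by apply: (is_derive_eq H); rewrite mulrN addrA subrr add0r.
Qed.

(** Since f(b) is the Taylor polynomial centred at [b] itself, the remainder is a difference of two
    values of [P]. *)
Lemma derive_bound_analytic : analytic_at f x0.
Proof.
have C0 : 0 <= C.
  have := @fB 0%N x0; rewrite subrr normr0 => /(_ r0).
  by rewrite expr0 fact0 !mulr1; exact: le_trans.
pose a n := derive1n n f x0 / n`!%:R.
(* The Cauchy remainder keeps a factor (n+2)!/(n+1)! = n+2, at most 2^(n+2). The radius 1/(4 rho)
   leaves 4^-(n+2) against it, hence the bound C 2^-(n+2). *)
exists a, (Num.min r (4 * rho)^-1); split.
  by rewrite lt_min r0 invr_gt0 mulr_gt0.
move=> h; rewrite lt_min => /andP[hr hrho].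
have rh : rho * `|h| <= 4^-1.
  have := ltW hrho; rewrite invfM -(ler_pM2l rho0) => /le_trans; apply.
  by rewrite mulrCA mulfV ?mulr1// gt_eqF.
have bnd n : `|f (x0 + h) - pseries a h n.+2| <= C * 2^-1 ^+ n.+2.
  have -> : pseries a h n.+2 = P (x0 + h) n.+2 x0.
    rewrite /pseries /series /= big_mkord /P; apply: eq_bigr => k _.
    by rewrite /a addrAC subrr add0r mulrAC mulrA.
  have -> : f (x0 + h) = P (x0 + h) n.+2 (x0 + h).
    rewrite /P big_ord_recl /= expr0 fact0 divr1 mulr1 big1 ?addr0// => k _.
    by rewrite subrr /bump /= add1n expr0n /= mul0r mulr0.
  have step c : `|c - x0| <= `|h| -> `|x0 + h - c| <= `|h| ->
      `|derive1n n.+2 f c * ((x0 + h - c) ^+ n.+1 / n.+1`!%:R) * h| <=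
      C * 2^-1 ^+ n.+2.
    move=> cx ch; rewrite !normrM normfV normrX (ger0_norm (ler0n _ _)).
    have F0 : (0 : R) < n.+1`!%:R by rewrite ltr0n fact_gt0.
    have h1 := @fB n.+2 c (le_lt_trans cx hr).
    have h2 : `|x0 + h - c| ^+ n.+1 <= `|h| ^+ n.+1.
      by rewrite lerXn2r ?nnegrE.
    apply: (@le_trans _ _ (C * rho ^+ n.+2 * n.+2`!%:R * (`|h| ^+ n.+1 / n.+1`!%:R) * `|h|)).
      apply: ler_wpM2r => //; apply: ler_pM => //.
      by apply: ler_wpM2r => //; rewrite invr_ge0 ltW.
    have -> : C * rho ^+ n.+2 * n.+2`!%:R * (`|h| ^+ n.+1 / n.+1`!%:R) * `|h|
        = C * (n.+2%:R * (rho * `|h|) ^+ n.+2).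
      rewrite factS natrM exprMn [`|h| ^+ n.+2]exprSr; field.
      by rewrite gt_eqF.
    apply: ler_wpM2l => //.
    apply: (@le_trans _ _ (2 ^+ n.+2 * 4^-1 ^+ n.+2)).
      apply: ler_pM => //; first by rewrite exprn_ge0// mulr_ge0// ltW.
        by rewrite -natrX ler_nat ltnW// ltn_expl.
      by rewrite lerXn2r// nnegrE// mulr_ge0// ltW.
    rewrite -exprMn; have -> // : 2 * 4^-1 = 2^-1 :> R by field.
  have PD c : `|c - x0| <= `|h| ->
      is_derive c 1 (P (x0 + h) n.+2) (derive1n n.+2 f c * ((x0 + h - c) ^+ n.+1 / n.+1`!%:R)).
    by move=> cx; apply: dP; exact: le_lt_trans hr.
  have [h0|h0] := leP 0 h.
  - have [|||c] := @MVT_segment _ (P (x0 + h) n.+2) (fun c => derive1n n.+2 f c * ((x0 + h - c) ^+ n.+1 / n.+1`!%:R)) x0 (x0 + h).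
    + by rewrite lerDl.
    + move=> x /[!in_itv]/= /andP[xl xr]; apply: PD.
      rewrite !ger0_norm//; lra.
    + apply: derivable_within_continuous => x /[!in_itv]/= /andP[xl xr].
      have /PD[] // : `|x - x0| <= `|h| by rewrite !ger0_norm//; lra.
    + rewrite in_itv /= => /andP[xl xr] ->.
      have -> : x0 + h - x0 = h by ring.
      by apply: step; rewrite !ger0_norm//; lra.
  - have [|||c] := @MVT_segment _ (P (x0 + h) n.+2) (fun c => derive1n n.+2 f c * ((x0 + h - c) ^+ n.+1 / n.+1`!%:R)) (x0 + h) x0.
    + by rewrite gerDl ltW.
    + move=> x /[!in_itv]/= /andP[xl xr]; apply: PD.
      rewrite !ler0_norm//; lra.
    + apply: derivable_within_continuous => x /[!in_itv]/= /andP[xl xr].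
      have /PD[] // : `|x - x0| <= `|h| by rewrite !ler0_norm//; lra.
    + rewrite in_itv /= => /andP[xl xr] E; rewrite distrC E.
      have -> : x0 - (x0 + h) = - h by ring.
      by rewrite mulrN normrN; apply: step; rewrite !ler0_norm//; lra.
rewrite -(cvg_shiftn 2); apply/cvgrPdist_le => e e0.
have /cvgrPdist_le/(_ _ e0) : (fun n => C * 2^-1 ^+ n.+2) @ \oo --> (0 : R).
  rewrite -[0](mulr0 C); apply: cvgMr.
  have := @cvg_expr R 2^-1; rewrite ger0_norm ?invr_ge0// invf_lt1// ltr1n => /(_ isT).
  by rewrite -(cvg_shiftn 2); under eq_fun do rewrite addn2.
apply: filterS => n Hn; have := bnd n; rewrite -addn2 => /le_trans; apply.
apply: le_trans Hn; rewrite sub0r normrN addn2; exact: ler_norm.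
Qed.

End taylor.

Lemma analytic_at_near_eq (R : realType) (f g : R -> R) (x : R) :
  (\near x, f x = g x) -> analytic_at f x -> analytic_at g x.
Proof.
move=> /nbhs_ballP[e /= e0 fg] [a [r [r0 H]]].
exists a, (Num.min r e); split; first by rewrite lt_min r0.
move=> h; rewrite lt_min => /andP[hr he].
rewrite -fg; first exact: H.
by rewrite /ball /= opprD addNKr normrN.
Qed.

(** * Degree and coefficient counts for iterated derivatives *)

Section balg.
Context {R : realType} (n : nat) (gen : 'I_n -> R -> R).
Variables (m : nat) (M : R).
Hypothesis M0 : 0 <= M.

(* [balg d a f]: [f] is a polynomial in the generators, of degree at most [d]
   and with sum of absolute values of coefficients at most [a]. *)
Inductive balg : nat -> R -> (R -> R) -> Prop :=
| balg_gen i : balg 1 1 (gen i)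
| balg_cst a : balg 0 `|a| (fun=> a)
| balg_add d a b f g : balg d a f -> balg d b g -> balg d (a + b) (fun x => f x + g x)
| balg_mul d e a b f g : balg d a f -> balg e b g ->
    balg (d + e) (a * b) (fun x => f x * g x)
| balg_le d e a b f : (d <= e)%N -> a <= b -> balg d a f -> balg e b f.

Lemma balg_ge0 d a f : balg d a f -> 0 <= a.
Proof.
elim=> // [*|*|{}d e {}a b {}f _ ab _ IH]; [exact: addr_ge0|exact: mulr_ge0|].
exact: le_trans ab.
Qed.

Lemma balg_bound (I : set R) (B : R) : 1 <= B ->
  (forall i x, I x -> `|gen i x| <= B) ->
  forall d a f, balg d a f -> forall x, I x -> `|f x| <= a * B ^+ d.
Proof.
move=> B1 gB d a f; elim=> {d a f}.
- by move=> i x Ix; rewrite mul1r expr1; exact: gB.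
- by move=> a x _; rewrite expr0 mulr1.
- move=> d a b f g _ IHf _ IHg x Ix; rewrite mulrDl.
  by apply: le_trans (ler_normD _ _) _; apply: lerD; auto.
- move=> d e a b f g _ IHf _ IHg x Ix; rewrite normrM exprD mulrACA.
  by apply: ler_pM => //; auto.
- move=> d e a b f de ab /balg_ge0 a0 IH x Ix; apply: le_trans (IH x Ix) _.
  by apply: ler_pM => //; [rewrite exprn_ge0// (le_trans _ B1)|exact: ler_weXn2l].
Qed.

(** Leibniz: a monomial of degree d offers d places to differentiate, and each replaces one
    generator by a polynomial of degree m+1 and coefficient sum [M]. *)
Lemma balg_derive (I : set R) :
  (forall i, exists2 g, balg m.+1 M g & forall x, I x -> is_derive x 1 (gen i) (g x)) ->
  forall d a f, balg d a f -> exists2 g, balg (d + m) (d%:R * a * M) g &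
    forall x, I x -> is_derive x 1 f (g x).
Proof.
move=> genD d a f; elim=> {d a f}.
- by move=> i; have [g bg Hg] := genD i; exists g => //; rewrite !mul1r.
- move=> a; exists (fun=> 0) => [|x _]; last exact: is_derive_cst'.
  by apply: balg_le (balg_cst 0) => //; rewrite normr0 !mul0r.
- move=> d a b f g _ [f' bf Df] _ [g' bg Dg].
  exists (fun x => f' x + g' x) => [|x Ix]; last by apply: is_deriveD'; auto.
  by rewrite mulrDr mulrDl; exact: balg_add.
- move=> d e a b f g bf [f' bf' Df] bg [g' bg' Dg].
  exists (fun x => f x * g' x + f' x * g x) => [|x Ix]; last by apply: is_deriveM'; auto.
  have -> : (d + e)%:R * (a * b) * M = a * (e%:R * b * M) + d%:R * a * M * b.
    by rewrite natrD; ring.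
  apply: balg_add.
  + by apply: balg_le (balg_mul bf bg'); rewrite ?addnA.
  + by apply: balg_le (balg_mul bf' bg); rewrite // addnAC.
- move=> d e a b f de ab ba [f' bf' Df]; exists f' => //.
  have a0 := balg_ge0 ba.
  apply: balg_le bf'; first by rewrite leq_add2r.
  by apply: ler_wpM2r => //; apply: ler_pM => //; rewrite ler_nat.
Qed.

End balg.

Definition isgen (R : realType) n (gen : 'I_n -> R -> R) (f : R -> R) :=
  exists i, f = gen i.

Section analytic_falg.
Context {R : realType} (n : nat) (gen : 'I_n -> R -> R).

Lemma falg_balg f : falg (isgen gen) f -> exists d a, balg gen d a f.
Proof.
elim=> {f}.
- by move=> _ [i ->]; exists 1%N, 1; exact: balg_gen.
- by move=> a; exists 0%N, `|a|; exact: balg_cst.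
- move=> f g _ [d [a bf]] _ [e [b bg]]; exists (maxn d e), (a + b).
  by apply: balg_add; [apply: balg_le bf|apply: balg_le bg]; rewrite ?leq_maxl ?leq_maxr.
- move=> f g _ [d [a bf]] _ [e [b bg]]; exists (d + e)%N, (a * b).
  exact: balg_mul.
Qed.

(** After k derivatives the degree is at most d0 + k m, and the coefficient sum is at most a0 times
    a product of k factors growing linearly. That product is of size rho^k k!, the growth
    [derive_bound_analytic] accepts. *)
Lemma falg_analytic (dgen : 'I_n -> R -> R) (x0 : R) :
  (\forall x \near x0, forall i, is_derive x (1 : R) (gen i) (dgen i x)) ->
  (forall i, falg (isgen gen) (dgen i)) ->
  forall f, falg (isgen gen) f -> analytic_at f x0.
Proof.
move=> genD dgenA f /falg_balg[d0 [a0 bf]].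
have [m [M [M0 mM]]] : exists m M, 0 <= M /\ forall i, balg gen m.+1 M (dgen i).
  have /choice[d /choice[a bd]] : forall i, exists d, exists a, balg gen d a (dgen i).
    by move=> i; exact: falg_balg.
  exists (\max_i d i), (\sum_i a i); split.
    by apply: sumr_ge0 => i _; exact: balg_ge0 (bd i).
  move=> i; apply: balg_le (bd i).
    by rewrite ltnW// ltnS; exact: leq_bigmax.
  rewrite (bigD1 i)//= lerDl; apply: sumr_ge0 => j _; exact: balg_ge0 (bd j).
(* A bound valid for all generators near [x0]; being at least 1, it has powers monotone in the
   degree. *)
pose B : R := 1 + \sum_i (`|gen i x0| + 1).
have B1 : 1 <= B by rewrite lerDl; apply: sumr_ge0 => i _; exact: addr_ge0.
have nB : \forall x \near x0, forall i, `|gen i x| <= B.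
  apply: (@filter_forall _ _ (fun i x => `|gen i x| <= B) (nbhs x0) _) => i.
  have ci : {for x0, continuous (gen i)}.
    by have /nbhs_singleton/(_ i)/is_derive_continuous := genD.
  have /cvgr_dist_lt/(_ _ ltr01) := ci; apply: filterS => x /ltW xi.
  apply: (@le_trans _ _ (`|gen i x0| + 1)).
    by rewrite -[gen i x](subKr (gen i x0)) (le_trans (ler_normB _ _))// lerD2l.
  by rewrite /B (bigD1 i)//= addrCA lerDl addr_ge0// sumr_ge0// => j _; exact: addr_ge0.
have [r /= r0 Ir] := (nbhs_ballP _ _).1 (filterI genD nB).
pose I := [set x | `|x - x0| < r].
have oI : open I.
  suff -> : I = ball x0 r by exact: ball_open.
  by apply/seteqP; split=> x; rewrite /I /ball /= distrC.
have Igen i : exists2 g, balg gen m.+1 M g & forall x, I x -> is_derive x 1 (gen i) (g x).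
  by exists (dgen i) => // x Ix; apply: (Ir x _).1; rewrite /ball /= distrC.
have IB i x : I x -> `|gen i x| <= B.
  by move=> Ix; apply: (Ir x _).2; rewrite /ball /= distrC.
(* The coefficient bound obtained by iterating [balg_derive]: step j multiplies by the current
   degree d0 + j m and by [M]. *)
pose K : nat -> R := fun k => iteri k (fun j a => (d0 + j * m)%:R * a * M) a0.
have H k : exists2 g, balg gen (d0 + k * m) (K k) g &
    forall x, I x -> derive1n k f x = g x.
  elim: k => [|k [g bg Eg]]; first by exists f => //; rewrite mul0n addn0.
  have [g' bg' Dg] := balg_derive M0 Igen bg.
  exists g' => [|x Ix]; first by rewrite mulSn [(m + _)%N]addnC addnA.
  rewrite derive1nS derive1E; have [_ <-] := Dg x Ix.
  by apply: near_eq_derive; apply: filterS (open_nbhs_nbhs (conj oI Ix)).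
have a00 := balg_ge0 bf.
(* From d0 + k m <= (d0 + m + 1)(k + 1) the factors combine to (M (d0 + m + 1))^k k!, and B^m
   accounts for the growing degree. The summand 1 only makes [rho] positive. *)
pose rho := M * (d0 + m.+1)%:R * B ^+ m + 1.
have KB k : K k <= a0 * (M * (d0 + m.+1)%:R) ^+ k * k`!%:R.
  elim: k => [|k IH]; first by rewrite expr0 fact0 !mulr1.
  rewrite /K /= -/(K k) exprS factS natrM.
  have -> : a0 * (M * (d0 + m.+1)%:R * (M * (d0 + m.+1)%:R) ^+ k) * (k.+1%:R * k`!%:R) =
    ((d0 + m.+1)%:R * k.+1%:R) * (a0 * (M * (d0 + m.+1)%:R) ^+ k * k`!%:R) * M by ring.
  apply: ler_wpM2r => //; apply: ler_pM => //.
    by have [g /balg_ge0] := H k.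
  rewrite -natrM ler_nat mulnDl leq_add//; first by rewrite leq_pmulr.
  by rewrite mulnC leq_mul.
apply: (@derive_bound_analytic _ f x0 r (a0 * B ^+ d0) rho).
- exact: r0.
- by rewrite /rho ltr_wpDl// mulr_ge0 ?mulr_ge0// exprn_ge0// (le_trans _ B1).
- move=> k x xr; have [g bg Eg] := H k; have [g' _ Dg] := balg_derive M0 Igen bg.
  have [+ _] := Dg x xr; apply: near_eq_derivable.
  by apply: filterS (open_nbhs_nbhs (conj oI xr)) => y /Eg.
- move=> k x xr; have [g bg Eg] := H k; rewrite (Eg x xr).
  apply: le_trans (balg_bound B1 IB bg xr) _.
  apply: (@le_trans _ _ (a0 * (M * (d0 + m.+1)%:R) ^+ k * k`!%:R * B ^+ (d0 + k * m))).
    by apply: ler_wpM2r => //; rewrite exprn_ge0// (le_trans _ B1).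
  rewrite exprD mulnC exprM.
  have -> : a0 * (M * (d0 + m.+1)%:R) ^+ k * k`!%:R * (B ^+ d0 * (B ^+ m) ^+ k) =
     a0 * B ^+ d0 * (M * (d0 + m.+1)%:R * B ^+ m) ^+ k * k`!%:R.
    by rewrite [(_ * B ^+ m) ^+ k]exprMn; ring.
  have Bm0 e : 0 <= B ^+ e by rewrite exprn_ge0// (le_trans _ B1).
  apply: ler_wpM2r => //; apply: ler_wpM2l; first by rewrite mulr_ge0.
  by rewrite lerXn2r// ?nnegrE /rho ?addr_ge0 ?mulr_ge0// lerDl.
Qed.

End analytic_falg.

(** Dropping the constant coefficient and shifting the others divides the power series by x - x0.
    This splits a pole into its principal part and an analytic remainder. *)
Lemma analytic_at_divided_difference (R : realType) (f : R -> R) (x0 : R) :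
  analytic_at f x0 ->
  exists2 g, analytic_at g x0 & forall x, x != x0 -> g x = (f x - f x0) / (x - x0).
Proof.
move=> [a [r [r0 H]]].
have a0 : a 0%N = f x0.
  have := H 0; rewrite normr0 addr0 => /(_ r0).
  rewrite -(cvg_shiftn 1) => fx0; apply: (cvg_unique _ _ fx0); first exact: Rhausdorff.
  rewrite [X in X @ _](_ : _ = fun=> a 0%N); first exact: cvg_cst.
  apply/funext => n; rewrite /pseries /series /= addn1 big_nat_recl//= expr0 mulr1.
  by rewrite big1 ?addr0// => i _; rewrite expr0n/= mulr0.
exists (fun x => if x == x0 then a 1%N else (f x - f x0) / (x - x0)); last first.
  by move=> x /negbTE ->.
exists (fun n => a n.+1), r; split=> // h hr.
have [->|h0] := eqVneq h 0.
  rewrite addr0 eqxx -(cvg_shiftn 1).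
  rewrite [X in X @ _](_ : _ = fun=> a 1%N); first exact: cvg_cst.
  apply/funext => n; rewrite /pseries /series /= addn1 big_nat_recl//= expr0 mulr1.
  by rewrite big1 ?addr0// => i _; rewrite expr0n/= mulr0.
rewrite -[X in _ == X]addr0 (inj_eq (addrI x0)) (negbTE h0) [X in _ / X]addrAC subrr add0r -a0.
have -> : pseries (fun n => a n.+1) h = (fun n => (pseries a h n.+1 - a 0%N) / h).
  apply/funext => n; rewrite /pseries /series /= [in RHS]big_nat_recl//= expr0 mulr1.
  rewrite addrAC subrr add0r mulr_suml; apply: eq_bigr => i _.
  by rewrite exprSr mulrA mulfK.
apply: cvgMl; apply: cvgB; last exact: cvg_cst.
have := H h hr; rewrite -(cvg_shiftn 1).
by under eq_fun do rewrite addn1.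
Qed.

(** * Determinants and definite matrices *)

Section linear_algebra.
Context {R : realType}.

Definition qform n (A : 'M[R]_n) (v : 'rV[R]_n) : R := (v *m A *m v^T) 0 0.

(** Completing the square in the first coordinate leaves the Schur complement. *)
Lemma qform_block n (a : R) (r : 'rV[R]_n) (A : 'M[R]_n) (x : R) (y : 'rV[R]_n) :
  a != 0 ->
  qform (block_mx a%:M r r^T A : 'M[R]_(1 + n)) (row_mx x%:M y) =
  a * (x + a^-1 * (r *m y^T) 0 0) ^+ 2 + qform (A - a^-1 *: (r^T *m r)) y.
Proof.
move=> a0; rewrite /qform mul_row_block tr_row_mx mul_row_col !mulmxDl.
rewrite tr_scalar_mx !mul_mx_scalar !mul_scalar_mx mulmxBr mulmxBl.
rewrite -!scalemxAl -!scalemxAr -scalemxAl !mulmxA.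
have E : y *m r^T = (r *m y^T)^T by rewrite trmx_mul trmxK.
rewrite -[y *m r^T *m r *m y^T]mulmxA E.
set s := r *m y^T.
have Es : s^T *m s = (s 0 0 ^+ 2)%:M.
  by rewrite {1 2}[s]mx11_scalar tr_scalar_mx -scalar_mxM expr2.
by rewrite Es !mxE /= !mulr1n; field.
Qed.

Lemma det_schur n (a : R) (r : 'rV[R]_n) (A : 'M[R]_n) : a != 0 ->
  \det (block_mx a%:M r r^T A : 'M[R]_(1 + n)) = a * \det (A - a^-1 *: (r^T *m r)).
Proof.
move=> a0.
have -> : (block_mx a%:M r r^T A : 'M[R]_(1 + n)) =
   block_mx 1%:M 0 (a^-1 *: r^T) 1%:M *m
   block_mx a%:M r 0 (A - a^-1 *: (r^T *m r)).
  rewrite mulmx_block !mul1mx !mul0mx !addr0.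
  by rewrite mul_mx_scalar scalerA mulfV// scale1r -scalemxAl subrKC.
by rewrite det_mulmx det_lblock det_ublock !det1 !mul1r det_scalar1.
Qed.

(** Induction on the dimension: the first pivots are ordered, and so are the Schur complements,
    because each is the minimum of its form over the first coordinate. *)
Lemma det_posdef_le n (A B : 'M[R]_n) : posdefmx B -> A^T = A ->
  (forall v, qform B v <= qform A v) -> 0 < \det B <= \det A.
Proof.
elim: n A B => [|n IH] A B; first by rewrite !det_mx00 ltr01 lexx.
rewrite -[n.+1]/(1 + n)%N in A B *.
have blk (M : 'M[R]_(1 + n)) : M^T = M ->
    M = block_mx (M 0 0)%:M (ursubmx M) (ursubmx M)^T (drsubmx M) /\
    (drsubmx M)^T = drsubmx M.
  move=> MT; split; last by rewrite trmx_drsub MT.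
  rewrite trmx_ursub MT -[in LHS](submxK M); congr block_mx.
  by rewrite [LHS]mx11_scalar !mxE; congr (M _ _)%:M; apply/val_inj.
move=> [BT B0] AT BA.
have [EA AT'] := blk A AT; have [EB BT'] := blk B BT.
move: EA EB AT' BT'; set a := A 0 0; set b := B 0 0.
set ra := ursubmx A; set rb := ursubmx B; set A' := drsubmx A; set B' := drsubmx B.
move=> EA EB AT' BT'.
have Eb : qform B (row_mx 1%:M 0) = b.
  rewrite EB /qform mul_row_block tr_row_mx mul_row_col !mul1mx !mul0mx !addr0.
  by rewrite trmx0 mulmx0 trmx1 mulmx1 addr0 !mxE /= mulr1n.
have Ea : qform A (row_mx 1%:M 0) = a.
  rewrite EA /qform mul_row_block tr_row_mx mul_row_col !mul1mx !mul0mx !addr0.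
  by rewrite trmx0 mulmx0 trmx1 mulmx1 addr0 !mxE /= mulr1n.
have b0 : 0 < b.
  rewrite -Eb; apply: B0; apply/eqP => /rowP/(_ (lshift n 0)).
  by rewrite (row_mxEl (1%:M : 'M[R]_1)) !mxE eqxx => /eqP; rewrite oner_eq0.
have ba : b <= a by rewrite -Eb -Ea.
have a0 : 0 < a by exact: lt_le_trans ba.
have [an bn] : a != 0 /\ b != 0 by rewrite !gt_eqF.
pose SA := A' - a^-1 *: (ra^T *m ra); pose SB := B' - b^-1 *: (rb^T *m rb).
have SAT : SA^T = SA by rewrite /SA linearB linearZ /= trmx_mul trmxK AT'.
have SBT : SB^T = SB by rewrite /SB linearB linearZ /= trmx_mul trmxK BT'.
have H := IH SA SB.
have /H{}H : posdefmx SB.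
  split=> // v v0; have := B0 (row_mx (- (b^-1 * (rb *m v^T) 0 0))%:M v).
  rewrite -/(qform B _) EB qform_block// addNr expr0n mulr0 add0r; apply.
  by apply: contraNneq v0 => /(congr1 rsubmx); rewrite row_mxKr linear0 => ->.
have {H}/andP[S0 SS] : 0 < \det SB <= \det SA.
  (* The first coordinate is the minimiser for [A]. There the form of [A] equals that of [SA], while
     the form of [B] is that of [SB] plus a square. *)
  apply: H => // v; have := BA (row_mx (- (a^-1 * (ra *m v^T) 0 0))%:M v).
  rewrite EA EB !qform_block// addNr expr0n mulr0 add0r; apply: le_trans.
  by rewrite lerDr mulr_ge0 ?sqr_ge0// ltW.
rewrite EA EB !det_schur// mulr_gt0//=.
by apply: ler_pM => //; exact: ltW.
Qed.

(** In dimension 3 the kernel of a nonzero covector has rank 2, so a rank 2 row space inside it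
    fills it. Tangency thus becomes a single scalar equation. *)
Lemma submx_conormal (A : 'M[R]_(2, 3)) (nu : 'cV[R]_3) (v : 'rV[R]_3) :
  row_free A -> nu != 0 -> A *m nu = 0 -> v *m nu = 0 -> (v <= A)%MS.
Proof.
move=> /eqP rA nu0 Anu vnu.
have An : (A <= kermx nu)%MS by apply/sub_kermxP.
have rk : \rank (kermx nu) = 2%N.
  rewrite mxrank_ker; suff -> : \rank nu = 1%N by [].
  apply/eqP; rewrite eqn_leq (leq_trans (rank_leq_col _))//= lt0n.
  by rewrite mxrank_eq0.
have vk : (v <= kermx nu)%MS by apply/sub_kermxP.
apply: submx_trans vk _.
by have := mxrank_leqif_sup An => -[_ <-]; rewrite rA rk.
Qed.

End linear_algebra.

(** * Uniqueness of the potential *)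

Section second_order.
Context {R : realType}.

Lemma is_derive_along (V W : normedModType R) (F : V -> W) (c v : V) (s : R) :
  differentiable F (c + s *: v) ->
  is_derive s 1 (fun t : R => F (c + t *: v)) ('D_v F (c + s *: v)).
Proof.
move=> dF; have /derivableP/is_derive_lineP H := @diff_derivable _ _ _ F _ v dF.
apply/is_derive_lineP; move: H; congr (is_derive _ _ _ _).
apply/funext => h; congr F.
by rewrite scalerDl [h%:A]mulr1 addrCA.
Qed.

Lemma derive_basis n (F : 'rV[R]_n -> R) (x v : 'rV[R]_n) : differentiable F x ->
  'D_v F x = \sum_i v 0 i * 'D_('e_i) F x.
Proof.
move=> dF; rewrite deriveE// {1}(row_sum_delta v) linear_sum; apply: eq_bigr => i _.
by rewrite linearZ /= deriveE.
Qed.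

Lemma derive2_Hessian n (U : set 'rV[R]_n) (F : 'rV[R]_n -> R) (x v : 'rV[R]_n) :
  open U -> (forall y, U y -> differentiable F y) ->
  (forall i, differentiable ('D_('e_i) F) x) -> U x ->
  is_derive x v ('D_v F) (qform (Hessian F x) v).
Proof.
move=> oU dF d2F Ux.
apply: (@near_eq_is_derive _ _ _ (\sum_i (fun y => v 0 i *: 'D_('e_i) F y))).
  apply: filterS (open_nbhs_nbhs (conj oU Ux)) => y Uy.
  by rewrite derive_basis ?fct_sumE//; exact: dF.
have -> : qform (Hessian F x) v = \sum_i v 0 i *: 'D_v ('D_('e_i) F) x.
  rewrite /qform mxE.
  under eq_bigr => j _.
    rewrite !mxE big_distrl /=; over.
  rewrite exchange_big /=; apply: eq_bigr => i _.
  rewrite derive_basis// /GRing.scale /= big_distrr /=; apply: eq_bigr => j _.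
  by rewrite !mxE; ring.
by apply: is_derive_sum => i; apply: is_deriveZ; exact/derivableP/diff_derivable.
Qed.

(** At the minimum [g1] vanishes; if [g2] were negative, [g1] would be negative just to the right of
    0, and [g] would drop below its minimum. *)
Lemma local_min_derive2 (g g1 : R -> R) (g2 : R) :
  (\forall s \near (0 : R), is_derive s (1 : R) g (g1 s)) ->
  is_derive (0 : R) (1 : R) g1 g2 ->
  (\forall s \near (0 : R), g 0 <= g s) -> 0 <= g2.
Proof.
move=> dg dg1 gmin; rewrite leNgt; apply/negP => g20.
have [e /= e0 H] := (nbhs_ballP _ _).1 (filterI dg gmin).
have be (s : R) : `|s| < e -> ball 0 e s by rewrite -ball_normE /ball_ /= sub0r normrN.
have e2 : 0 < e / 2 by rewrite divr_gt0.
have d0 : is_derive (0 : R) 1 g 0.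
  apply: (@derive1_at_min R g (- e) e 0).
  - by rewrite ge0_cp// ltW.
  - move=> t /[!in_itv]/= te; have [+ _] : is_derive t 1 g (g1 t); last exact.
    by apply: (H t _).1; apply: be; rewrite ltr_norml.
  - by rewrite in_itv /= oppr_lt0 e0.
  - move=> t /[!in_itv]/= te.
    by apply: (H t _).2; apply: be; rewrite ltr_norml.
have g10 : g1 0 = 0.
  apply: is_derive_unique d0; apply: (H 0 _).1; apply: be; rewrite normr0//.
have gr : h^-1 *: (g1 (h *: 1 + 0) - g1 0) @[h --> 0^'] --> g2.
  by have [+ <-] := dg1.
(* The margin: for small c the quotient g1(c)/c lies below g2/2 < 0. *)
have g22 : g2 < g2 / 2 by lra.
have [r /= r0 Hr] := (nbhs_ballP _ _).1 (cvgr_lt _ gr _ g22).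
pose s := Num.min r e / 2.
have [mr me m0] : [/\ Num.min r e <= r, Num.min r e <= e & 0 < Num.min r e].
  by rewrite !ge_min !lexx orbT lt_min r0 e0.
have [s0 sr se] : [/\ 0 < s, s < r & s < e] by rewrite /s; split; lra.
have Dg (t : R) : `|t| <= s -> is_derive t 1 g (g1 t).
  by move=> ts; apply: (H t _).1; apply: be; exact: le_lt_trans se.
have [||c] := @MVT _ g g1 0 s s0.
- move=> t /[!in_itv]/= /andP[t0 ts]; apply: Dg.
  by rewrite gtr0_norm// ltW.
- apply: derivable_within_continuous => t /[!in_itv]/= /andP[t0 ts].
  by have [] : is_derive t 1 g (g1 t) by apply: Dg; rewrite ger0_norm.
rewrite in_itv /= => /andP[c0 cs].
rewrite subr0 => E.
have := (H s (be s _)).2; rewrite gtr0_norm// => /(_ se); rewrite -subr_ge0 E.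
have : g1 c < 0.
  have := Hr c; rewrite g10 addr0 subr0 [c%:A]mulr1 /= => /(_ _ _).
  rewrite -ball_normE /ball_ /= sub0r normrN gtr0_norm// => /(_ (lt_trans cs sr)).
  rewrite gt_eqF// => /(_ isT) {}Hr.
  have : c^-1 * g1 c < 0 by apply: (lt_le_trans Hr); lra.
  by rewrite pmulr_rlt0// invr_gt0.
by move=> g1c; rewrite pmulr_lge0// leNgt g1c.
Qed.
End second_order.

(** Eliminating either diagonal block of the same matrix gives the two sides. *)
Lemma det_add_rank1 (R : realType) n (l : 'cV[R]_n) (d : 'rV[R]_n) :
  \det (1%:M + l *m d) = 1 + (d *m l) 0 0.
Proof.
pose M : 'M[R]_(1 + n) := block_mx 1%:M (- d) l 1%:M.
have <- : \det M = \det (1%:M + l *m d).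
  have -> : M = block_mx 1%:M 0 l 1%:M *m block_mx 1%:M (- d) 0 (1%:M + l *m d).
    rewrite mulmx_block !mul1mx !mul0mx !addr0 !mulmx1 !mulmxN.
    by rewrite addrCA addNr addr0.
  by rewrite det_mulmx det_lblock det_ublock !det1 !mul1r.
have -> : M = block_mx (1%:M + d *m l) (- d) 0 1%:M *m block_mx 1%:M 0 l 1%:M.
  rewrite mulmx_block !mulmx1 !mul1mx !mulmx0 !add0r !mulNmx.
  by rewrite addrK.
rewrite det_mulmx det_lblock det_ublock !det1 !mulr1 det_mx11.
by rewrite !mxE.
Qed.

(* The perturbations [x + e (x l) d] map K minus the origin into the interior of K,
   so that a potential composed with them stays bounded at the boundary of K. *)
Section comparison.
Context {R : realType} (n : nat) (K : set 'rV[R]_n) (l : 'cV[R]_n) (d : 'rV[R]_n).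
Variable C : R.
Variable U : set 'rV[R]_n.
Hypothesis UE : interior K = U.
Hypothesis cK : closed K.
Hypothesis int0 : ~ U 0.
Hypothesis intZ : forall (a : R) x, 0 < a -> U x -> U (a *: x).
Hypothesis l_gt0 : forall x, K x -> x != 0 -> 0 < (x *m l) 0 0.
Hypothesis l_bound : forall x, K x -> `|x| <= C * (x *m l) 0 0.
Hypothesis dl_ge0 : 0 <= (d *m l) 0 0.
Hypothesis push_in : forall (e : R) x, 0 < e -> K x -> x != 0 ->
  U (x + (e * (x *m l) 0 0) *: d).

Let L (e : R) : 'M[R]_n := 1%:M + e *: (l *m d).

Let mulL e x : x *m L e = x + (e * (x *m l) 0 0) *: d.
Proof.
rewrite mulmxDr mulmx1 -scalemxAr mulmxA; congr (_ + _).
by rewrite {1}[x *m l]mx11_scalar mul_scalar_mx scalerA.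
Qed.

Let detL e : \det (L e) = 1 + e * (d *m l) 0 0.
Proof. by rewrite /L scalemxAl det_add_rank1 -scalemxAr mxE. Qed.

Let KI x : U x -> K x. Proof. by rewrite -UE; exact: interior_subset. Qed.

Let KI0 x : U x -> x != 0.
Proof. by apply: contraPneq => ->. Qed.

Let contL x : continuous (fun y : 'rV[R]_n => y *m L x).
Proof.
move=> y.
apply: (@differentiable_continuous _ _ _ _ (fun y : 'rV[R]_n => y *m L x)).
apply: differentiable_rV => i.
have -> : (fun u : 'rV[R]_n => (u *m L x) 0 i) =
    \sum_k (fun u : 'rV[R]_n => L x k i *: u 0 k).
  apply/funext => u; rewrite fct_sumE mxE.
  by apply: eq_bigr => k _; rewrite /GRing.scale /= mulrC.
apply: differentiable_sum => k; apply: differentiableZ; exact: differentiable_coord.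
Qed.

Let potU F : canonical_potential K F ->
  [/\ forall x, U x -> differentiable F x /\ forall i, differentiable ('D_('e_i) F) x,
      forall x, U x -> posdefmx (Hessian F x),
      forall x, U x -> \det (Hessian F x) = expR (2 * F x),
      forall b, K b -> ~ U b -> F x @[x --> within U (nbhs b)] --> +oo &
      forall (a : R) x, 0 < a -> U x -> F (a *: x) = F x - n%:R * ln a].
Proof.
rewrite /canonical_potential /boundary UE => -[[dF d2F] H1 H2 H3 H4]; split.
- by move=> x Ux; split=> [|i]; [exact: dF|have [+ _] := d2F 'e_i; exact].
- exact: H1.
- exact: H2.
- by move=> b Kb Ub; apply: H3; split; [exact: subset_closure|exact: Ub].
- exact: H4.
Qed.

Section potentials.
Variables F1 F2 : 'rV[R]_n -> R.
Hypothesis cF1 : canonical_potential K F1.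
Hypothesis cF2 : canonical_potential K F2.

Let dF1 x : U x -> differentiable F1 x.
Proof. by have [+ _ _ _ _] := potU cF1 => H Ux; have [] := H x Ux. Qed.
Let dF2 x : U x -> differentiable F2 x.
Proof. by have [+ _ _ _ _] := potU cF2 => H Ux; have [] := H x Ux. Qed.
Let d2F1 i x : U x -> differentiable ('D_('e_i) F1) x.
Proof. by have [+ _ _ _ _] := potU cF1 => H Ux; have [_] := H x Ux. Qed.
Let d2F2 i x : U x -> differentiable ('D_('e_i) F2) x.
Proof. by have [+ _ _ _ _] := potU cF2 => H Ux; have [_] := H x Ux. Qed.

Variable e : R.
Hypothesis e0 : 0 < e.

Let intL x : K x -> x != 0 -> U (x *m L e).
Proof. by move=> Kx x0; rewrite mulL; exact: push_in. Qed.

Let dL0 : 0 < \det (L e).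
Proof. by rewrite detL ltr_pwDl// mulr_ge0// ltW. Qed.

(** The subtracted function again solves the Monge-Ampere equation: composing with [L e] multiplies
    the determinant of the Hessian by the square of det L, which the summand ln det L absorbs. *)
Let D (x : 'rV[R]_n) := F1 x - (F2 (x *m L e) + ln (\det (L e))).

Let contG x : K x -> x != 0 -> {for x, continuous (fun x : 'rV[R]_n => F2 (x *m L e) + ln (\det (L e)))}.
Proof.
move=> Kx x0; apply: continuousD; last exact: cst_continuous.
apply: (@continuous_comp _ _ _ (fun y : 'rV[R]_n => y *m L e) F2 x); first exact: contL.
by apply: differentiable_continuous; apply: dF2; exact: intL.
Qed.

Let contD x : U x -> {for x, continuous D}.
Proof.
move=> Kx; apply: continuousB; first by apply: differentiable_continuous; exact: dF1.
by apply: contG; [exact: KI|exact: KI0].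
Qed.

Let DZ (a : R) x : 0 < a -> U x -> D (a *: x) = D x.
Proof.
have [_ _ _ _ H1] := potU cF1; have [_ _ _ _ H2] := potU cF2 => a0 Kx.
rewrite /D H1// -scalemxAl H2//; last by apply: intL; [exact: KI|exact: KI0].
ring.
Qed.

(** [D] is constant on rays, so it may be minimised on the slice where [l] equals 1, which is
    bounded by [l_bound]. It tends to +oo at the boundary of K because F1 does, while the subtracted
    term stays continuous there. *)
Let exists_min : (exists x, U x) ->
  exists2 c, U c & forall x, U x -> D c <= D x.
Proof.
move=> [x1 Kx1].
pose nrm (x : 'rV[R]_n) := ((x *m l) 0 0)^-1 *: x.
have nrmP x : U x -> [/\ U (nrm x), (nrm x *m l) 0 0 = 1 & D (nrm x) = D x].
  move=> Kx; have lx : 0 < (x *m l) 0 0 by apply: l_gt0; [exact: KI|exact: KI0].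
  have lx' : 0 < ((x *m l) 0 0)^-1 by rewrite invr_gt0.
  split; [exact: intZ| |exact: DZ].
  by rewrite -scalemxAl mxE mulVf// gt_eqF.
pose x0 := nrm x1; have [Kx0 lx0 _] := nrmP _ Kx1.
(* A sublevel set of [D] on the slice; only its closedness at points outside [U] uses the boundary
   condition. *)
pose A := [set x | [/\ U x, (x *m l) 0 0 = 1 & D x <= D x0]].
have A0 : A !=set0 by exists x0; split.
have clA : closed A.
  move=> b clb.
  have Kb : K b.
    by apply: cK; apply: closure_subset clb => x [Kx _ _]; exact: KI.
  have lb : (b *m l) 0 0 = 1.
    have : closed [set x : 'rV[R]_n | (x *m l) 0 0 = 1].
      apply: (@closed_comp _ _ (fun x : 'rV[R]_n => (x *m l) 0 0) [set r : R | r = 1]).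
        move=> x _.
        apply: (@differentiable_continuous _ _ _ _ (fun x : 'rV[R]_n => (x *m l) 0 0)).
        have -> : (fun u : 'rV[R]_n => (u *m l) 0 0) =
            \sum_k (fun u : 'rV[R]_n => l k 0 *: u 0 k).
          apply/funext => u; rewrite fct_sumE mxE.
          by apply: eq_bigr => k _; rewrite /GRing.scale /= mulrC.
        by apply: differentiable_sum => k; apply: differentiableZ; exact: differentiable_coord.
      exact: closed_eq.
    by apply; apply: closure_subset clb => x [].
  have b0 : b != 0.
    by apply/eqP => b0; move: lb; rewrite b0 mul0mx mxE => /esym/eqP; rewrite oner_eq0.
  have [Kb'|Kb'] := pselect (U b).
    split; [exact: Kb'|exact: lb|rewrite leNgt; apply/negP => Dlt].
    have [y [[_ _ Dy]]] := clb _ (cvgr_gt _ (contD Kb') _ Dlt).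
    by move=> /=; rewrite ltNge Dy.
  exfalso.
  have [_ _ _ H1 _] := potU cF1.
  (* Near such a limit point the subtracted term is below M and F1 is above D x0 + M, so D exceeds D
     x0, contradicting membership in [A]. *)
  pose M := F2 (b *m L e) + ln (\det (L e)) + 1.
  have Mgt : F2 (b *m L e) + ln (\det (L e)) < M by rewrite ltrDl.
  have nG : \forall y \near b, F2 (y *m L e) + ln (\det (L e)) < M by apply: (cvgr_lt _ (contG Kb b0) _ Mgt).
  have := H1 b Kb Kb' => /cvgryPgt/(_ (D x0 + M)).
  rewrite near_withinE => /(filterI nG) nF.
  have [y [[Ky _ Dy]]] := clb _ nF; move=> [/= lt1 /(_ Ky) lt2].
  by move: Dy; rewrite leNgt /D => /negP; apply; rewrite /D in lt2; lra.
have cA : compact A.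
  apply: bounded_closed_compact => //.
  exists (C * 1); split; first exact: num_real.
  move=> r Cr x [Kx lx _]; apply: le_trans (l_bound (KI Kx)) _.
  by rewrite lx ltW.
have [c cA' cmin] : exists2 c, c \in A & forall t, t \in A -> D c <= D t.
  apply: EVT_min_rV => //; apply: continuous_in_subspaceT => x.
  by rewrite inE => -[Kx _ _]; exact: contD.
rewrite inE in cA'; have [Kc lc Dc] := cA'.
exists c => // x Kx; have [Knx lnx <-] := nrmP x Kx.
have [Dx|Dx] := leP (D (nrm x)) (D x0).
  by apply: cmin; rewrite inE.
exact: ltW (le_lt_trans Dc Dx).
Qed.

(** At a minimum the Hessian of F1 dominates that of the transformed F2. Their determinants, which
    are e^2 to the respective function values, are then ordered as well. *)
Let min_ge0 c : U c -> (forall x, U x -> D c <= D x) -> 0 <= D c.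
Proof.
move=> Kc cmin; set c' := c *m L e.
have Kc' : U c' by apply: intL; [exact: KI|exact: KI0].

have oK : open U by rewrite -UE; exact: open_interior.
have near_line (b v : 'rV[R]_n) : U b -> \forall s \near (0 : R), U (b + s *: v).
  move=> Kb; have cs : {for (0 : R), continuous (fun s : R => b + s *: v)}.
    by apply: continuousD; [exact: cst_continuous|exact: scalel_continuous].
  by apply: cs; rewrite /= scale0r addr0; apply: open_nbhs_nbhs; split.
have [_ pos1 det1' _ _] := potU cF1; have [_ pos2 det2' _ _] := potU cF2.
have H v : qform (Hessian F2 c') (v *m L e) <= qform (Hessian F1 c) v.
  rewrite -subr_ge0.
  pose g (s : R) := F1 (c + s *: v) - F2 (c' + s *: (v *m L e)).
  pose g1 (s : R) := 'D_v F1 (c + s *: v) - 'D_(v *m L e) F2 (c' + s *: (v *m L e)).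
  apply: (@local_min_derive2 _ g g1).
  - apply: filterS2 (near_line _ v Kc) (near_line _ (v *m L e) Kc') => s Ks Ks'.
    by apply: is_deriveB'; apply: is_derive_along; [exact: dF1|exact: dF2].
  - have A1 := derive2_Hessian v oK dF1 (fun i => d2F1 i Kc) Kc.
    have A2 := derive2_Hessian (v *m L e) oK dF2 (fun i => d2F2 i Kc') Kc'.
    by apply: is_deriveB'; [move: A1|move: A2] => /is_derive_lineP;
      under eq_fun do rewrite addrC.
  - apply: filterS (near_line _ v Kc) => s Ks.
    have := cmin _ Ks; rewrite /D /g !scale0r !addr0 mulmxDl -scalemxAl -/c'.
    by lra.
have [H1T H1P] := pos1 c Kc; have [H2T H2P] := pos2 c' Kc'.
pose B := L e *m Hessian F2 c' *m (L e)^T.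
have qB v : qform B v = qform (Hessian F2 c') (v *m L e).
  by rewrite /qform /B trmx_mul !mulmxA.
have pB : posdefmx B.
  split=> [|v v0]; first by rewrite /B !trmx_mul trmxK H2T mulmxA.
  rewrite -/(qform B v) qB; apply: H2P; apply: contraNneq v0 => vL.
  have uL : L e \in unitmx by rewrite unitmxE unitfE gt_eqF.
  by rewrite -[v](mulmxK uL) vL mul0mx.
have /andP[_] : 0 < \det B <= \det (Hessian F1 c).
  by apply: det_posdef_le => // v; rewrite qB.
rewrite /B !det_mulmx det_tr (det1' _ Kc) (det2' _ Kc').
have -> : \det (L e) * expR (2 * F2 c') * \det (L e) =
    expR (2 * (F2 c' + ln (\det (L e)))).
  rewrite mulrDr expRD (mulrDl 1 1 (ln _)) mul1r expRD lnK ?posrE//.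
  by ring.
by rewrite ler_expR /D -/c'; lra.
Qed.

Lemma potential_perturb_le x : U x -> F2 (x *m L e) + ln (\det (L e)) <= F1 x.
Proof.
move=> Kx; have [c Kc cmin] : exists2 c, U c & forall x, U x -> D c <= D x.
  by apply: exists_min; exists x.
by rewrite -subr_ge0; apply: le_trans (min_ge0 Kc cmin) (cmin x Kx).
Qed.

End potentials.

Lemma canonical_potential_le F1 F2 : canonical_potential K F1 -> canonical_potential K F2 ->
  forall x, U x -> F2 x <= F1 x.
Proof.
move=> cF1 cF2 x Kx; apply/ler_addgt0Pr => eta eta0.
have cF2x : {for x, continuous F2}.
  by have [+ _ _ _ _] := potU cF2 => /(_ x Kx)[dF _]; exact: differentiable_continuous.
have cx : {for (0 : R), continuous (fun e : R => x + (e * (x *m l) 0 0) *: d)}.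
  apply: continuousD; first exact: cst_continuous.
  apply: (@continuous_comp _ _ _ (fun e : R => e * (x *m l) 0 0) (fun s : R => s *: d)).
    exact: mulrr_continuous.
  exact: scalel_continuous.
have nF : \forall e \near (0 : R), F2 x - eta < F2 (x + (e * (x *m l) 0 0) *: d).
  have c0 : {for (0 : R), continuous (fun e : R => F2 (x + (e * (x *m l) 0 0) *: d))}.
    by apply: (continuous_comp cx); rewrite mul0r scale0r addr0.
  have lt0 : F2 x - eta < F2 (x + (0 * (x *m l) 0 0) *: d).
    by rewrite mul0r scale0r addr0 ltrBlDr ltrDl.
  exact: cvgr_gt _ c0 _ lt0.
have [r /= r0 Hr] := (nbhs_ballP _ _).1 nF.
have r2 : 0 < r / 2 by rewrite divr_gt0.
have {}Hr : F2 x - eta < F2 (x *m L (r / 2)).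
  rewrite mulL; apply: Hr; rewrite -ball_normE /ball_ /= sub0r normrN gtr0_norm//.
  by rewrite ltr_pdivrMr// ltr_pMr// ltr1n.
have := potential_perturb_le cF1 cF2 r2 Kx.
have : 0 <= ln (\det (L (r / 2))).
  by rewrite ln_ge0// detL lerDl mulr_ge0// ltW.
lra.
Qed.

Lemma canonical_potential_unique F1 F2 :
  canonical_potential K F1 -> canonical_potential K F2 ->
  forall x, U x -> F1 x = F2 x.
Proof.
move=> c1 c2 x Kx; apply/eqP; rewrite eq_le.
by rewrite (canonical_potential_le c2 c1 Kx) (canonical_potential_le c1 c2 Kx).
Qed.

End comparison.

(** * Improper integrals *)

Section integrals.
Context {R : realType}.
Notation mu := (@lebesgue_measure R).

Lemma continuous_integrable_itv (f : R -> R) (a b : R) : continuous f ->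
  mu.-integrable `[a, b] (EFin \o f).
Proof.
move=> cf; apply: continuous_compact_integrable; first exact: segment_compact.
exact: continuous_subspaceT.
Qed.

Lemma continuous_antiderivative (f : R -> R) : continuous f ->
  exists F : R -> R, forall x : R, is_derive x 1 F (f x).
Proof.
move=> cf; pose G a x := \int[mu]_(y in `[a, x]) f y.
have GD (a x : R) : a < x -> is_derive x 1 (G a) (f x).
  move=> ax; have xx : x < x + 1 by rewrite ltrDl.
  have [d1 d2] := continuous_FTC1_closed xx (continuous_integrable_itv _ _ cf) ax (cf x).
  have E : 'D_1 (G a) x = f x by rewrite -derive1E.
  exact: (DeriveDef d1 E).
have GB a b x : a < b -> b < x -> G a x = G a b + G b x.
  move=> ab bx; apply/eqP; rewrite addrC -subr_eq; apply/eqP.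
  rewrite /G Rintegral_itvB ?bnd_simp//; first last.
  - exact: ltW.
  - exact: ltW.
  - exact: continuous_integrable_itv _ _ cf.
  by rewrite Rintegral_itv_obnd_cbnd//; apply: integrableS (continuous_integrable_itv _ _ cf) => //;
    exact: subset_itv_oc_cc.
(* The base point -(|x| + 1) lies to the left of both x and 0; subtracting the value at 0 removes
   the dependence on it. *)
exists (fun x => G (- (`|x| + 1)) x - G (- (`|x| + 1)) 0) => x.
(* For |x - y| < 1 the moving base point of y stays to the right of -M, so one fixed base point
   serves near x. *)
pose M := `|x| + 3.
have H y : `|x - y| < 1 -> G (- M) y - G (- M) 0 = G (- (`|y| + 1)) y - G (- (`|y| + 1)) 0.
  move=> xy; have yx : `|y| < `|x| + 1.
    by rewrite -[y](subKr x) (le_lt_trans (ler_normB _ _))// ltrD2l.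
  have My : - M < - (`|y| + 1) by rewrite /M; lra.
  have y1 : - (`|y| + 1) < y by have := ler_norm (- y); rewrite normrN; lra.
  have y2 : - (`|y| + 1) < 0 by have := normr_ge0 y; lra.
  by rewrite (GB _ _ _ My y1) (GB _ _ _ My y2); ring.
apply: (@near_eq_is_derive _ _ _ (fun y => G (- M) y - G (- M) 0)).
  by exists 1 => //= y; exact: H.
have Mx : - M < x by rewrite /M; have := ler_norm (- x); rewrite normrN; lra.
rewrite -[f x]subr0.
exact: (is_deriveB' (GD _ _ Mx) (is_derive_cst' x 1 (G (- M) 0))).
Qed.

(** The constant sign lets the fundamental theorem on a half-line give the extended integral
    directly; its finite value proves integrability. *)
Lemma ge0_integral_y (f F : R -> R) (a l : R) :
  (forall x, a <= x -> 0 <= f x) -> (forall x, a <= x -> {for x, continuous f}) ->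
  (forall x, a <= x -> is_derive x 1 F (f x)) -> F x @[x --> +oo] --> l ->
  mu.-integrable `[a, +oo[ (EFin \o f) /\ \int[mu]_(x in `[a, +oo[) f x = l - F a.
Proof.
move=> f0 cf dF Fl.
have cw : {within `[a, +oo[, continuous f}.
  apply: continuous_in_subspaceT => x; rewrite inE /= in_itv /= andbT; exact: cf.
have Fa : F x @[x --> a^'+] --> F a.
  by apply: cvg_at_right_filter; apply: (@is_derive_continuous _ F a (f a)); apply: dF.
have dF' x : a < x -> derivable F x 1 by move=> /ltW/dF[].
have FE : {in `]a, +oo[, derive1 F =1 f}.
  by move=> x; rewrite in_itv /= andbT => /ltW/dF[_ <-]; rewrite derive1E.
split; last exact: Rintegral_ge0_continuous_FTC2y.
apply/integrableP; split.
  apply/measurable_EFinP; apply: subspace_continuous_measurable_fun => //.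
under eq_integral => x.
  rewrite inE /= in_itv /= andbT => ax.
  rewrite ger0_norm ?f0//; over.
by rewrite (ge0_continuous_FTC2y f0 cw Fl dF' Fa FE) -EFinB ltry.
Qed.

Lemma le0_integral_y (f F : R -> R) (a l : R) :
  (forall x, a <= x -> f x <= 0) -> (forall x, a <= x -> {for x, continuous f}) ->
  (forall x, a <= x -> is_derive x 1 F (f x)) -> F x @[x --> +oo] --> l ->
  mu.-integrable `[a, +oo[ (EFin \o f) /\ \int[mu]_(x in `[a, +oo[) f x = l - F a.
Proof.
move=> f0 cf dF Fl.
have [] := @ge0_integral_y (fun x => - f x) (fun x => - F x) a (- l).
- by move=> x ax; rewrite oppr_ge0; exact: f0.
- by move=> x ax; apply: continuousN; exact: cf.
- by move=> x ax; apply: is_deriveN'; exact: dF.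
- exact: cvgN.
move=> If E; have {}If : mu.-integrable `[a, +oo[ (EFin \o f).
  have := integrableN If.
  by congr integrable; apply/funext => x /=; rewrite opprK.
split=> //; apply: oppr_inj; rewrite -[LHS]mulN1r -RintegralZl//.
under eq_Rintegral do rewrite mulN1r.
by rewrite E; ring.
Qed.

Lemma le0_integral_Ny (f F : R -> R) (a l : R) :
  (forall x, x <= a -> f x <= 0) -> (forall x, x <= a -> {for x, continuous f}) ->
  (forall x, x <= a -> is_derive x 1 F (f x)) -> F x @[x --> -oo] --> l ->
  mu.-integrable `]-oo, a] (EFin \o f) /\ \int[mu]_(x in `]-oo, a]) f x = F a - l.
Proof.
move=> f0 cf dF Fl.
have [] := @ge0_integral_y (fun x => - f (- x)) (fun x => F (- x)) (- a) l.
- by move=> x ax; rewrite oppr_ge0; apply: f0; rewrite lerNl.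
- move=> x ax; apply: continuousN; apply: (@continuous_comp _ _ _ -%R f x); first exact: opp_continuous.
  by apply: cf; rewrite lerNl.
- move=> x ax; rewrite -mulrN1.
  apply: (@is_derive_scomp _ _ -%R F x 1 (f (- x)) (-1)).
    by apply: dF; rewrite lerNl.
- exact/cvgNy_compNP.
move=> If E.
have cw : {within `]-oo, - - a], continuous (fun x => - f x)}.
  apply: continuous_in_subspaceT => x; rewrite inE /= in_itv /= opprK => xa.
  by apply: continuousN; exact: cf.
have S := @ge0_integration_by_substitutionNy _ (fun x => - f x) (- a) cw.
have {}S : (\int[mu]_(x in `]-oo, a]) (- f x)%:E = \int[mu]_(x in `[(- a)%R, +oo[) (- f (- x))%:E)%E.
  rewrite -[in LHS](opprK a); apply: S => x; rewrite in_itv /= opprK => /ltW xa.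
  by rewrite oppr_ge0; exact: f0.
have mf : measurable_fun `]-oo, a] f.
  apply: subspace_continuous_measurable_fun => //.
  by apply: continuous_in_subspaceT => x; rewrite inE /= in_itv /=; exact: cf.
have Ifin : mu.-integrable `]-oo, a] (EFin \o f).
  apply/integrableP; split; first exact/measurable_EFinP.
  have -> : (\int[mu]_(x in `]-oo, a]) `|(EFin \o f) x| = \int[mu]_(x in `]-oo, a]) (- f x)%:E)%E.
    apply: eq_integral => x; rewrite inE /= in_itv /= => xa.
    by rewrite ler0_norm// f0.
  rewrite S; case/integrableP: If => _; apply: le_lt_trans.
  rewrite le_eqVlt; apply/orP; left; apply/eqP; apply: eq_integral => x.
  rewrite inE /= in_itv /= andbT => xa.
  by rewrite ger0_norm// oppr_ge0 f0// lerNl.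
split=> //; apply: oppr_inj; rewrite -[LHS]mulN1r -RintegralZl//.
under eq_Rintegral do rewrite mulN1r.
by rewrite /Rintegral S -/(Rintegral _ _ _) E opprK; ring.
Qed.

End integrals.

(** * The functions phi and t in closed form *)

Section explicit.
Context {R : realType}.
Variables (p q c x1 x2 x3 : R).
Hypothesis p2 : 2 <= p.
Hypothesis q1 : 1 < q.
Hypothesis pq : p * q = p + q.
Hypothesis c0 : c < 0.
Hypothesis x1_01 : 0 < x1 < 1.
Hypothesis x21 : x2 < x1.
Hypothesis x31 : x3 < x1.
(** Vieta's relations. The linear coefficient of the cubic is a multiple of p q - (p + q), which
    vanishes; hence the zero in [e2]. *)
Hypothesis e1 : x1 + x2 + x3 = 1 - p - q.
Hypothesis e2 : x1 * x2 + x1 * x3 + x2 * x3 = 0.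
Hypothesis e3 : 4 * (p + q) * (x1 * x2 * x3) = 4 * (p + q) ^+ 2 - c ^+ 2.

Definition W (z : R) := z ^+ 2 + x1.
Definition L (z : R) := 3 * W z + 2 * (p + q) - 2.
Notation S := (Defs.rad p q x1 x2 x3).
Definition N (z : R) := 2 * z * S z - c.
Definition H (z : R) := 2 * z * S z + c.

Lemma p_gt0 : 0 < p. Proof. by move: p2; lra. Qed.
Lemma q_gt0 : 0 < q. Proof. by move: q1; lra. Qed.
Lemma pq_ge4 : 4 <= p + q.
Proof.
have P := p_gt0; have Q := q_gt0; have := sqr_ge0 (p - q).
have -> : (p - q) ^+ 2 = (p + q) * (p + q - 4) + 4 * (p + q - p * q) by ring.
by rewrite pq subrr mulr0 addr0 pmulr_rge0 ?addr_gt0// subr_ge0.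
Qed.

(** The sum x2 + x3 is negative by [e1], and by [e2] the product is -x1 (x2 + x3), hence
    positive. *)
Lemma x23_lt0 : x2 < 0 /\ x3 < 0.
Proof.
have s4 := pq_ge4; have /andP[x10 x11] := x1_01.
have s23 : x2 + x3 < 0 by move: e1; lra.
have p23 : 0 < x2 * x3.
  have -> : x2 * x3 = - (x1 * (x2 + x3)) by move: e2; rewrite mulrDr; lra.
  by rewrite oppr_gt0 pmulr_rlt0.
by split; rewrite ltNge; apply/negP => ge0; nra.
Qed.

Lemma W_ge z : x1 <= W z. Proof. by rewrite lerDr sqr_ge0. Qed.
Lemma W_gt0 z : 0 < W z.
Proof. by case/andP: x1_01 => + _; move/lt_le_trans; apply; exact: W_ge. Qed.
Lemma Wp_gt0 z : 0 < W z + p. Proof. exact: addr_gt0 (W_gt0 z) p_gt0. Qed.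
Lemma Wq_gt0 z : 0 < W z + q. Proof. exact: addr_gt0 (W_gt0 z) q_gt0. Qed.
Lemma L_gt0 z : 0 < L z.
Proof. by rewrite /L; have := W_gt0 z; have := pq_ge4; lra. Qed.

Lemma rad_arg_gt0 z : 0 < (p + q) * (W z - x2) * (W z - x3).
Proof.
have Wz := W_ge z; rewrite mulr_gt0 ?mulr_gt0 ?(addr_gt0 p_gt0 q_gt0)//.
  by move: x21; lra.
by move: x31; lra.
Qed.

Lemma S_gt0 z : 0 < S z.
Proof. by rewrite /Defs.rad sqrtr_gt0; exact: rad_arg_gt0. Qed.

Lemma WpWq z : (W z + p) * (W z + q) = W z ^+ 2 + (p + q) * W z + (p + q).
Proof.
have -> : (W z + p) * (W z + q) = W z ^+ 2 + (p + q) * W z + p * q by ring.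
by rewrite pq.
Qed.

Lemma inv_pq : [/\ p^-1 + q^-1 = 1, p^-1 * q = q - 1 & q^-1 * p = p - 1].
Proof.
have p0 := lt0r_neq0 p_gt0; have q0 := lt0r_neq0 q_gt0.
have E1 : p^-1 * q = q - 1.
  by apply: (mulfI p0); rewrite mulrA divff// mul1r mulrBr pq mulr1 addrC addKr.
have E2 : q^-1 * p = p - 1.
  by apply: (mulfI q0); rewrite mulrA divff// mul1r mulrBr [q * p]mulrC pq mulr1 addrK.
split=> //; apply: (mulfI q0); rewrite mulrDr divff// mulr1.
by rewrite mulrC E1 subrK.
Qed.

Lemma partial_fractions z : (1 + p^-1) / (W z + p) + (1 + q^-1) / (W z + q) =
  L z / ((W z + p) * (W z + q)).
Proof.
have [E0 E1 E2] := inv_pq; have a0 := Wp_gt0 z; have b0 := Wq_gt0 z.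
have -> : L z = (1 + p^-1) * (W z + q) + (1 + q^-1) * (W z + p).
  have -> : (1 + p^-1) * (W z + q) + (1 + q^-1) * (W z + p) =
    W z * (2 + (p^-1 + q^-1)) + (p + q) + (p^-1 * q + q^-1 * p) by ring.
  by rewrite E0 E1 E2 /L; ring.
by field; rewrite !gt_eqF ?p_gt0 ?q_gt0.
Qed.

Lemma S_sqr z : S z ^+ 2 = (p + q) * (W z - x2) * (W z - x3).
Proof. by rewrite /Defs.rad sqr_sqrtr//; exact/ltW/rad_arg_gt0. Qed.

Lemma is_derive_W (z : R) : is_derive z 1 W (2 * z).
Proof.
have dz := is_derive_id' z.
apply: (is_derive_eq (is_deriveD' (is_deriveX' 1 dz) (is_derive_cst' z 1 x1))).
by rewrite addr0 mulr1 expr1.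
Qed.

Lemma is_derive_S (z : R) :
  is_derive z 1 S ((p + q) * z * (2 * W z - x2 - x3) / S z).
Proof.
have dA y := is_deriveB' (is_derive_W z) (is_derive_cst' z 1 y).
have dM := is_deriveM' (is_deriveM' (is_derive_cst' z 1 (p + q)) (dA x2)) (dA x3).
have d : is_derive z 1 S _ := is_derive_sqrt' dM (rad_arg_gt0 z).
apply: (is_derive_eq d); rewrite -/(S z).
have Sn : S z != 0 by rewrite gt_eqF// S_gt0.
by field.
Qed.

Lemma N_mul_H z : N z * H z = 4 * (p + q) * (W z - 1) * (W z + p) * (W z + q).
Proof.
have -> : N z * H z = 4 * z ^+ 2 * S z ^+ 2 - c ^+ 2 by rewrite /N /H; ring.
rewrite S_sqr; have -> : z ^+ 2 = W z - x1 by rewrite /W addrK.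
have -> : c ^+ 2 = 4 * (p + q) ^+ 2 - 4 * (p + q) * (x1 * x2 * x3).
  by rewrite e3; ring.
have -> : 4 * (W z - x1) * ((p + q) * (W z - x2) * (W z - x3)) =
  4 * (p + q) * (W z ^+ 3 - (x1 + x2 + x3) * W z ^+ 2 +
    (x1 * x2 + x1 * x3 + x2 * x3) * W z - x1 * x2 * x3) by ring.
rewrite e1 e2.
have -> : 4 * (p + q) * (W z - 1) * (W z + p) * (W z + q) =
  4 * (p + q) * (W z ^+ 3 + (p + q - 1) * W z ^+ 2 + (p * q - (p + q)) * W z - p * q).
  by ring.
by rewrite pq; ring.
Qed.

(** (z S)^2 is (p + q) times the product of the W - xi. By [e2] the derivative of that product in W
    has no constant term, so it factors as W L. *)
Lemma is_derive_N (z : R) : is_derive z 1 N (2 * (p + q) * W z * L z / S z).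
Proof.
have dz := is_deriveM' (is_derive_cst' z 1 2) (is_derive_id' z).
apply: (is_derive_eq (is_deriveB' (is_deriveM' dz (is_derive_S z)) (is_derive_cst' z 1 c))).
have Sn : S z != 0 by rewrite gt_eqF// S_gt0.
apply: (mulIf Sn); rewrite divfK//.
have -> : (2 * z * ((p + q) * z * (2 * W z - x2 - x3) / S z) + (2 * 1 + 0 * z) * S z - 0) * S z
  = 2 * z * ((p + q) * z * (2 * W z - x2 - x3)) + 2 * S z ^+ 2 by field.
rewrite S_sqr.
have -> : 2 * z * ((p + q) * z * (2 * W z - x2 - x3)) =
  2 * (p + q) * (W z - x1) * (2 * W z - x2 - x3) by rewrite /W; ring.
have -> : L z = 3 * W z - 2 * (x1 + x2 + x3) by rewrite /L e1; ring.
have -> : 2 * (p + q) * W z * (3 * W z - 2 * (x1 + x2 + x3)) =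
  2 * (p + q) * (3 * W z ^+ 2 - 2 * (x1 + x2 + x3) * W z
     + (x1 * x2 + x1 * x3 + x2 * x3)) by rewrite e2; ring.
by ring.
Qed.

Lemma is_derive_H (z : R) : is_derive z 1 H (2 * (p + q) * W z * L z / S z).
Proof.
have -> : H = (fun z => N z + 2 * c) by apply/funext => y; rewrite /H /N; ring.
apply: (is_derive_eq (is_deriveD' (is_derive_N z) (is_derive_cst' z 1 (2 * c)))).
by rewrite addr0.
Qed.

(** Minus the part of phi' that is proportional to c. The remaining part, z L / ((W + p)(W + q)),
    integrates to logarithms by [partial_fractions]. *)
Definition theta z := - c * L z / (2 * S z * (W z + p) * (W z + q)).

Lemma theta_gt0 z : 0 < theta z.
Proof.
rewrite /theta divr_gt0 ?mulr_gt0 ?oppr_gt0 ?L_gt0 ?S_gt0 ?Wp_gt0 ?Wq_gt0//.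
Qed.

Lemma continuous_theta : continuous theta.
Proof.
move=> z.
have dL := is_deriveB' (is_deriveD' (is_deriveM' (is_derive_cst' z 1 3) (is_derive_W z))
  (is_derive_cst' z 1 (2 * (p + q)))) (is_derive_cst' z 1 2).
have dD := is_deriveM' (is_deriveM' (is_deriveM' (is_derive_cst' z 1 2) (is_derive_S z))
  (is_deriveD' (is_derive_W z) (is_derive_cst' z 1 p)))
  (is_deriveD' (is_derive_W z) (is_derive_cst' z 1 q)).
have D0 : 2 * S z * (W z + p) * (W z + q) != 0.
  by rewrite gt_eqF// !mulr_gt0 ?S_gt0 ?Wp_gt0 ?Wq_gt0.
have d : is_derive z 1 theta _ := is_deriveM' (is_deriveM' (is_derive_cst' z 1 (- c)) dL)
  (is_deriveV' dD D0).
exact: is_derive_continuous d.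
Qed.

Lemma S_ge z : Num.sqrt (p + q) * W z <= S z.
Proof.
have s0 : 0 < p + q by have := pq_ge4; lra.
have W0 := W_gt0 z.
rewrite -[W z in leLHS]ger0_norm ?(ltW W0)// -sqrtr_sqr -sqrtrM ?(ltW s0)//.
rewrite /Defs.rad ler_sqrt; last exact: ltW (rad_arg_gt0 z).
rewrite -mulrA ler_pM2l//; have [X2 X3] := x23_lt0.
by rewrite -/(W z); nra.
Qed.

Lemma sqrt_s_ge2 : 2 <= Num.sqrt (p + q).
Proof.
have s4 := pq_ge4; rewrite -[leLHS]ger0_norm// -sqrtr_sqr ler_sqrt; first lra.
by rewrite (le_trans _ s4).
Qed.

(** Since S >= 2 W and L <= 3 (W + p)(W + q), theta is at most -(3/4) c / W. The factor 1 + 1/x1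
    trades 1/W for 1/(1 + z^2). *)
Lemma theta_le : exists C, forall z, theta z <= C * (1 + z ^+ 2)^-1.
Proof.
have s4 := pq_ge4; have P := p_gt0; have Q := q_gt0.
have x10 : 0 < x1 by case/andP: x1_01.
exists (- c * (3 / 4) * (1 + x1^-1)) => z; rewrite /theta.
have W0 := W_gt0 z; have S0 := S_gt0 z; have z0 := sqr_ge0 z.
have SW : 2 * W z <= S z.
  by apply: le_trans (S_ge z); rewrite ler_pM2r// sqrt_s_ge2.
have ab0 : 0 < (W z + p) * (W z + q) by rewrite mulr_gt0 ?Wp_gt0 ?Wq_gt0.
have Lab : L z <= 3 * ((W z + p) * (W z + q)).
  by rewrite WpWq /L; nra.
apply: (@le_trans _ _ (- c * (3 / 4) / W z)); last first.
  have k0 : 0 < - c * (3 / 4) by rewrite mulr_gt0 ?oppr_gt0// divr_gt0.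
  rewrite -[leRHS]mulrA ler_pM2l//.
  have -> : 1 + x1^-1 = (1 + x1) / x1 by field; rewrite gt_eqF.
  rewrite -[leLHS]mul1r ler_pdivrMr// mulrAC ler_pdivlMr; last by lra.
  rewrite mul1r mulrAC ler_pdivlMr//.
  by rewrite /W; nra.
rewrite -!mulrA ler_pM2l ?oppr_gt0// ler_pdivrMr; last first.
  by rewrite !mulr_gt0// ?Wp_gt0 ?Wq_gt0.
have -> : 3 * (4^-1 / W z) * (2 * (S z * ((W z + p) * (W z + q)))) =
   3 * ((W z + p) * (W z + q)) * (S z / (2 * W z)).
  by field; rewrite gt_eqF.
apply: le_trans Lab _; rewrite ler_peMr//; first by rewrite mulr_ge0// ltW.
by rewrite ler_pdivlMr ?mulr_gt0// mul1r.
Qed.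

Variables (Th : R -> R).
Hypothesis dTh : forall z : R, is_derive z 1 Th (theta z).
Variable la : R.
Hypothesis Th_y : Th z @[z --> +oo] --> 0.
Hypothesis Th_Ny : Th z @[z --> -oo] --> la.

(** As 1/p + 1/q = 1, the logarithms add up to (3/2) ln W at leading order. The constant ln (p +
    q)/2 is the one for which T tends to 1 at +oo. *)
Definition phi0 z := (1 + p^-1) / 2 * ln (W z + p) + (1 + q^-1) / 2 * ln (W z + q)
  - Th z - ln (p + q) / 2.
Definition eps z := expR (phi0 z).
Definition T z := N z / (2 * (p + q) * eps z).
Definition chi z := H z * eps z / (2 * (W z + p) * (W z + q)).

Lemma eps_gt0 z : 0 < eps z. Proof. exact: expR_gt0. Qed.

Lemma sum_gt0 : 0 < p + q. Proof. by have := pq_ge4; lra. Qed.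

Lemma chi_mul_T z : chi z * T z = W z - 1.
Proof.
have := N_mul_H z; rewrite /chi /T => E.
have -> : H z * eps z / (2 * (W z + p) * (W z + q)) * (N z / (2 * (p + q) * eps z)) =
   N z * H z / (4 * (p + q) * (W z + p) * (W z + q)).
  by field; rewrite ?gt_eqF ?Wp_gt0 ?Wq_gt0 ?eps_gt0 ?sum_gt0.
by rewrite E; field; rewrite !gt_eqF ?Wp_gt0 ?Wq_gt0 ?sum_gt0.
Qed.

Lemma is_derive_phi0' (z : R) :
  is_derive z 1 phi0 (L z * H z / (2 * S z * (W z + p) * (W z + q))).
Proof.
have dl y (y0 : 0 < W z + y) := is_derive_ln' (is_deriveD' (is_derive_W z) (is_derive_cst' z 1 y)) y0.
have d1 := is_deriveM' (is_derive_cst' z 1 ((1 + p^-1) / 2)) (dl p (Wp_gt0 z)).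
have d2 := is_deriveM' (is_derive_cst' z 1 ((1 + q^-1) / 2)) (dl q (Wq_gt0 z)).
have d := is_deriveB' (is_deriveB' (is_deriveD' d1 d2) (dTh z)) (is_derive_cst' z 1 (ln (p + q) / 2)).
apply: (is_derive_eq d); rewrite /theta /H.
have [Wp Wq S0] := And3 (Wp_gt0 z) (Wq_gt0 z) (S_gt0 z).
have PF := partial_fractions z.
have -> : (1 + p^-1) / 2 * ((W z + p)^-1 * (2 * z + 0)) + 0 * ln (W z + p) +
   ((1 + q^-1) / 2 * ((W z + q)^-1 * (2 * z + 0)) + 0 * ln (W z + q)) =
   z * ((1 + p^-1) / (W z + p) + (1 + q^-1) / (W z + q)).
  by field; rewrite !gt_eqF ?p_gt0 ?q_gt0.
by rewrite PF; field; rewrite !gt_eqF.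
Qed.

Lemma is_derive_eps (z : R) :
  is_derive z 1 eps (eps z * (L z * H z / (2 * S z * (W z + p) * (W z + q)))).
Proof. exact: is_derive_expR' (is_derive_phi0' z). Qed.

(** The quotient rule gives L/(S eps) times W minus N H / (4 (p + q)(W + p)(W + q)); by [N_mul_H]
    this bracket is W - (W - 1) = 1. *)
Lemma is_derive_T (z : R) : is_derive z 1 T (L z / (S z * eps z)).
Proof.
have s0 := sum_gt0; have E0 := eps_gt0 z; have S0 := S_gt0 z.
have a0 := Wp_gt0 z; have b0 := Wq_gt0 z.
have nz : 2 * (p + q) * eps z != 0 by rewrite gt_eqF// !mulr_gt0.
have d : is_derive z 1 T _ := is_deriveM' (is_derive_N z)
  (is_deriveV' (is_deriveM' (is_derive_cst' z 1 (2 * (p + q))) (is_derive_eps z)) nz).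
apply: (is_derive_eq d).
have NH := N_mul_H z.
have -> : N z * (- (2 * (p + q) * (eps z * (L z * H z / (2 * S z * (W z + p) * (W z + q)))) +
   0 * eps z) / (2 * (p + q) * eps z) ^+ 2) +
   2 * (p + q) * W z * L z / S z * (2 * (p + q) * eps z)^-1 =
   L z * W z / (S z * eps z) - L z / (4 * (p + q) * S z * (W z + p) * (W z + q) * eps z) * (N z * H z).
  by field; rewrite !gt_eqF.
by rewrite NH; field; rewrite !gt_eqF.
Qed.

Lemma is_derive_phi0 (z : R) : is_derive z 1 phi0 (chi z * (L z / (S z * eps z))).
Proof.
apply: (is_derive_eq (is_derive_phi0' z)); rewrite /chi.
by field; rewrite !gt_eqF ?S_gt0 ?eps_gt0 ?Wp_gt0 ?Wq_gt0.
Qed.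

(** Divided by T' this is psi'' as a function of t: ((p + q) eps^2 + chi^2 (W + p + q - 2)) / L,
    free of the square root. *)
Lemma is_derive_chi (z : R) : is_derive z 1 chi
  (((p + q) * eps z + chi z ^+ 2 * (W z + p + q - 2) / eps z) / S z).
Proof.
have s0 := sum_gt0; have E0 := eps_gt0 z; have S0 := S_gt0 z.
have a0 := Wp_gt0 z; have b0 := Wq_gt0 z.
have nz : 2 * (W z + p) * (W z + q) != 0 by rewrite gt_eqF// !mulr_gt0.
have dW y := is_deriveD' (is_derive_W z) (is_derive_cst' z 1 y).
have d : is_derive z 1 chi _ := is_deriveM' (is_deriveM' (is_derive_H z) (is_derive_eps z))
  (is_deriveV' (is_deriveM' (is_deriveM' (is_derive_cst' z 1 2) (dW p)) (dW q)) nz).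
apply: (is_derive_eq d); rewrite /chi.
set a := W z + p in a0 *; set b := W z + q in b0 *.
(* Rests on W L - a b = (a + b)(W - 1) and on N = H - 2 c; it removes the terms without H from the
   difference to be shown zero. *)
have K1 : 4 * (p + q) * (a * b) * (W z * L z - a * b) = (a + b) * (H z ^+ 2 - 2 * c * H z).
  have -> : H z ^+ 2 - 2 * c * H z = N z * H z by rewrite /N /H; ring.
  rewrite N_mul_H -/a -/b.
  have -> : W z * L z - a * b = (a + b) * (W z - 1); last by ring.
  by rewrite WpWq /a /b /L; ring.
have K2 : 2 * z * S z = H z - c by rewrite /H addrK.
apply/eqP; rewrite -subr_eq0; apply/eqP.
rewrite [X in X - _](_ : _ = eps z / (2 * a * b * S z) * (2 * (p + q) * W z * L z +
    L z * H z ^+ 2 / (2 * a * b) - (2 * z * S z) * H z * (a + b) / (a * b))); last first.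
  by field; rewrite !gt_eqF.
rewrite K2.
have -> : eps z / (2 * a * b * S z) * (2 * (p + q) * W z * L z +
    L z * H z ^+ 2 / (2 * a * b) - (H z - c) * H z * (a + b) / (a * b)) -
   ((p + q) * eps z + (H z * eps z / (2 * a * b)) ^+ 2 * (W z + p + q - 2) / eps z) / S z =
   eps z / (4 * a ^+ 2 * b ^+ 2 * S z) * (4 * (p + q) * (a * b) * (W z * L z - a * b)
    + H z ^+ 2 * (L z - (W z + p + q - 2) - 2 * (a + b)) + 2 * c * H z * (a + b)).
  by field; rewrite !gt_eqF.
by rewrite K1 /a /b /L; field; rewrite !gt_eqF ?S_gt0 ?Wp_gt0 ?Wq_gt0.
Qed.

Lemma Th_homo : {homo Th : x y / x < y}.
Proof. by apply: (is_derive_homo dTh); exact: theta_gt0. Qed.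

Lemma Th_le0 z : Th z <= 0.
Proof.
have t0 y : z <= y -> 0 <= theta y by move=> _; exact/ltW/theta_gt0.
exact: (@ndecr_cvgy_le _ Th theta z 0 (fun y _ => dTh y) t0 Th_y).
Qed.

Lemma la_le_Th z : la <= Th z.
Proof.
have t0 y : y <= z -> - theta y <= 0 by move=> _; rewrite oppr_le0; exact/ltW/theta_gt0.
have ThN : (fun y => - Th y) y @[y --> -oo] --> - la by exact: cvgN.
have := nincr_cvgNy_le (fun y _ => is_deriveN' (dTh y)) t0 ThN.
by move=> /(_ z (lexx z)); rewrite lerN2.
Qed.

Lemma la_lt0 : la < 0.
Proof.
apply: (le_lt_trans (la_le_Th (-1))); apply: (lt_le_trans _ (Th_le0 0)).
by apply: Th_homo; rewrite oppr_lt0.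
Qed.

(** What remains of the logarithms in phi0, in the variable r = 1/W, after (3/2) ln W is taken
    out. *)
Definition B r := (1 + p^-1) / 2 * ln (1 + p * r) + (1 + q^-1) / 2 * ln (1 + q * r).

Lemma eps_eq z : eps z =
  W z * Num.sqrt (W z) * expR (B (W z)^-1) * expR (- Th z) / Num.sqrt (p + q).
Proof.
have W0 := W_gt0 z; have s0 := sum_gt0; have P := p_gt0; have Q := q_gt0.
have sqrtE (y : R) : 0 < y -> Num.sqrt y = expR (ln y / 2).
  move=> y0; rewrite -[RHS]ger0_norm ?expR_ge0// -sqrtr_sqr expr2 -expRD.
  by rewrite -splitr lnK.
rewrite /eps !sqrtE// -{1}(lnK W0) -expRN -!expRD; congr expR.
have lnW y : 0 < y -> ln (W z + y) = ln (W z) + ln (1 + y / W z).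
  move=> y0; have A0 : 0 < 1 + y / W z by exact: addr_gt0 ltr01 (divr_gt0 y0 W0).
  rewrite -lnM ?posrE//.
  by congr ln; field; rewrite gt_eqF.
rewrite /phi0 /B !lnW//; have [E _ _] := inv_pq.
have -> : q^-1 = 1 - p^-1 by rewrite -E addrAC subrr add0r.
by field; rewrite ?gt_eqF.
Qed.

Lemma B_ge0 z : 0 <= B (W z)^-1.
Proof.
have W0 := W_gt0 z; have P := p_gt0; have Q := q_gt0.
by rewrite /B addr_ge0// mulr_ge0 ?divr_ge0 ?addr_ge0 ?invr_ge0 ?(ltW P) ?(ltW Q)//
  ln_ge0// lerDl mulr_ge0 ?invr_ge0 ?(ltW P) ?(ltW Q) ?(ltW W0).
Qed.

Lemma B_le z : B (W z)^-1 <= (p + q + 2) / (2 * x1).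
Proof.
have W0 := W_gt0 z; have P := p_gt0; have Q := q_gt0.
have x10 : 0 < x1 by case/andP: x1_01.
have lnb y : 0 < y -> ln (1 + y * (W z)^-1) <= y / x1.
  move=> y0; apply: (@le_trans _ _ (y * (W z)^-1)).
    by apply: le_ln1Dx; apply: (@lt_trans _ _ 0); rewrite ?oppr_lt0// divr_gt0.
  by rewrite ler_pM2l// lef_pV2 ?posrE// W_ge.
rewrite /B.
have -> : (p + q + 2) / (2 * x1) = (1 + p^-1) / 2 * (p / x1) + (1 + q^-1) / 2 * (q / x1).
  by field; rewrite !gt_eqF.
by apply: lerD; apply: ler_wpM2l; rewrite ?lnb// divr_ge0// addr_ge0// invr_ge0 ltW.
Qed.

Lemma eps_ge z : W z * Num.sqrt (W z) / Num.sqrt (p + q) <= eps z.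
Proof.
have W0 := W_gt0 z.
rewrite eps_eq; apply: ler_wpM2r; first by rewrite invr_ge0 sqrtr_ge0.
rewrite -mulrA ler_peMr//; first by rewrite mulr_ge0 ?sqrtr_ge0// ltW.
by rewrite -expRD -expR0 ler_expR addr_ge0 ?B_ge0// oppr_ge0 Th_le0.
Qed.

Lemma eps_sqr_le : exists2 C, 0 <= C & forall z, eps z ^+ 2 <= C * W z ^+ 3.
Proof.
exists (expR ((p + q + 2) / (2 * x1) - la) ^+ 2) => [|z]; first exact: sqr_ge0.
have W0 := W_gt0 z; have s0 : 0 < Num.sqrt (p + q) by rewrite sqrtr_gt0 sum_gt0.
have -> : expR ((p + q + 2) / (2 * x1) - la) ^+ 2 * W z ^+ 3 =
   (W z * Num.sqrt (W z) * expR ((p + q + 2) / (2 * x1) - la)) ^+ 2.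
  by rewrite !exprMn sqr_sqrtr ?(ltW W0)//; ring.
have E0 := ltW (eps_gt0 z).
rewrite lerXn2r ?nnegrE ?mulr_ge0 ?sqrtr_ge0 ?expR_ge0 ?(ltW W0)//.
rewrite eps_eq -[X in X / _]mulrA -expRD ler_pdivrMr//.
apply: (@le_trans _ _ (W z * Num.sqrt (W z) * expR ((p + q + 2) / (2 * x1) - la))).
  apply: ler_wpM2l; first by rewrite mulr_ge0 ?sqrtr_ge0 ?(ltW W0).
  by rewrite ler_expR; apply: lerD; [exact: B_le|rewrite lerN2 la_le_Th].
rewrite ler_peMr ?mulr_ge0 ?sqrtr_ge0 ?expR_ge0 ?(ltW W0)//.
by have := sqrt_s_ge2; lra.
Qed.

(* [T] on the half-line of sign [sg] in the variable [r = 1/W]: the limits of [T] at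
   infinity become continuity at [r = 0]. *)
Definition Phi sg r := (sg * Num.sqrt (1 - x1 * r) *
  Num.sqrt ((p + q) * (1 - x2 * r) * (1 - x3 * r)) - c / 2 * r * Num.sqrt r)
  * expR (- B r) / Num.sqrt (p + q).

Lemma T_eq sg z : z = sg * `|z| -> T z = Phi sg (W z)^-1 * expR (Th z).
Proof.
move=> zE; have W0 := W_gt0 z; have s0 := sum_gt0.
have wn : W z != 0 by rewrite gt_eqF.
have sW : 0 < Num.sqrt (W z) by rewrite sqrtr_gt0.
have ss : 0 < Num.sqrt (p + q) by rewrite sqrtr_gt0.
have E1 : `|z| = Num.sqrt (W z) * Num.sqrt (1 - x1 * (W z)^-1).
  rewrite -sqrtr_sqr -sqrtrM ?(ltW W0)//; congr Num.sqrt.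
  by rewrite mulrBr mulr1 mulrCA divff// mulr1 /W addrK.
have E2 : S z = W z * Num.sqrt ((p + q) * (1 - x2 * (W z)^-1) * (1 - x3 * (W z)^-1)).
  rewrite -[X in X * _]ger0_norm ?(ltW W0)// -sqrtr_sqr -sqrtrM ?sqr_ge0//.
  by rewrite /Defs.rad -/(W z); congr Num.sqrt; field.
have E3 : Num.sqrt (W z)^-1 = (Num.sqrt (W z))^-1 by rewrite sqrtrV// ltW.
have E4 : Num.sqrt (p + q) ^+ 2 = p + q by rewrite sqr_sqrtr// ltW.
rewrite /T eps_eq /Phi E3 /N {1}zE E1 E2 !expRN.
have b0 := expR_gt0 (B (W z)^-1); have t0 := expR_gt0 (Th z).
move: E4; set sq := Num.sqrt (p + q) in ss *.
set X := Num.sqrt (1 - _); set Y := Num.sqrt (_ * _ * _) => <-.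
move: sW; set w := Num.sqrt (W z) => w0.
have -> : W z = w ^+ 2 by rewrite sqr_sqrtr// ltW.
by field; rewrite ?gt_eqF ?expR_gt0.
Qed.

Lemma continuous_Phi0 sg : {for 0, continuous (Phi sg)}.
Proof.
have clin (a : R) : continuous (fun r : R => 1 - a * r).
  move=> r; apply: continuousB; first exact: cst_continuous.
  exact: mulrl_continuous.
have clin' (a : R) : continuous (fun r : R => 1 + a * r).
  move=> r; apply: continuousD; first exact: cst_continuous.
  exact: mulrl_continuous.
have csqrt (f : R -> R) : {for 0, continuous f} -> {for 0, continuous (fun r => Num.sqrt (f r))}.
  by move=> cf; apply: (continuous_comp cf); exact: sqrt_continuous.
have cln (a b : R) : {for 0, continuous (fun r : R => b * ln (1 + a * r))}.
  apply: continuousM; first exact: cst_continuous.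
  apply: (@continuous_comp _ _ _ (fun r : R => 1 + a * r) (@ln R)); first exact: clin'.
  by apply: continuous_ln; rewrite mulr0 addr0.
apply: continuousM; last exact: cst_continuous.
apply: continuousM; last first.
  apply: (@continuous_comp _ _ _ (fun r : R => - B r) (@expR R)); last exact: continuous_expR.
  by apply: continuousN; apply: continuousD; exact: cln.
apply: continuousB.
  apply: continuousM.
    apply: continuousM; first exact: cst_continuous.
    by apply: csqrt; exact: clin.
  apply: csqrt; apply: continuousM; last exact: clin.
  by apply: continuousM; [exact: cst_continuous|exact: clin].
apply: continuousM; first exact: mulrl_continuous.
exact: sqrt_continuous.
Qed.

Lemma Phi_at0 sg : Phi sg 0 = sg.
Proof.
have ss : Num.sqrt (p + q) != 0 by rewrite gt_eqF// sqrtr_gt0 sum_gt0.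
rewrite /Phi /B !mulr0 !subr0 !addr0 !ln1 !mulr0 addr0 oppr0 expR0 sqrtr1 !mulr1.
by rewrite mul0r subr0 mulfK.
Qed.

Lemma W_ge_norm z : 1 <= `|z| -> `|z| <= W z.
Proof.
move=> z1; have x10 : 0 < x1 by case/andP: x1_01.
by rewrite /W -(real_normK (num_real z)); nra.
Qed.

Lemma Winv_cvgy : (W z)^-1 @[z --> +oo] --> 0.
Proof.
apply/cvgrPdist_le => e e0; near=> z.
have z1 : 1 <= z by near: z; exact: nbhs_pinfty_ge.
have ze : e^-1 <= z by near: z; apply: nbhs_pinfty_ge; exact: num_real.
rewrite sub0r normrN gtr0_norm ?invr_gt0 ?W_gt0// invf_ple ?posrE ?W_gt0//.
apply: (le_trans ze); have := @W_ge_norm z; rewrite ger0_norm; last by lra.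
exact.
Unshelve. all: by end_near. Qed.

Lemma WN z : W (- z) = W z. Proof. by rewrite /W sqrrN. Qed.

Lemma T_cvgy : T z @[z --> +oo] --> (1 : R).
Proof.
have H1 : Phi 1 (W z)^-1 * expR (Th z) @[z --> +oo] --> (1 : R).
  have E : (1 : R) = Phi 1 0 * expR 0 by rewrite Phi_at0 expR0 mulr1.
  rewrite [X in _ --> X]E.
  apply: cvgM.
    by apply: (cvg_comp _ _ Winv_cvgy); exact: continuous_Phi0.
  by apply: (cvg_comp _ _ Th_y); exact: continuous_expR.
apply: cvg_trans H1; apply: near_eq_cvg; near=> z.
apply/esym/T_eq; rewrite mul1r ger0_norm//; near: z; exact: nbhs_pinfty_ge.
Unshelve. all: by end_near. Qed.

Lemma T_cvgNy : T z @[z --> -oo] --> - expR la.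
Proof.
apply/cvgNy_compNP.
have H1 : Phi (- 1) (W z)^-1 * expR (Th (- z)) @[z --> +oo] --> - expR la.
  have E : - expR la = Phi (- 1) 0 * expR la by rewrite Phi_at0 mulN1r.
  rewrite [X in _ --> X]E.
  apply: cvgM.
    by apply: (cvg_comp _ _ Winv_cvgy); exact: continuous_Phi0.
  by move/cvgNy_compNP : Th_Ny => h; apply: (cvg_comp _ _ h); exact: continuous_expR.
apply: cvg_trans H1; apply: near_eq_cvg; near=> z.
rewrite /= -{1}WN; apply/esym/T_eq; rewrite mulN1r normrN ger0_norm//; near: z; exact: nbhs_pinfty_ge.
Unshelve. all: by end_near. Qed.

Lemma dT_gt0 z : 0 < L z / (S z * eps z).
Proof. by rewrite divr_gt0 ?L_gt0// mulr_gt0 ?S_gt0 ?eps_gt0. Qed.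

Lemma T_homo : {homo T : x y / x < y}.
Proof. by apply: (is_derive_homo is_derive_T); exact: dT_gt0. Qed.

Lemma T_lt1 z : T z < 1.
Proof.
apply: (@lt_le_trans _ _ (T (z + 1))); first by apply: T_homo; rewrite ltrDl.
have t0 y : z <= y -> 0 <= L y / (S y * eps y) by move=> _; exact/ltW/dT_gt0.
apply: (ndecr_cvgy_le (fun y _ => is_derive_T y) t0 T_cvgy).
by rewrite lerDl.
Qed.

Lemma T_gt z : - expR la < T z.
Proof.
apply: (@le_lt_trans _ _ (T (z - 1))); last by apply: T_homo; rewrite ltrBlDr ltrDl.
have t0 y : y <= z -> - (L y / (S y * eps y)) <= 0.
  by move=> _; rewrite oppr_le0; exact/ltW/dT_gt0.
have TN : (fun y => - T y) y @[y --> -oo] --> - - expR la by apply: cvgN; exact: T_cvgNy.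
have := nincr_cvgNy_le (fun y _ => is_deriveN' (is_derive_T y)) t0 TN.
by move=> /(_ (z - 1)); rewrite lerN2; apply; rewrite lerBlDr lerDl.
Qed.

(** For |z| >= 1 the bound [eps_ge] gives eps >= |z| / sqrt (p + q), whence the explicit
    threshold. *)
Lemma phi0_ge A z : 1 + expR A * Num.sqrt (p + q) <= `|z| -> A <= phi0 z.
Proof.
move=> zA; rewrite -ler_expR -/(eps z); apply: le_trans (eps_ge z).
have ss : 0 < Num.sqrt (p + q) by rewrite sqrtr_gt0 sum_gt0.
have eA := expR_gt0 A.
have z1 : 1 <= `|z| by apply: le_trans zA; rewrite lerDl mulr_ge0// ltW.
have Wz := W_ge_norm z1.
rewrite ler_pdivlMr//.
apply: (@le_trans _ _ `|z|); first by apply: le_trans zA; rewrite lerDr.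
apply: (le_trans Wz); rewrite ler_peMr ?(ltW (W_gt0 z))//.
rewrite -[leLHS]sqrtr1 ler_sqrt ?(ltW (W_gt0 z))//.
exact: le_trans Wz.
Qed.

(* The derivative of [T] is of order [W^(-3/2)]. *)
Lemma T_rate : exists2 C, 0 <= C & forall z,
  (0 <= z -> 1 - T z <= C / W z) /\ (z <= 0 -> T z + expR la <= C / W z).
Proof.
have x10 : 0 < x1 by case/andP: x1_01.
have x11 : x1 < 1 by case/andP: x1_01.
have s4 := pq_ge4.
(* W >= x1 turns the constant part of L into a multiple of W, so that L <= k W. *)
pose k : R := 3 + (2 * (p + q) - 2) / x1.
have k0 : 0 <= k by rewrite /k addr_ge0// divr_ge0; lra.
have dT_le z : L z / (S z * eps z) <= k / (W z * Num.sqrt (W z)).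
  have W0 := W_gt0 z; have S0 := S_gt0 z; have E0 := eps_gt0 z.
  have w0 : 0 < Num.sqrt (W z) by rewrite sqrtr_gt0.
  have ss : 0 < Num.sqrt (p + q) by rewrite sqrtr_gt0 sum_gt0.
  have Lk : L z <= k * W z.
    have -> : k * W z = 3 * W z + (2 * (p + q) - 2) * (W z / x1).
      by rewrite /k; field; rewrite gt_eqF.
    have : 1 <= W z / x1 by rewrite ler_pdivlMr// mul1r W_ge.
    by rewrite /L; nra.
  have SE : W z * (W z * Num.sqrt (W z)) <= S z * eps z.
    apply: (@le_trans _ _ (Num.sqrt (p + q) * W z * (W z * Num.sqrt (W z) / Num.sqrt (p + q)))).
      by rewrite le_eqVlt; apply/orP; left; apply/eqP; field; rewrite gt_eqF.
    apply: ler_pM; last exact: eps_ge; last exact: S_ge.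
      by rewrite mulr_ge0// ltW.
    by rewrite divr_ge0 ?mulr_ge0// ltW.
  rewrite ler_pdivrMr ?mulr_gt0// mulrAC ler_pdivlMr ?mulr_gt0//.
  apply: le_trans (_ : k * W z * (W z * Num.sqrt (W z)) <= _).
    by apply: ler_wpM2r; rewrite ?mulr_ge0 ?(ltW W0) ?(ltW w0).
  by rewrite -mulrA ler_wpM2l.
(* The right-hand side is |(k/W)'|. Comparing T with k/W on |z| >= 1 turns the rate of T' into a
   rate for T. *)
have cmp z : 1 <= `|z| -> L z / (S z * eps z) <= 2 * `|z| * k / W z ^+ 2.
  move=> z1; apply: (le_trans (dT_le z)).
  have W0 := W_gt0 z; have w0 : 0 < Num.sqrt (W z) by rewrite sqrtr_gt0.
  have wz : Num.sqrt (W z) <= 2 * `|z|.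
    rewrite -[leRHS]ger0_norm ?mulr_ge0// -sqrtr_sqr ler_sqrt ?sqr_ge0//.
    by rewrite exprMn (real_normK (num_real z)) /W; have := real_normK (num_real z); nra.
  have WE : W z ^+ 2 = W z * Num.sqrt (W z) * Num.sqrt (W z).
    by rewrite -mulrA -expr2 sqr_sqrtr ?(ltW W0)// expr2.
  have -> : 2 * `|z| * k / W z ^+ 2 =
    k / (W z * Num.sqrt (W z)) * (2 * `|z| / Num.sqrt (W z)).
    by rewrite WE; field; rewrite !gt_eqF.
  rewrite ler_peMr//; first by rewrite divr_ge0// mulr_ge0// ltW.
  by rewrite ler_pdivlMr// mul1r.
have dW (z : R) : is_derive z 1 (fun y => k / W y) (- (2 * z * k / W z ^+ 2)).
  have d := is_deriveM' (is_derive_cst' z 1 k) (is_deriveV' (is_derive_W z) (lt0r_neq0 (W_gt0 z))).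
  by apply: (is_derive_eq d); field; rewrite gt_eqF ?W_gt0.
have kW : k / W z @[z --> +oo] --> 0.
  by rewrite -(mulr0 k); apply: cvgMr; exact: Winv_cvgy.
have big z : 0 <= k / W z by rewrite divr_ge0// ltW ?W_gt0.
(* On |z| <= 1 one has W <= 2, and the trivial bound 2 on both gaps is absorbed by 4/W. This is the
   4 in the final constant. *)
have small z : `|z| <= 1 -> 2 <= 4 / W z.
  move=> z1; rewrite ler_pdivlMr ?W_gt0//.
  by rewrite /W; have := real_normK (num_real z); have := normr_ge0 z; nra.
have e1' : expR la < 1 by rewrite expR_lt1 la_lt0.
have e0 := expR_gt0 la.
exists (k + 4) => [|z]; first by rewrite addr_ge0.
rewrite mulrDl; have W0 := W_gt0 z; split=> z0.
- have [z1|z1] := leP z 1.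
    have := small z; rewrite ger0_norm// => /(_ z1); have := big z; have := T_gt z; lra.
  have t0 y : 1 <= y -> 0 <= - - (2 * y * k / W y ^+ 2) - L y / (S y * eps y).
    by move=> y1; have := cmp y; rewrite ger0_norm ?opprK ?subr_ge0; [exact|lra].
  have := ndecr_cvgy_le (fun y _ => is_deriveB' (is_deriveN' (dW y)) (is_derive_T y)) t0.
  move=> /(_ (- 0 - 1)) /(_ _ z (ltW z1)).
  have -> : 4 / W z = 4 / W z by [].
  have p4 : 0 <= 4 / W z by rewrite divr_ge0// ltW.
  move=> K; have : - (k / W z) - T z <= - 0 - 1.
    by apply: K; apply: cvgB; [exact: cvgN|exact: T_cvgy].
  by move: p4; lra.
- have [z1|z1] := leP (- 1) z.
    have := small z; rewrite ler0_norm// lerNl => /(_ z1); have := big z; have := T_lt1 z; lra.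
  have t0 y : y <= - 1 -> L y / (S y * eps y) - - (2 * y * k / W y ^+ 2) <= 0.
    move=> y1; have := cmp y; rewrite ler0_norm ?opprK; last by lra.
    by rewrite lerNr => /(_ y1); rewrite mulrN !mulNr; lra.
  have kWN : k / W z @[z --> -oo] --> 0.
    by apply/cvgNy_compNP; move: kW; apply: cvg_trans; apply: near_eq_cvg; near=> y; rewrite /= WN.
  have := nincr_cvgNy_le (fun y _ => is_deriveB' (is_derive_T y) (dW y)) t0.
  move=> /(_ (- expR la - 0)) /(_ _ z (ltW z1)).
  have p4 : 0 <= 4 / W z by rewrite divr_ge0// ltW.
  move=> K; have : T z - k / W z <= - expR la - 0.
    by apply: K; apply: cvgB; [exact: T_cvgNy|exact: kWN].
  by move: p4; lra.
Unshelve. all: by end_near. Qed.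

(** The gap is O(1/W) and eps^2 is O(W^3), so the powers of W cancel exactly. This is the
    quantitative input for asymptoticity to the boundary of K. *)
Lemma T_eps_rate : exists2 C, 0 <= C & forall z,
  (0 <= z -> (1 - T z) ^+ 3 * eps z ^+ 2 <= C) /\
  (z <= 0 -> (T z + expR la) ^+ 3 * eps z ^+ 2 <= C).
Proof.
have [C1 C10 H1] := T_rate; have [C2 C20 H2] := eps_sqr_le.
exists (C1 ^+ 3 * C2) => [|z]; first by rewrite mulr_ge0 ?exprn_ge0.
have W0 := W_gt0 z.
have K y : 0 <= y -> y <= C1 / W z -> y ^+ 3 * eps z ^+ 2 <= C1 ^+ 3 * C2.
  move=> y0 yC; apply: (@le_trans _ _ ((C1 / W z) ^+ 3 * (C2 * W z ^+ 3))).
    apply: ler_pM; rewrite ?exprn_ge0 ?(ltW (eps_gt0 z))// ?lerXn2r ?nnegrE//.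
    by rewrite divr_ge0// ltW.
  by rewrite le_eqVlt; apply/orP; left; apply/eqP; field; rewrite gt_eqF.
have [H1p H1n] := H1 z; split=> z0.
  by apply: K (H1p z0); rewrite subr_ge0 ltW// T_lt1.
by apply: K (H1n z0); rewrite -lerBlDr sub0r ltW// T_gt.
Qed.

(** (H - c)^2 = N H + c^2 gives H^2 <= 2 N H + 4 c^2. Dividing by 4 ((W + p)(W + q))^2 and using
    [N_mul_H] yields the constant c^2 + 2 (p + q). *)
Lemma chi_sqr_le : exists2 C, 0 <= C & forall z, chi z ^+ 2 <= C * eps z ^+ 2.
Proof.
have s0 := sum_gt0.
exists (c ^+ 2 + 2 * (p + q)) => [|z]; first by rewrite addr_ge0 ?sqr_ge0 ?mulr_ge0// ltW.
have a0 := Wp_gt0 z; have b0 := Wq_gt0 z; have W0 := W_gt0 z.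
have -> : chi z ^+ 2 = (H z ^+ 2 / (4 * ((W z + p) * (W z + q)) ^+ 2)) * eps z ^+ 2.
  by rewrite /chi; field; rewrite !gt_eqF.
apply: ler_wpM2r; first exact: sqr_ge0.
set ab := (W z + p) * (W z + q).
have ab1 : 1 <= ab by rewrite /ab WpWq; have := pq_ge4; nra.
have abW : W z - 1 <= ab by rewrite /ab WpWq; have := pq_ge4; nra.
have ab0 : 0 < ab by exact: lt_le_trans ab1.
rewrite ler_pdivrMr; last by apply: mulr_gt0 => //; exact: exprn_gt0.
have HN : (H z - c) ^+ 2 = N z * H z + c ^+ 2 by rewrite /H /N; ring.
have : H z ^+ 2 <= 2 * (H z - c) ^+ 2 + 2 * c ^+ 2.
  by have := sqr_ge0 (H z - c - c); nra.
rewrite HN N_mul_H => /le_trans; apply.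
have -> : 4 * (p + q) * (W z - 1) * (W z + p) * (W z + q) = 4 * (p + q) * ((W z - 1) * ab).
  by rewrite /ab; ring.
have ab2 : 1 <= ab ^+ 2 by rewrite expr_ge1// (le_trans _ ab1).
have h1 : c ^+ 2 * 1 <= c ^+ 2 * ab ^+ 2 by apply: ler_wpM2l => //; exact: sqr_ge0.
have h2 : (p + q) * ((W z - 1) * ab) <= (p + q) * ab ^+ 2.
  by rewrite ler_pM2l// expr2; apply: ler_wpM2r => //; rewrite (le_trans _ ab1).
by move: h1 h2; rewrite mulr1; lra.
Qed.

End explicit.

(** * The function G *)

Section bounded_antiderivative.
Context {R : realType}.

Lemma nondecreasing_bounded_cvgy (f : R -> R) (M : R) :
  {homo f : x y / x <= y} -> (forall x, f x <= M) ->
  exists l : R, f x @[x --> +oo] --> l.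
Proof.
move=> hf fM; exists (sup (range f)); apply: nondecreasing_cvgr => //.
by exists M => _ [x _ <-].
Qed.

(** C atan - F is nondecreasing, so the total variation of F is at most C pi. F is monotone, so it
    has limits at both ends, and the limit at +oo is subtracted. *)
Lemma le_oneDsqrV_antiderivative (f : R -> R) (C : R) : continuous f ->
  (forall x, 0 <= f x) -> (forall x, f x <= C * (1 + x ^+ 2)^-1) ->
  exists F : R -> R, exists la : R, [/\ forall x : R, is_derive x 1 F (f x),
    F x @[x --> +oo] --> (0 : R) & F x @[x --> -oo] --> la].
Proof.
move=> cf f0 fC; have [F dF] := continuous_antiderivative cf.
have datan (x : R) := @is_derive1_atan R x.
have C0 : 0 <= C.
  by have := le_trans (f0 0) (fC 0); rewrite expr0n addr0 invr1 mulr1.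
have hF : {homo F : x y / x <= y}.
  move=> x y xy; have [u _ E] := is_derive_MVT xy (fun z _ => dF z).
  by rewrite -subr_ge0 E mulr_ge0// subr_ge0.
have hB x y : x <= y -> F y - F x <= C * pi.
  move=> xy; have d (z : R) := is_deriveB' (is_deriveM' (is_derive_cst' z 1 C) (datan z)) (dF z).
  have [u _ /= E] := is_derive_MVT xy (fun z _ => d z).
  have : 0 <= C * atan y - F y - (C * atan x - F x).
    by rewrite E mulr_ge0 ?subr_ge0// mul0r addr0 fC.
  have := atan_ltpi2 y; have := atan_gtNpi2 x => h1 h2.
  have : C * (atan y - atan x) <= C * pi by apply: ler_wpM2l => //; lra.
  by rewrite mulrBr; lra.
have [|l Fl] := @nondecreasing_bounded_cvgy F (F 0 + C * pi) hF.
  move=> x; have [x0|x0] := leP 0 x; first by have := hB _ _ x0; lra.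
  apply: le_trans (hF _ _ (ltW x0)) _; rewrite lerDl mulr_ge0//; exact: pi_ge0.
have [||m Fm] := @nondecreasing_bounded_cvgy (fun x => - F (- x)) (- F 0 + C * pi).
- by move=> x y xy; rewrite lerN2; apply: hF; rewrite lerN2.
- move=> x; have [x0|x0] := leP 0 x; first by have := hB (- x) 0; rewrite oppr_le0 => /(_ x0); lra.
  have := hF 0 (- x); rewrite oppr_ge0 => /(_ (ltW x0)) h.
  have := mulr_ge0 C0 (pi_ge0 R); lra.
exists (fun x => F x - l), (- m - l); split.
- move=> x; apply: (is_derive_eq (is_deriveB' (dF x) (is_derive_cst' x 1 l))).
  by rewrite subr0.
- by rewrite -[X in _ --> X](subrr l); apply: cvgB => //; exact: cvg_cst.
- apply/cvgNy_compNP; apply: cvgB; last exact: cvg_cst.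
  suff : - - F (- x) @[x --> +oo] --> - m by under eq_fun do rewrite opprK.
  exact: cvgN.
Qed.

End bounded_antiderivative.

Lemma ln_opp_derive (R : realType) (f : R -> R) (x a : R) : is_derive x 1 f a -> f x < 0 ->
  is_derive x 1 (fun y => ln (- f y)) (a / f x).
Proof.
move=> df fx; have fx' : 0 < - f x by rewrite oppr_gt0.
apply: (is_derive_eq (is_derive_ln' (is_deriveN' df) fx')).
by rewrite invrN mulrNN mulrC.
Qed.

Lemma fill_eq (R : realType) (f g : R -> R) (a : R) :
  {for a, continuous g} -> (\forall x \near a^', f x = g x) -> fill f a a = g a.
Proof.
move=> cg fg; rewrite /fill eqxx; apply: cvg_lim; first exact: Rhausdorff.
have cg' : g x @[x --> a^'] --> g a by exact/continuous_withinNx.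
by apply: cvg_trans cg'; apply: near_eq_cvg; apply: filterS fg.
Qed.

Section interval_integrals.
Context {R : realType}.
Notation mu := (@lebesgue_measure R).

Lemma integral_segment (f F : R -> R) (a b : R) : a < b ->
  (forall x, a <= x <= b -> {for x, continuous f}) ->
  (forall x, a <= x <= b -> is_derive x 1 F (f x)) ->
  mu.-integrable `[a, b] (EFin \o f) /\ \int[mu]_(x in `[a, b]) f x = F b - F a.
Proof.
move=> ab cf dF.
have cw : {within `[a, b], continuous f}.
  by apply: continuous_in_subspaceT => x; rewrite inE /= in_itv /=; exact: cf.
split; first by apply: continuous_compact_integrable => //; exact: segment_compact.
have cF x : a <= x <= b -> {for x, continuous F}.
  by move=> /dF; exact: is_derive_continuous.
rewrite /Rintegral (@continuous_FTC2 _ f F a b)//; last first.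
- move=> x; rewrite in_itv /= => /andP[/ltW ax /ltW xb].
  by have [|_ <-] := dF x; rewrite ?ax// derive1E.
- split.
  + move=> x; rewrite in_itv /= => /andP[/ltW ax /ltW xb].
    by have [] : is_derive x 1 F (f x) by apply: dF; rewrite ax.
  + by apply: cvg_at_right_filter; apply: cF; rewrite lexx ltW.
  + by apply: cvg_at_left_filter; apply: cF; rewrite lexx ltW.
Qed.

Lemma integrable_obnd_cbnd (f : R -> R) (a : R) :
  mu.-integrable `]a, +oo[ (EFin \o f) -> mu.-integrable `[a, +oo[ (EFin \o f).
Proof.
move=> /integrableP[mf If].
have mf' : measurable_fun `[a, +oo[ f.
  rewrite -(@setU1itv _ _ _ a false) ?bnd_simp//; apply/measurable_funU => //.
  by split; [exact: measurable_fun_set1|exact/measurable_EFinP].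
apply/integrableP; split; first exact/measurable_EFinP.
rewrite -integral_itv_obnd_cbnd//.
apply: measurableT_comp => //; apply/measurable_EFinP.
Qed.

(** Nothing is asked of [f] at 0: there the integrand of log alpha takes the arbitrary value of G at
    its pole. *)
Lemma integral_glue (f g h : R -> R) (a u v : R) : 0 < a ->
  (forall x, 0 < x <= a -> f x = g x) -> (forall x, a <= x -> f x = h x) ->
  mu.-integrable `[0, a] (EFin \o g) /\ \int[mu]_(x in `[0, a]) g x = u ->
  mu.-integrable `[a, +oo[ (EFin \o h) /\ \int[mu]_(x in `[a, +oo[) h x = v ->
  mu.-integrable `[0, +oo[ (EFin \o f) /\ \int[mu]_(x in `[0, +oo[) f x = u + v.
Proof.
move=> a0 fg fh [Ig Eg] [Ih Eh].
have Ig' : mu.-integrable `]0, a] (EFin \o g).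
  by apply: integrableS Ig => //; exact: subset_itv_oc_cc.
have Ih' : mu.-integrable `]a, +oo[ (EFin \o h).
  by apply: integrableS Ih => // x /=; rewrite !in_itv /= !andbT => /ltW.
have If1 : mu.-integrable `]0, a] (EFin \o f).
  by move: Ig'; apply: eq_integrable => // x; rewrite inE /= in_itv /= => /fg ->.
have If2 : mu.-integrable `]a, +oo[ (EFin \o f).
  by move: Ih'; apply: eq_integrable => // x; rewrite inE /= in_itv /= andbT => /ltW/fh ->.
have UE : `]0, +oo[%classic = `]0, a] `|` `]a, +oo[ :> set R.
  by rewrite -itv_bndbnd_setU ?bnd_simp// ltW.
have dj : [disjoint `]0, a]%classic & (`]a, +oo[%classic : set R)].
  apply/disj_setPS => x [] /=; rewrite !in_itv /= andbT => /andP[_ xa].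
  by rewrite ltNge xa.
have If : mu.-integrable `]0, +oo[ (EFin \o f).
  have [/integrableP[m1 i1] /integrableP[m2 i2]] := (If1, If2).
  rewrite UE; have mU : measurable_fun (`]0, a] `|` `]a, +oo[) (EFin \o f).
    by apply/measurable_funU.
  apply/integrableP; split=> //.
  rewrite ge0_integral_setU//; first exact: lte_add_pinfty.
  exact: measurableT_comp.
split; first exact: integrable_obnd_cbnd.
rewrite -Rintegral_itv_obnd_cbnd// UE Rintegral_setU -?UE//; congr (_ + _).
  rewrite -Eg -Rintegral_itv_obnd_cbnd//; apply: eq_Rintegral => x.
  by rewrite inE /= in_itv /= => /fg ->.
rewrite -Eh -Rintegral_itv_obnd_cbnd//; apply: eq_Rintegral => x.
by rewrite inE /= in_itv /= andbT => /ltW/fh ->.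
Qed.

End interval_integrals.

(** * Closed forms of G, alpha, t and phi *)

Section profile.
Context {R : realType}.
Variables (p q c x1 x2 x3 : R).
Hypothesis p2 : 2 <= p.
Hypothesis q1 : 1 < q.
Hypothesis pq : p * q = p + q.
Hypothesis c0 : c < 0.
Hypothesis x1_01 : 0 < x1 < 1.
Hypothesis x21 : x2 < x1.
Hypothesis x31 : x3 < x1.
Hypothesis e1 : x1 + x2 + x3 = 1 - p - q.
Hypothesis e2 : x1 * x2 + x1 * x3 + x2 * x3 = 0.
Hypothesis e3 : 4 * (p + q) * (x1 * x2 * x3) = 4 * (p + q) ^+ 2 - c ^+ 2.
Variables (Th : R -> R) (la : R).

Notation W := (W x1).
Notation L := (L p q x1).
Notation S := (Defs.rad p q x1 x2 x3).
Notation N := (N p q c x1 x2 x3).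
Notation H := (H p q c x1 x2 x3).
Notation phi0 := (phi0 p q x1 Th).
Notation eps := (eps p q x1 Th).
Notation T := (T p q c x1 x2 x3 Th).
Notation chi := (chi p q c x1 x2 x3 Th).

Hypothesis dTh : forall z : R, is_derive z 1 Th (theta p q c x1 x2 x3 z).
Hypothesis Th_y : Th z @[z --> +oo] --> 0.
Hypothesis Th_Ny : Th z @[z --> -oo] --> la.

Let W0 z : 0 < W z := W_gt0 x1_01 z.
Let Wp z : 0 < W z + p := Wp_gt0 p2 x1_01 z.
Let Wq z : 0 < W z + q := Wq_gt0 q1 x1_01 z.
Let L0 z : 0 < L z := L_gt0 p2 q1 pq x1_01 z.
Let S0 z : 0 < S z := S_gt0 p2 q1 x21 x31 z.
Let s0 : 0 < p + q := sum_gt0 p2 q1 pq.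
Let E0 z : 0 < eps z := eps_gt0 p q x1 Th z.
Let NH z := N_mul_H p2 q1 pq x21 x31 e1 e2 e3 z.
Let dN (z : R) : is_derive z 1 N (2 * (p + q) * W z * L z / S z).
Proof. exact: is_derive_N. Qed.

Definition zpole : R := - Num.sqrt (1 - x1).
Notation z0 := zpole.

Lemma zpole_lt0 : z0 < 0.
Proof. by rewrite oppr_lt0 sqrtr_gt0 subr_gt0; case/andP: x1_01. Qed.

Lemma W_zpole : W z0 = 1.
Proof.
rewrite /W sqrrN sqr_sqrtr ?subrK// subr_ge0 ltW//.
by case/andP: x1_01.
Qed.

Lemma W_sub1 z : W z - 1 = (z - z0) * (z + z0).
Proof.
have <- : z ^+ 2 - z0 ^+ 2 = (z - z0) * (z + z0) by ring.
rewrite -{1}W_zpole; rewrite /W; ring.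
Qed.

(** At the pole W = 1, so N H = 0 by [N_mul_H]; and H is negative there, both of its terms being
    negative. *)
Lemma N_zpole : N z0 = 0.
Proof.
have H0 : H z0 < 0.
  rewrite /H; apply: (@lt_trans _ _ c) => //; rewrite gtrDr.
  by rewrite pmulr_llt0 ?S0// pmulr_rlt0// zpole_lt0.
apply/eqP; have /eqP := NH z0; rewrite W_zpole subrr mulr0 !mul0r mulf_eq0.
by rewrite (lt_eqF H0) orbF.
Qed.

Lemma N_homo : {homo N : x y / x < y}.
Proof.
apply: (is_derive_homo dN) => z.
by rewrite divr_gt0 ?S0// !mulr_gt0 ?L0 ?W0.
Qed.

Lemma N_gt0 z : z0 < z -> 0 < N z.
Proof. by move=> /N_homo; rewrite N_zpole. Qed.

Lemma N_lt0 z : z < z0 -> N z < 0.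
Proof. by move=> /N_homo; rewrite N_zpole. Qed.

Lemma N_neq0 z : z != z0 -> N z != 0.
Proof. by rewrite neq_lt => /orP[/N_lt0/lt_eqF->|/N_gt0/gt_eqF->]. Qed.

Lemma T_gt0 z : z0 < z -> 0 < T z.
Proof. by move=> zz; rewrite divr_gt0 ?N_gt0// !mulr_gt0. Qed.

Lemma T_lt0 z : z < z0 -> T z < 0.
Proof.
move=> zz; have D0 : 0 < (2 * (p + q) * eps z)^-1 by rewrite invr_gt0 !mulr_gt0.
by rewrite /T (pmulr_llt0 _ D0) N_lt0.
Qed.

Lemma T_zpole : T z0 = 0. Proof. by rewrite /T N_zpole mul0r. Qed.

Lemma T_neq0 z : z != z0 -> T z != 0.
Proof. by rewrite neq_lt => /orP[/T_lt0/lt_eqF->|/T_gt0/gt_eqF->]. Qed.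

(** G with the factor H cancelled. Since N vanishes at z0 only, the removable singularity has
    disappeared. *)
Definition Ghat z := 2 * (p + q) * L z / (S z * N z).

Lemma Ghat_gt0 z : z0 < z -> 0 < Ghat z.
Proof. by move=> /N_gt0 n0; rewrite divr_gt0 ?mulr_gt0. Qed.

Lemma Ghat_lt0 z : z < z0 -> Ghat z < 0.
Proof.
move=> /N_lt0 n0; rewrite /Ghat -oppr_gt0 -mulrN -invrN -mulrN.
by rewrite divr_gt0 ?mulr_gt0 ?oppr_gt0.
Qed.

(** The bracket is L / ((W - 1)(W + p)(W + q)) = 4 (p + q) L / (N H), and the other factor is H / (2
    S). The point -z0 is excluded because W - 1, hence N H, vanishes there. *)
Lemma G_formulaE z : z != z0 -> z != - z0 -> G_formula p q c x1 x2 x3 z = Ghat z.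
Proof.
move=> zz zz'.
have w1 : W z - 1 != 0.
  by rewrite W_sub1 mulf_eq0 negb_or (subr_eq0 z z0) (addr_eq0 z z0) zz.
have h0 : H z != 0.
  apply: contraNneq w1 => h0; have := NH z; rewrite h0 mulr0 => /esym/eqP.
  by rewrite !mulf_eq0 (gt_eqF (Wp z)) (gt_eqF (Wq z)) (gt_eqF s0) !orbF pnatr_eq0.
have n0 := N_neq0 zz.
have [u1 u2 u3] := inv_pq p2 q1 pq.
rewrite /G_formula -/(W z).
have -> : z + c / (2 * S z) = H z / (2 * S z).
  by rewrite /H; field; rewrite gt_eqF ?S0.
have P0 := p_gt0 p2; have Q0 := q_gt0 q1.
have -> : 1 / (W z - 1) - 1 / (p * (W z + p)) - 1 / (q * (W z + q)) =
   L z / ((W z - 1) * (W z + p) * (W z + q)).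
  have -> : L z = (W z + p) * (W z + q) - (W z - 1) * (p^-1 * (W z + q) + q^-1 * (W z + p)).
    have -> : p^-1 * (W z + q) + q^-1 * (W z + p) =
      W z * (p^-1 + q^-1) + p^-1 * q + q^-1 * p by ring.
    by rewrite u1 u2 u3 (WpWq x1 pq) /L; ring.
  by field; rewrite w1 !gt_eqF ?Wp ?Wq.
rewrite /Ghat; have -> : L z / ((W z - 1) * (W z + p) * (W z + q)) =
  4 * (p + q) * L z / (N z * H z) by rewrite NH; field; rewrite w1 !gt_eqF ?Wp ?Wq.
by field; rewrite n0 h0 gt_eqF ?S0.
Qed.

Let nS z : S z != 0. Proof. by rewrite gt_eqF ?S0. Qed.

Lemma continuous_Ghat z : z != z0 -> {for z, continuous Ghat}.
Proof.
move=> /N_neq0 n0.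
have dL := is_deriveB' (is_deriveD' (is_deriveM' (is_derive_cst' z 1 3) (is_derive_W x1 z))
  (is_derive_cst' z 1 (2 * (p + q)))) (is_derive_cst' z 1 2).
have dS := is_derive_S p2 q1 x21 x31 z.
have SN : S z * N z != 0 by rewrite mulf_neq0.
have d : is_derive z 1 Ghat _ := is_deriveM' (is_deriveM' (is_derive_cst' z 1 (2 * (p + q))) dL)
  (is_deriveV' (is_deriveM' dS (dN z)) SN).
exact: is_derive_continuous d.
Qed.

Notation G := (G_fun p q c x1 x2 x3).

Lemma G_funE z : z != z0 -> G z = Ghat z.
Proof.
move=> zz; have zp : Num.sqrt (1 - x1) = - z0 by rewrite opprK.
(* [fill] acts only at -z0, where its value is the limit of the formula, that is, of the continuous
   function [Ghat]. *)
have [zE|zz'] := eqVneq z (- z0); last first.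
  by rewrite /G_fun /fill zp (negbTE zz') G_formulaE.
rewrite zE /G_fun zp; apply: fill_eq.
  by apply: continuous_Ghat; rewrite -zE.
have nz : \forall x \near (- z0), x != z0.
  have := @open_nbhs_nbhs R (- z0) [set x | x != z0]; apply; split; last by rewrite /= -zE.
  exact: open_neq.
rewrite near_withinE; near=> x => xz; apply: G_formulaE => //; near: x; exact: nz.
Unshelve. all: by end_near. Qed.

Let eq4 (f : 'I_4 -> Prop) : f 0 -> f 1 -> f 2 -> f 3 -> forall i, f i.
Proof.
move=> f0 f1 f2 f3 [[|[|[|[|//]]]] i].
- by have -> : Ordinal i = 0 by apply: val_inj.
- by have -> : Ordinal i = 1 by apply: val_inj.
- by have -> : Ordinal i = 2 by apply: val_inj.
- by have -> : Ordinal i = 3 by apply: val_inj.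
Qed.

Lemma falg_eq (V : normedModType R) (gen : (V -> R) -> Prop) f g :
  falg gen f -> (forall x, f x = g x) -> falg gen g.
Proof. by move=> ff /funext <-. Qed.

(** The generators id, S, 1/S and 1/N are closed under differentiation away from the pole. *)
Lemma analytic_Ghat z : z != z0 -> analytic_at Ghat z.
Proof.
move=> zz; pose gen (i : 'I_4) : R -> R :=
  nth (fun=> 0) [:: id; S; fun y => (S y)^-1; fun y => (N y)^-1] i.
pose dgen (i : 'I_4) : R -> R :=
  nth (fun=> 0) [:: fun=> 1; fun y => (p + q) * y * (2 * W y - x2 - x3) / S y;
     fun y => - ((p + q) * y * (2 * W y - x2 - x3) / S y) / S y ^+ 2;
     fun y => - (2 * (p + q) * W y * L y / S y) / N y ^+ 2] i.
have nz : \forall x \near z, x != z0.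
  by have := @open_nbhs_nbhs R z [set x | x != z0]; apply; split; [exact: open_neq|].
have g0 : falg (isgen gen) id by apply: falg_gen; exists 0.
have g1 : falg (isgen gen) S by apply: falg_gen; exists 1.
have g2 : falg (isgen gen) (fun y => (S y)^-1) by apply: falg_gen; exists 2.
have g3 : falg (isgen gen) (fun y => (N y)^-1) by apply: falg_gen; exists 3.
have gc a : falg (isgen gen) (fun=> a) := falg_cst _ a.
have gW : falg (isgen gen) W by apply: falg_add => //; exact: (falg_mul g0 g0).
have gL : falg (isgen gen) L.
  by apply: falg_add => //; apply: falg_add => //; exact: falg_mul.
have gW2 : falg (isgen gen) (fun y => 2 * W y - x2 - x3).
  by apply: falg_add => //; apply: falg_add => //; exact: falg_mul.
have gdS : falg (isgen gen) (fun y => (p + q) * y * (2 * W y - x2 - x3) / S y).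
  by apply: falg_mul => //; apply: falg_mul => //; exact: falg_mul.
apply: (@falg_analytic _ 4 gen dgen).
- near=> y; have yz : y != z0 by near: y; exact: nz.
  apply: eq4; rewrite /gen /dgen /=.
  + exact: is_derive_id'.
  + exact: is_derive_S.
  + by apply: is_deriveV' => //; exact: is_derive_S.
  + by apply: is_deriveV'; [exact: dN|exact: N_neq0].
- apply: eq4; rewrite /dgen //=.
  + apply: (@falg_eq _ _ (fun y => - ((p + q) * y * (2 * W y - x2 - x3) / S y) * ((S y)^-1 * (S y)^-1))).
      by apply: falg_mul; [exact: falg_opp|exact: falg_mul].
    by move=> y; rewrite -expr2 exprVn.
  + apply: (@falg_eq _ _ (fun y => - (2 * (p + q) * W y * L y / S y) * ((N y)^-1 * (N y)^-1))).
      apply: falg_mul; last exact: falg_mul.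
      apply: falg_opp; apply: falg_mul => //; apply: falg_mul => //; exact: falg_mul.
    by move=> y; rewrite -expr2 exprVn.
- apply: (@falg_eq _ _ (fun y => 2 * (p + q) * L y * ((S y)^-1 * (N y)^-1))).
    by apply: falg_mul; [exact: falg_mul|exact: falg_mul].
  by move=> y; rewrite /Ghat invfM.
Unshelve. all: by end_near. Qed.

Lemma analytic_G z : z != z0 -> analytic_at G z.
Proof.
move=> zz; apply: analytic_at_near_eq (analytic_Ghat zz).
have nz : \forall x \near z, x != z0.
  by have := @open_nbhs_nbhs R z [set x | x != z0]; apply; split; [exact: open_neq|].
by apply: filterS nz => x /G_funE ->.
Qed.

Lemma S_even z : S (- z) = S z. Proof. by rewrite /Defs.rad sqrrN. Qed.

Lemma H_eqN z : H z = - N (- z).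
Proof. by rewrite /H /N S_even; ring. Qed.

Lemma H_lt0 z : z < - z0 -> H z < 0.
Proof. by move=> zz; rewrite H_eqN oppr_lt0 N_gt0// ltrNr. Qed.

(** (z - z0) times [Ghat], with 1/N replaced through N H and W - 1 = (z - z0)(z + z0). In this form
    it is regular at z0. *)
Definition Gam z := L z * H z / (2 * S z * (z + z0) * ((W z + p) * (W z + q))).

Lemma Ghat_Gam z : z != z0 -> z < - z0 -> Ghat z = Gam z / (z - z0).
Proof.
move=> zz zlt; have n0 := N_neq0 zz; have h0 : H z != 0 by rewrite lt_eqF// H_lt0.
have d1 : z - z0 != 0 by rewrite subr_eq0.
have d2 : z + z0 != 0 by rewrite addr_eq0 lt_eqF.
have -> : Gam z / (z - z0) = L z * H z / (2 * S z * ((W z - 1) * (W z + p) * (W z + q))).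
  by rewrite W_sub1 /Gam; field; rewrite d1 d2 !gt_eqF ?S0 ?Wp ?Wq.
have -> : (W z - 1) * (W z + p) * (W z + q) = N z * H z / (4 * (p + q)).
  by rewrite NH; field; rewrite gt_eqF.
by rewrite /Ghat; field; rewrite n0 h0 !gt_eqF ?S0.
Qed.

(** N z0 = 0 gives H z0 = 4 z0 S z0, and at W = 1 both L and (W + p)(W + q) equal 1 + 2 (p + q). *)
Lemma Gam_zpole : Gam z0 = 1.
Proof.
have z00 : z0 != 0 by rewrite lt_eqF// zpole_lt0.
have E : H z0 = 4 * z0 * S z0.
  have -> : H z0 = 4 * z0 * S z0 - N z0 by rewrite /H /N; ring.
  by rewrite N_zpole subr0.
have F (y w : R) : y != 0 -> w != 0 ->
    (3 * 1 + 2 * (p + q) - 2) * (4 * y * w) /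
    (2 * w * (y + y) * (1 ^+ 2 + (p + q) * 1 + (p + q))) = 1.
  move=> y0 w0; have -> : y + y = 2 * y by ring.
  by field; rewrite w0 y0 gt_eqF//; move: s0; lra.
by rewrite /Gam E (WpWq x1 pq) /L W_zpole; exact: F.
Qed.

Let ltNz0_near z : z < - z0 -> \forall y \near z, y < - z0.
Proof. by move=> zz; have := cvgr_lt _ (@cvg_id _ (nbhs z)) _ zz; apply. Qed.

Lemma analytic_Gam : analytic_at Gam z0.
Proof.
pose gens := [:: id; S; fun y => (S y)^-1; fun y => (y + z0)^-1;
     fun y => (W y + p)^-1; fun y => (W y + q)^-1].
pose dgens := [:: fun=> 1; fun y => (p + q) * y * (2 * W y - x2 - x3) / S y;
     fun y => - ((p + q) * y * (2 * W y - x2 - x3) / S y) / S y ^+ 2;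
     fun y => - (1 + 0) / (y + z0) ^+ 2;
     fun y => - (2 * y + 0) / (W y + p) ^+ 2; fun y => - (2 * y + 0) / (W y + q) ^+ 2].
pose gen (i : 'I_6) : R -> R := nth (fun=> 0) gens i.
pose dgen (i : 'I_6) : R -> R := nth (fun=> 0) dgens i.
have nz : \forall x \near z0, x < - z0.
  by apply: ltNz0_near; rewrite (lt_trans zpole_lt0)// oppr_gt0 zpole_lt0.
have g0 : falg (isgen gen) id by apply: falg_gen; exists (inord 0); rewrite /gen inordK.
have g1 : falg (isgen gen) S by apply: falg_gen; exists (inord 1); rewrite /gen inordK.
have g2 : falg (isgen gen) (fun y => (S y)^-1) by apply: falg_gen; exists (inord 2); rewrite /gen inordK.
have g3 : falg (isgen gen) (fun y => (y + z0)^-1) by apply: falg_gen; exists (inord 3); rewrite /gen inordK.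
have g4 : falg (isgen gen) (fun y => (W y + p)^-1) by apply: falg_gen; exists (inord 4); rewrite /gen inordK.
have g5 : falg (isgen gen) (fun y => (W y + q)^-1) by apply: falg_gen; exists (inord 5); rewrite /gen inordK.
have gc a : falg (isgen gen) (fun=> a) := falg_cst _ a.
have gW : falg (isgen gen) W by apply: falg_add => //; exact: (falg_mul g0 g0).
have gL : falg (isgen gen) L.
  by apply: falg_add => //; apply: falg_add => //; exact: falg_mul.
have gW2 : falg (isgen gen) (fun y => 2 * W y - x2 - x3).
  by apply: falg_add => //; apply: falg_add => //; exact: falg_mul.
have gdS : falg (isgen gen) (fun y => (p + q) * y * (2 * W y - x2 - x3) / S y).
  by apply: falg_mul => //; apply: falg_mul => //; exact: falg_mul.
have sq f g : falg (isgen gen) f -> falg (isgen gen) (fun y => (g y)^-1) ->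
    falg (isgen gen) (fun y => - f y / g y ^+ 2).
  move=> ff fg; apply: (@falg_eq _ _ (fun y => - f y * ((g y)^-1 * (g y)^-1))).
    by apply: falg_mul; [exact: falg_opp|exact: falg_mul].
  by move=> y; rewrite -expr2 exprVn.
have g2y : falg (isgen gen) (fun y => 2 * y + 0).
  by apply: falg_add => //; exact: falg_mul.
apply: (@falg_analytic _ 6 gen dgen).
- near=> y; have yz : y < - z0 by near: y; exact: nz.
  have dWy a := is_deriveD' (is_derive_W x1 y) (is_derive_cst' y 1 a).
  case=> -[|[|[|[|[|[|//]]]]]] i; rewrite /gen /dgen /=.
  + exact: is_derive_id'.
  + exact: is_derive_S.
  + by apply: is_deriveV' => //; exact: is_derive_S.
  + have d := is_deriveD' (is_derive_id' y) (is_derive_cst' y 1 z0).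
    by apply: (is_deriveV' d); rewrite addr_eq0 lt_eqF.
  + by apply: (is_deriveV' (dWy p)); rewrite gt_eqF ?Wp.
  + by apply: (is_deriveV' (dWy q)); rewrite gt_eqF ?Wq.
- by case=> -[|[|[|[|[|[|//]]]]]] i; rewrite /dgen //=; apply: sq => //; exact: falg_add.
- apply: (@falg_eq _ _ (fun y => L y * (2 * y * S y + c) * (2^-1 * (S y)^-1 * (y + z0)^-1 *
     ((W y + p)^-1 * (W y + q)^-1)))).
    apply: falg_mul; first apply: falg_mul => //.
      by apply: falg_add => //; apply: falg_mul => //; exact: falg_mul.
    by apply: falg_mul; [apply: falg_mul => //; exact: falg_mul|exact: falg_mul].
  by move=> y; rewrite /Gam /H !invfM.
Unshelve. all: by end_near. Qed.

(** The regular part is the divided difference of [Gam] at z0, and the residue is its value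
    there. *)
Lemma pole_G : simple_pole_with_residue G z0 1.
Proof.
split; first exact: oner_neq0.
have [g ag gE] := analytic_at_divided_difference analytic_Gam.
exists g; split=> //.
have zz : z0 < - z0 by rewrite (lt_trans zpole_lt0)// oppr_gt0 zpole_lt0.
rewrite near_withinE; apply: filterS (ltNz0_near zz) => x xz xn.
rewrite G_funE// Ghat_Gam// gE// Gam_zpole mulrBl addrCA subrr addr0//.
Qed.

Notation mu := (@lebesgue_measure R).
Let dT (z : R) : is_derive z 1 T (L z / (S z * eps z)).
Proof. exact: is_derive_T. Qed.

(** G is the logarithmic derivative of T; this identifies T with the exponentials of integrals that
    define t. *)
Let GhatT z : z != z0 -> L z / (S z * eps z) / T z = Ghat z.
Proof.
by move=> /N_neq0 n0; rewrite /T /Ghat; field; rewrite n0 !gt_eqF ?S0 ?E0.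
Qed.

Lemma is_derive_lnT (z : R) : z0 < z -> is_derive z 1 (fun y => ln (T y)) (Ghat z).
Proof.
move=> zz; apply: (is_derive_eq (is_derive_ln' (dT z) (T_gt0 zz))).
by rewrite -GhatT ?gt_eqF// mulrC.
Qed.

Lemma is_derive_lnNT (z : R) : z < z0 -> is_derive z 1 (fun y => ln (- T y)) (Ghat z).
Proof.
move=> zz; apply: (is_derive_eq (ln_opp_derive (dT z) (T_lt0 zz))).
by rewrite -GhatT ?lt_eqF.
Qed.

Let T_y : T z @[z --> +oo] --> (1 : R).
Proof. exact: T_cvgy. Qed.
Let T_Ny : T z @[z --> -oo] --> - expR la.
Proof. exact: T_cvgNy. Qed.

Lemma lnT_cvgy : ln (T z) @[z --> +oo] --> (0 : R).
Proof. by rewrite -ln1; apply: (cvg_comp _ _ T_y); exact: continuous_ln. Qed.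

Lemma lnNT_cvgNy : ln (- T z) @[z --> -oo] --> la.
Proof.
rewrite -[X in _ --> X]expRK; have TN : - T z @[z --> -oo] --> expR la.
  by rewrite -[X in _ --> X]opprK; exact: cvgN.
by apply: (cvg_comp _ _ TN); exact/continuous_ln/expR_gt0.
Qed.

Lemma integral_Ghat_y z : z0 < z ->
  mu.-integrable `[z, +oo[ (EFin \o Ghat) /\ \int[mu]_(s in `[z, +oo[) Ghat s = - ln (T z).
Proof.
move=> zz; rewrite -[X in _ /\ _ = X]sub0r; apply: (@ge0_integral_y _ Ghat (fun y => ln (T y))).
- by move=> x zx; apply/ltW/Ghat_gt0; exact: lt_le_trans zx.
- by move=> x zx; apply: continuous_Ghat; rewrite gt_eqF// (lt_le_trans zz).
- by move=> x zx; apply: is_derive_lnT; exact: lt_le_trans zx.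
- exact: lnT_cvgy.
Qed.

Lemma integral_Ghat_Ny z : z < z0 ->
  mu.-integrable `]-oo, z] (EFin \o Ghat) /\
  \int[mu]_(s in `]-oo, z]) Ghat s = ln (- T z) - la.
Proof.
move=> zz; apply: (@le0_integral_Ny _ Ghat (fun y => ln (- T y))).
- by move=> x zx; apply/ltW/Ghat_lt0; exact: le_lt_trans zz.
- by move=> x zx; apply: continuous_Ghat; rewrite lt_eqF// (le_lt_trans zx).
- by move=> x zx; apply: is_derive_lnNT; exact: le_lt_trans zz.
- exact: lnNT_cvgNy.
Qed.

Lemma integrable_G_y z : z0 < z -> mu.-integrable `[z, +oo[ (EFin \o G).
Proof.
move=> zz; have [+ _] := integral_Ghat_y zz; apply: eq_integrable => // x.
rewrite inE /= in_itv /= andbT => zx; rewrite G_funE// gt_eqF//.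
exact: lt_le_trans zx.
Qed.

Lemma integrable_G_Ny z : z < z0 -> mu.-integrable `]-oo, z] (EFin \o G).
Proof.
move=> zz; have [+ _] := integral_Ghat_Ny zz; apply: eq_integrable => // x.
rewrite inE /= in_itv /= => zx; rewrite G_funE// lt_eqF//.
exact: le_lt_trans zz.
Qed.

Notation a := (- z0).
Let a_gt0 : 0 < a. Proof. by rewrite oppr_gt0 zpole_lt0. Qed.

Let dchi z := ((p + q) * eps z + chi z ^+ 2 * (W z + p + q - 2) / eps z) / S z.
Let is_dchi (z : R) : is_derive z 1 chi (dchi z). Proof. exact: is_derive_chi. Qed.

Lemma chi_lt0 z : z < a -> chi z < 0.
Proof.
move=> /H_lt0 H0; have D0 : 0 < (2 * (W z + p) * (W z + q))^-1 by rewrite invr_gt0 !mulr_gt0.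
by rewrite /chi (pmulr_llt0 _ D0) (pmulr_llt0 _ (E0 z)).
Qed.

(** The cofactor of z - z0 in T, read off from chi T = (z - z0)(z + z0). It is positive to the left
    of -z0, so ln T1 passes through the pole. *)
Let T1 z := (z + z0) / chi z.
Let T1_gt0 z : z < a -> 0 < T1 z.
Proof.
move=> za; rewrite /T1 -[X in 0 < X]mulrNN -invrN divr_gt0// oppr_gt0 ?chi_lt0//.
by move: za; lra.
Qed.

Let T1E z : z < a -> T z = (z - z0) * T1 z.
Proof.
move=> za; have c1 : chi z != 0 by rewrite lt_eqF ?chi_lt0.
by apply: (mulfI c1); rewrite chi_mul_T// W_sub1 /T1; field.
Qed.

(** The derivative of ln T1, that is, the regular part of G at the pole. *)
Let gg z := (z + z0)^-1 - dchi z / chi z.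
Let is_derive_lnT1 (z : R) : z < a -> is_derive z 1 (fun y => ln (T1 y)) (gg z).
Proof.
move=> za; have c1 : chi z != 0 by rewrite lt_eqF ?chi_lt0.
have z1 : z + z0 != 0 by rewrite (addr_eq0 z z0) lt_eqF.
have d : is_derive z 1 T1 _ := is_deriveM' (is_deriveD' (is_derive_id' z) (is_derive_cst' z 1 z0))
  (is_deriveV' (is_dchi z) c1).
apply: (is_derive_eq (is_derive_ln' d (T1_gt0 za))).
by rewrite /T1 /gg; field; rewrite c1 z1.
Qed.

Let Ghat_gg z : z != z0 -> z < a -> Ghat z = (z - z0)^-1 + gg z.
Proof.
move=> zz za; have c1 : chi z != 0 by rewrite lt_eqF ?chi_lt0.
have z1 : z + z0 != 0 by rewrite (addr_eq0 z z0) lt_eqF.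
have z2 : z - z0 != 0 by rewrite (subr_eq0 z z0).
have t0 := T_neq0 zz.
have d := is_deriveM' (is_dchi z) (dT z).
have E : (fun y => chi y * T y) = (fun y => W y - 1) by apply/funext => y; exact: chi_mul_T.
rewrite E in d; have {E} := is_derive_unique d (is_deriveB' (is_derive_W x1 z) (is_derive_cst' z 1 1)).
rewrite subr0 => E.
rewrite -GhatT//.
have -> : L z / (S z * eps z) / T z = 2 * z / (chi z * T z) - dchi z / chi z.
  have -> : 2 * z = chi z * (L z / (S z * eps z)) + dchi z * T z by rewrite E.
  by field; rewrite c1 t0 !gt_eqF ?S0 ?E0.
rewrite chi_mul_T// W_sub1 /gg.
by field; rewrite c1 z1 z2.
Qed.

Let continuous_gg z : z < a -> {for z, continuous gg}.
Proof.
move=> za; have c1 : chi z != 0 by rewrite lt_eqF ?chi_lt0.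
have z1 : z + z0 != 0 by rewrite (addr_eq0 z z0) lt_eqF.
have dE : is_derive z 1 eps (eps z * (L z * H z / (2 * S z * (W z + p) * (W z + q)))).
  exact: is_derive_eps.
have dVE := is_deriveV' dE (lt0r_neq0 (E0 z)).
have dS := is_derive_S p2 q1 x21 x31 z.
have dVS := is_deriveV' dS (nS z).
have dW := is_deriveB' (is_deriveD' (is_deriveD' (is_derive_W x1 z) (is_derive_cst' z 1 p))
  (is_derive_cst' z 1 q)) (is_derive_cst' z 1 2).
have d1 := is_deriveM' (is_deriveD' (is_deriveM' (is_derive_cst' z 1 (p + q)) dE)
  (is_deriveM' (is_deriveM' (is_deriveX' 1 (is_dchi z)) dW) dVE)) dVS.
have d : is_derive z 1 gg _ := is_deriveB'
   (is_deriveV' (is_deriveD' (is_derive_id' z) (is_derive_cst' z 1 z0)) z1)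
  (is_deriveM' d1 (is_deriveV' (is_dchi z) c1)).
exact: is_derive_continuous d.
Qed.

Let dshift (z b : R) : is_derive z 1 (fun y : R => y + b) 1.
Proof. by apply: (is_derive_eq (is_deriveD' (is_derive_id' z) (is_derive_cst' z 1 b))); rewrite addr0. Qed.
Let dflip (z b : R) : is_derive z 1 (fun y : R => - y + b) (- 1).
Proof. by apply: (is_derive_eq (is_deriveD' (is_deriveN' (is_derive_id' z)) (is_derive_cst' z 1 b))); rewrite addr0. Qed.
Let cshift (f : R -> R) (z b : R) : {for z + b, continuous f} ->
  {for z, continuous (fun y => f (y + b))}.
Proof. by move=> cf; apply: (@continuous_comp _ _ _ (fun y => y + b) f) => //; apply: is_derive_continuous (dshift z b). Qed.
Let cflip (f : R -> R) (z b : R) : {for - z + b, continuous f} ->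
  {for z, continuous (fun y => f (- y + b))}.
Proof. by move=> cf; apply: (@continuous_comp _ _ _ (fun y => - y + b) f) => //; apply: is_derive_continuous (dflip z b). Qed.

(** Up to s = a the terms 1/s and -1/s cancel and ln T1 gives an antiderivative; beyond a, ln |T|
    does. The terms at a match, leaving only the limits 0 and [la] of ln |T|. The cut at a = -z0
    keeps s + z0 <= 0, where T1 is positive. *)
Lemma integral_G_both :
  mu.-integrable `[0, +oo[ (EFin \o (fun s => G (s + z0) + G (- s + z0))) /\
  \int[mu]_(s in `[0, +oo[) (G (s + z0) + G (- s + z0)) = - la.
Proof.
have aa := a_gt0.
have -> : - la = (ln (T (a + z0)) - ln (- T (- a + z0))) +
   ((0 - ln (T (a + z0))) + (- la - (- ln (- T (- a + z0))))) by ring.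
apply: (@integral_glue _ _ (fun s => gg (s + z0) + gg (- s + z0))
         (fun s => Ghat (s + z0) + Ghat (- s + z0)) a) => //.
- move=> s /andP[s1 s2].
  have n1 : s + z0 != z0 by rewrite -subr_eq0 addrK gt_eqF.
  have n2 : - s + z0 != z0 by rewrite -subr_eq0 addrK oppr_eq0 gt_eqF.
  rewrite !G_funE// !Ghat_gg//; try lra.
  by rewrite !addrK invrN addrACA subrr add0r.
- move=> s s1.
  have n1 : s + z0 != z0 by rewrite -subr_eq0 addrK gt_eqF// (lt_le_trans aa).
  have n2 : - s + z0 != z0 by rewrite -subr_eq0 addrK oppr_eq0 gt_eqF// (lt_le_trans aa).
  by rewrite !G_funE.
(* The two contributions at s = 0 are both ln T1 z0 and cancel; so do the two terms ln a that come
   from |z - z0| = a. *)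
- have -> : ln (T (a + z0)) - ln (- T (- a + z0)) =
    (ln (T1 (a + z0)) - ln (T1 (- a + z0))) - (ln (T1 (0 + z0)) - ln (T1 (- 0 + z0))).
    rewrite oppr0 !subrr subr0 !T1E; try lra.
    have t1 : 0 < T1 (a + z0) by apply: T1_gt0; lra.
    have t2 : 0 < T1 (- a + z0) by apply: T1_gt0; lra.
    have -> : a + z0 - z0 = a by ring.
    have -> : - ((- a + z0 - z0) * T1 (- a + z0)) = a * T1 (- a + z0) by ring.
    have lnE y : 0 < y -> ln (a * y) = ln a + ln y by move=> y0; rewrite lnM ?posrE.
    by rewrite (lnE _ t1) (lnE _ t2) opprD addrACA subrr add0r.
  apply: (@integral_segment _ _ (fun s => ln (T1 (s + z0)) - ln (T1 (- s + z0)))) => //.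
  + move=> s /andP[s1 s2]; apply: continuousD.
      by apply: cshift; apply: continuous_gg; lra.
    by apply: cflip; apply: continuous_gg; lra.
  + move=> s /andP[s1 s2].
    have l1 : s + z0 < a by lra.
    have l2 : - s + z0 < a by lra.
    have d1 : is_derive s 1 (fun y => ln (T1 (y + z0))) (gg (s + z0) * 1).
      exact (@is_derive_scomp R R (fun y : R => y + z0) (fun y => ln (T1 y)) s 1 (gg (s+z0)) 1 (is_derive_lnT1 l1) (dshift s z0)).
    have d2 : is_derive s 1 (fun y => ln (T1 (- y + z0))) (gg (- s + z0) * - 1).
      exact (@is_derive_scomp R R (fun y : R => - y + z0) (fun y => ln (T1 y)) s 1 (gg (- s + z0)) (- 1) (is_derive_lnT1 l2) (dflip s z0)).
    by have := is_deriveB' d1 d2; rewrite mulr1 mulrN1 opprK.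
- have [i1 j1] : mu.-integrable `[a, +oo[ (EFin \o (fun s => Ghat (s + z0))) /\
      \int[mu]_(s in `[a, +oo[) Ghat (s + z0) = 0 - ln (T (a + z0)).
    apply: (@ge0_integral_y _ (fun s => Ghat (s + z0)) (fun s => ln (T (s + z0)))) => [s s1|s s1|s s1|].
    + by apply/ltW/Ghat_gt0; lra.
    + by apply: cshift; apply: continuous_Ghat; rewrite gt_eqF//; lra.
    + have l1 : z0 < s + z0 by lra.
      by have := @is_derive_scomp R R (fun y : R => y + z0) (fun y => ln (T y)) s 1 _ 1 (is_derive_lnT l1) (dshift s z0); rewrite mulr1.
    + apply: (cvg_comp _ _ _ lnT_cvgy).
      exact: cvg_addrr.
  have [i2 j2] : mu.-integrable `[a, +oo[ (EFin \o (fun s => Ghat (- s + z0))) /\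
      \int[mu]_(s in `[a, +oo[) Ghat (- s + z0) = - la - (- ln (- T (- a + z0))).
    apply: (@le0_integral_y _ (fun s => Ghat (- s + z0)) (fun s => - ln (- T (- s + z0)))) => [s s1|s s1|s s1|].
    + by apply/ltW/Ghat_lt0; lra.
    + by apply: cflip; apply: continuous_Ghat; rewrite lt_eqF//; lra.
    + have l1 : - s + z0 < z0 by lra.
      have := is_deriveN' (@is_derive_scomp R R (fun y : R => - y + z0) (fun y => ln (- T y)) s 1 _ (- 1)
         (is_derive_lnNT l1) (dflip s z0)).
      by rewrite mulrN1 opprK.
    + apply: cvgN; apply: (cvg_comp _ _ _ lnNT_cvgNy).
      have nn : - x @[x --> +oo] --> (-oo : set_system R) by rewrite (@ninfty R).
      exact: (cvg_comp _ _ nn (cvg_addrr_Ny z0)).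
  split; last by rewrite RintegralD// j1 j2.
  have -> : EFin \o (fun s => Ghat (s + z0) + Ghat (- s + z0)) =
     (EFin \o (fun s => Ghat (s + z0))) \+ (EFin \o (fun s => Ghat (- s + z0)))%E by [].
  exact: integrableD.
Qed.

Lemma alpha_ofE : alpha_of G z0 = expR la.
Proof. by rewrite /alpha_of integral_G_both.2 opprK. Qed.

Lemma t_ofE : t_of G z0 = T.
Proof.
apply/funext => z; rewrite /t_of.
have [zz|zz|<-] := ltgtP z0 z; last by rewrite T_zpole.
- have -> : \int[mu]_(s in `[z, +oo[) G s = - ln (T z).
    rewrite -(integral_Ghat_y zz).2; apply: eq_Rintegral => x.
    rewrite inE /= in_itv /= andbT => zx; rewrite G_funE// gt_eqF//.
    exact: lt_le_trans zx.
  by rewrite opprK lnK// posrE T_gt0.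
- have -> : \int[mu]_(s in `]-oo, z]) G s = ln (- T z) - la.
    rewrite -(integral_Ghat_Ny zz).2; apply: eq_Rintegral => x.
    rewrite inE /= in_itv /= => zx; rewrite G_funE// lt_eqF//.
    exact: le_lt_trans zz.
  rewrite alpha_ofE expRD lnK ?posrE ?oppr_gt0 ?T_lt0// expRN.
  by field; rewrite gt_eqF ?expR_gt0.
Qed.

Lemma phi_argE z : z != z0 -> phi_arg p q c x1 x2 x3 T z = eps z.
Proof.
move=> zz; have t0 := N_neq0 zz.
rewrite /phi_arg -/(Defs.rad _ _ _ _ _ _) [- c + _]addrC -/(N z) /T.
by field; rewrite t0 !gt_eqF ?E0.
Qed.

Lemma continuous_phi0 : continuous phi0.
Proof.
move=> z; have d : is_derive z 1 phi0 (chi z * (L z / (S z * eps z))) by exact: is_derive_phi0.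
exact: is_derive_continuous d.
Qed.

Lemma phi_ofE : phi_of p q c x1 x2 x3 T z0 = phi0.
Proof.
apply/funext => z; rewrite /phi_of; have [->|zz] := eqVneq z z0.
  apply: fill_eq; first exact: continuous_phi0.
  rewrite near_withinE; near=> x => xz.
  by rewrite phi_argE// /eps expRK.
by rewrite /fill (negbTE zz) phi_argE// /eps expRK.
Unshelve. all: by end_near. Qed.

End profile.

(** * The roots of the cubic *)

Section cubic_roots.
Context {R : realType}.
Variables (p q c : R).
Hypothesis p2 : 2 <= p.
Hypothesis upq : 1 / p + 1 / q = 1.
Hypothesis hc : - (2 * (p + q)) < c < 0.

Let P0 : 0 < p. Proof. by move: p2; lra. Qed.

Lemma conj_neq0 : q != 0.
Proof.
apply/eqP => q0; move: upq; rewrite q0 invr0 mulr0 addr0 div1r => /eqP.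
by rewrite invr_eq1 => /eqP; move: p2; lra.
Qed.

Lemma conj_mul : p * q = p + q.
Proof.
have := upq; have := conj_neq0; have P := lt0r_neq0 P0 => q0 E.
have -> : p * q = (1 / p + 1 / q) * (p * q) by rewrite E mul1r.
by field; rewrite q0 P.
Qed.

Lemma conj_gt1 : 1 < q.
Proof.
have E : (q - 1) * (p - 1) = 1.
  by rewrite mulrBl mulrBr mul1r mulr1 [q * p]mulrC conj_mul; ring.
have p1 : 0 < p - 1 by move: p2; lra.
have : 0 < (q - 1) * (p - 1) by rewrite E.
by rewrite pmulr_lgt0// subr_gt0.
Qed.

Lemma conj_le : q <= p.
Proof.
have E : (q - 1) * (p - 1) = 1.
  by rewrite mulrBl mulrBr mul1r mulr1 [q * p]mulrC conj_mul; ring.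
rewrite leNgt; apply/negP => pq; move: p2 pq E; nra.
Qed.

Let s0 : 0 < p + q. Proof. by move: P0 conj_gt1; lra. Qed.

Lemma horner_cubic x :
  (cubic p q c).[x] = c ^+ 2 + 4 * (p + q) * ((x - 1) * (x + p) * (x + q)).
Proof. by rewrite /cubic !hornerE. Qed.

Lemma cubicE x : (cubic p q c).[x] =
  c ^+ 2 + 4 * (p + q) * (x ^+ 3 + (p + q - 1) * x ^+ 2 - (p + q)).
Proof.
rewrite horner_cubic; congr (_ + _ * _).
have -> : (x - 1) * (x + p) * (x + q) =
  x ^+ 3 + (p + q - 1) * x ^+ 2 + (p * q - (p + q)) * x - p * q by ring.
by rewrite conj_mul; ring.
Qed.

Let c2_gt0 : 0 < c ^+ 2. Proof. by rewrite exprn_even_gt0//= lt_eqF//; case/andP: hc. Qed.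
Let c2_lt : c ^+ 2 < 4 * (p + q) ^+ 2.
Proof. by case/andP: hc => h1 h2; move: s0 h1 h2; nra. Qed.

Lemma root_lt1 x : root (cubic p q c) x -> x < 1.
Proof.
move=> /rootP; rewrite horner_cubic => E; rewrite ltNge; apply/negP => x1.
have : 0 <= 4 * (p + q) * ((x - 1) * (x + p) * (x + q)).
  have q1 := conj_gt1.
  by rewrite !mulr_ge0//; move: P0 q1 x1; lra.
by move: c2_gt0 E; lra.
Qed.

(** The equations of two distinct roots are subtracted and divided by the difference of the roots.
    Doing so again with the two results gives the sum, from which the other relations follow. *)
Lemma cubic_relations x1 x2 x3 : x3 < x2 < x1 ->
  root (cubic p q c) x1 -> root (cubic p q c) x2 -> root (cubic p q c) x3 ->
  [/\ x1 + x2 + x3 = 1 - p - q, x1 * x2 + x1 * x3 + x2 * x3 = 0 &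
   4 * (p + q) * (x1 * x2 * x3) = 4 * (p + q) ^+ 2 - c ^+ 2].
Proof.
move=> /andP[x32 x21] /rootP + /rootP + /rootP; rewrite !cubicE => r1 r2 r3.
have k0 : 4 * (p + q) != 0 by rewrite mulf_neq0 ?gt_eqF.
have d x y : x != y ->
    c ^+ 2 + 4 * (p + q) * (x ^+ 3 + (p + q - 1) * x ^+ 2 - (p + q)) = 0 ->
    c ^+ 2 + 4 * (p + q) * (y ^+ 3 + (p + q - 1) * y ^+ 2 - (p + q)) = 0 ->
    x ^+ 2 + x * y + y ^+ 2 + (p + q - 1) * (x + y) = 0.
  move=> xy rx ry; have xy' : x - y != 0 by rewrite subr_eq0.
  apply: (mulfI xy'); apply: (mulfI k0); rewrite !mulr0.
  by move: rx ry; move: (p + q) => s rx ry; rewrite -[RHS](subrr 0) -{1}rx -ry; ring.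
have d12 : x1 != x2 by rewrite gt_eqF.
have d13 : x1 != x3 by rewrite gt_eqF// (lt_trans x32).
have d23 : x2 - x3 != 0 by rewrite subr_eq0 gt_eqF.
have E12 := d _ _ d12 r1 r2; have E13 := d _ _ d13 r1 r3.
have E1 : x1 + x2 + x3 = 1 - p - q.
  apply/eqP; rewrite -subr_eq0; apply/eqP/(mulfI d23); rewrite mulr0.
  by rewrite -[RHS](subrr 0) -{1}E12 -E13; ring.
have E2 : x1 * x2 + x1 * x3 + x2 * x3 = 0.
  have -> : x3 = 1 - p - q - x1 - x2 by rewrite -E1; ring.
  by rewrite -[RHS]oppr0 -{}E12; ring.
split=> //.
have -> : x3 = 1 - p - q - x1 - x2 by rewrite -E1; ring.
have A : x1 * x2 * (1 - p - q - x1 - x2) = x1 ^+ 3 + (p + q - 1) * x1 ^+ 2.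
  apply/eqP; rewrite -subr_eq0; apply/eqP.
  rewrite -[RHS](mulr0 (- x1)) -E12; ring.
rewrite A; apply/eqP; rewrite -subr_eq0 -[X in _ == X]r1; apply/eqP; ring.
Qed.

(** Sign changes: the cubic equals c^2 > 0 at 1, -q and -p, and is negative at 0, by |c| < 2 (p +
    q), and far to the left. As q <= p, the intervals separate the roots. *)
Lemma cubic_roots_exist : exists x1 x2 x3 : R, [/\ x3 < x2 < x1, 0 < x1,
  root (cubic p q c) x1 & root (cubic p q c) x2 /\ root (cubic p q c) x3].
Proof.
have q1 := conj_gt1; have qp := conj_le.
have C0 : (cubic p q c).[0] < 0.
  rewrite cubicE !expr0n /= mulr0 !add0r; move: c2_lt; nra.
have C1 : 0 < (cubic p q c).[1] by rewrite horner_cubic subrr !mul0r mulr0 addr0.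
have Cq : 0 < (cubic p q c).[- q] by rewrite horner_cubic addNr !mulr0 addr0.
have Cp : 0 < (cubic p q c).[- p] by rewrite horner_cubic addNr mulr0 mul0r mulr0 addr0.
(* At this point the product of the three factors is at most -(p + q), so the cubic is at most c^2 -
   4 (p + q)^2 < 0. *)
have Cm : (cubic p q c).[- p - (p + q)] < 0.
  rewrite horner_cubic.
  have -> : (- p - (p + q) - 1) * (- p - (p + q) + p) * (- p - (p + q) + q) =
    - ((2 * p + q + 1) * (p + q) * (2 * p)) by ring.
  have : p + q <= (2 * p + q + 1) * (p + q) * (2 * p).
    have h : 1 <= (2 * p + q + 1) * (2 * p) by move: p2 q1; nra.
    have := ler_wpM2r (ltW s0) h; rewrite mul1r; lra.
  move=> h; have := ler_wpM2l (ltW s0) h; move: c2_lt; lra.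
have [x1 /andP[x10 _] r1] : exists2 x, 0 <= x <= 1 & root (cubic p q c) x.
  by apply: poly_ivt; rewrite ?ltW.
have [x2 /andP[x2q x20] r2] : exists2 x, - q <= x <= 0 & root (- cubic p q c) x.
  apply: poly_ivt; first by move: q1; lra.
  by rewrite !hornerN oppr_le0 oppr_ge0 !ltW.
have [x3 /andP[x3m x3p] r3] : exists2 x, - p - (p + q) <= x <= - p & root (cubic p q c) x.
  apply: poly_ivt; first by move: s0; lra.
  by rewrite !ltW.
rewrite rootN in r2.
have x1n : x1 != 0 by apply: contraTneq r1 => ->; rewrite /root lt_eqF.
have x2n : x2 != 0 by apply: contraTneq r2 => ->; rewrite /root lt_eqF.
have x2m : x2 != - q by apply: contraTneq r2 => ->; rewrite /root gt_eqF.
have x1_gt0 : 0 < x1 by rewrite lt_neqAle eq_sym x1n.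
have x2_lt0 : x2 < 0 by rewrite lt_neqAle x2n.
have x2_gt : - q < x2 by rewrite lt_neqAle eq_sym x2m.
exists x1, x2, x3; split=> //; rewrite (lt_trans x2_lt0)// andbT.
by move: x3p qp x2_gt; lra.
Qed.

Lemma cubic_factor x1 x2 x3 : x3 < x2 < x1 ->
  root (cubic p q c) x1 -> root (cubic p q c) x2 -> root (cubic p q c) x3 ->
  cubic p q c = (4 * (p + q)) *: (('X - x1%:P) * ('X - x2%:P) * ('X - x3%:P)).
Proof.
move=> h r1 r2 r3; have [E1 E2 E3] := cubic_relations h r1 r2 r3.
rewrite /cubic.
have -> : ('X - 1) * ('X + p%:P) * ('X + q%:P) =
  'X^3 + (p + q - 1)%:P * 'X^2 - (p + q)%:P :> {poly R}.
  have -> : ('X - 1) * ('X + p%:P) * ('X + q%:P) =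
    'X^3 + (p%:P + q%:P - 1) * 'X^2 + (p%:P * q%:P - (p%:P + q%:P)) * 'X - p%:P * q%:P
    :> {poly R} by ring.
  by rewrite -polyCM conj_mul !polyCB !polyCD subrr mul0r addr0.
have -> : ('X - x1%:P) * ('X - x2%:P) * ('X - x3%:P) =
   'X^3 - (x1 + x2 + x3)%:P * 'X^2 + (x1 * x2 + x1 * x3 + x2 * x3)%:P * 'X
   - (x1 * x2 * x3)%:P :> {poly R}.
  by rewrite !polyCD !polyCM; ring.
rewrite E2 E1 mul0r addr0.
have -> : 1 - p - q = - (p + q - 1) by ring.
rewrite -!mul_polyC; have K : (4 * (p + q))%:P * (x1 * x2 * x3)%:P =
   (4 * (p + q))%:P * (p + q)%:P - (c ^+ 2)%:P :> {poly R}.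
  by rewrite -!polyCM E3 -polyCB; congr (_%:P); ring.
rewrite [RHS]mulrBr K polyCN.
by move: ((c ^+ 2)%:P) ((4 * (p + q))%:P) ((p + q)%:P) ((p + q - 1)%:P) => a b d e; ring.
Qed.

(** Some root is positive by the existence lemma; by the factorisation it is one of the three, hence
    at most x1. *)
Lemma largest_root_bounds x1 x2 x3 : x3 < x2 < x1 ->
  root (cubic p q c) x1 -> root (cubic p q c) x2 -> root (cubic p q c) x3 ->
  0 < x1 < 1.
Proof.
move=> h r1 r2 r3; rewrite (root_lt1 r1) andbT.
have [y1 [y2 [y3 [_ y0 ry _]]]] := cubic_roots_exist.
move: ry; rewrite (cubic_factor h r1 r2 r3) rootZ; last by rewrite mulf_neq0 ?gt_eqF.
case/andP: h => h1 h2.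
rewrite !rootM !root_XsubC => /orP[/orP[]|] /eqP E.
- by rewrite -E.
- by rewrite (lt_trans y0)// E.
- by rewrite (lt_trans y0)// E (lt_trans h1).
Qed.

End cubic_roots.

(** * The cone *)

Section rows.
Context {R : realType}.

Lemma forall_ord2 (P : 'I_2 -> Prop) : P 0 -> P 1 -> forall i, P i.
Proof.
move=> P0 P1 [[|[|//]] i].
- by have -> : Ordinal i = 0 by apply: val_inj.
- by have -> : Ordinal i = 1 by apply: val_inj.
Qed.

Lemma forall_ord3 (P : 'I_3 -> Prop) : P 0 -> P 1 -> P 2 -> forall i, P i.
Proof.
move=> P0 P1 P2 [[|[|[|//]]] i].
- by have -> : Ordinal i = 0 by apply: val_inj.
- by have -> : Ordinal i = 1 by apply: val_inj.
- by have -> : Ordinal i = 2 by apply: val_inj.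
Qed.

Lemma sum_ord3 (V : nmodType) (f : 'I_3 -> V) : \sum_i f i = f 0 + f 1 + f 2.
Proof.
rewrite !big_ord_recl big_ord0 addr0 addrA.
by congr (_ + f _ + f _); apply: val_inj.
Qed.

Lemma sum_ord2 (V : nmodType) (f : 'I_2 -> V) : \sum_i f i = f 0 + f 1.
Proof.
by rewrite !big_ord_recl big_ord0 addr0; congr (_ + f _); apply: val_inj.
Qed.

Lemma norm_rV_le n (v : 'rV[R]_n) C : 0 <= C -> (forall i, `|v 0 i| <= C) -> `|v| <= C.
Proof.
move=> C0 vC; have [->//|v0] := eqVneq `|v| 0.
have [[i j] /= E] := mx_norm_neq0 v0.
by have : mx_norm v <= C by rewrite E ord1.
Qed.

Lemma is_derive_coord n (x v : 'rV[R]_n) i : is_derive x v (fun w : 'rV[R]_n => w 0 i) (v 0 i).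
Proof.
apply/is_derive_lineP.
have -> : (fun s : R => (s *: v + x) 0 i) = (fun s => s * v 0 i + x 0 i).
  by apply/funext => s; rewrite !mxE.
apply: (is_derive_eq (is_deriveD' (is_deriveM' (is_derive_id' 0) (is_derive_cst' (0:R) 1 (v 0 i))) (is_derive_cst' (0:R) 1 (x 0 i)))).
by rewrite mulr0 add0r mul1r addr0.
Qed.

End rows.

(** * The weighted geometric mean and the regular cone bounded by its graphs *)

Section cone.
Context {R : realType}.
Variables (p q al : R).
Hypothesis p0 : 0 < p.
Hypothesis q0 : 0 < q.
Hypothesis upq : p^-1 + q^-1 = 1.
Hypothesis al01 : 0 < al <= 1.

Let u0 : 0 < p^-1. Proof. by rewrite invr_gt0. Qed.
Let v0 : 0 < q^-1. Proof. by rewrite invr_gt0. Qed.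
Let al0 : 0 < al. Proof. by case/andP: al01. Qed.

Definition gmean (x y : R) := x `^ p^-1 * y `^ q^-1.

Lemma gmean_expR x y : 0 < x -> 0 < y -> gmean x y = expR (p^-1 * ln x + q^-1 * ln y).
Proof. by move=> x0 y0; rewrite /gmean /powR !gt_eqF// -expRD. Qed.

Lemma gmean_gt0 x y : 0 < x -> 0 < y -> 0 < gmean x y.
Proof. by move=> x0 y0; rewrite gmean_expR// expR_gt0. Qed.

Lemma gmean_ge0 x y : 0 <= gmean x y.
Proof. by rewrite mulr_ge0 ?powR_ge0. Qed.

Lemma gmean0x y : gmean 0 y = 0.
Proof. by rewrite /gmean powR0 ?mul0r// gt_eqF. Qed.

Lemma gmeanx0 x : gmean x 0 = 0.
Proof. by rewrite /gmean powR0 ?mulr0// gt_eqF. Qed.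

Lemma gmeanZ a x y : 0 <= a -> 0 <= x -> 0 <= y -> gmean (a * x) (a * y) = a * gmean x y.
Proof.
move=> a0 x0 y0; rewrite /gmean !powRM// mulrACA -powRD; last by rewrite upq oner_eq0.
by rewrite upq powRr1.
Qed.

Lemma gmean_le x y x' y' : 0 <= x -> 0 <= y -> x <= x' -> y <= y' -> gmean x y <= gmean x' y'.
Proof.
move=> x0 y0 xx yy; apply: ler_pM; rewrite ?powR_ge0//.
  by apply: ge0_ler_powR => //; rewrite ?nnegrE ?(ltW u0)// (le_trans x0).
by apply: ge0_ler_powR => //; rewrite ?nnegrE ?(ltW v0)// (le_trans y0).
Qed.

Lemma gmean_lt x y x' y' : 0 <= x -> 0 <= y -> x < x' -> y < y' -> gmean x y < gmean x' y'.
Proof.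
move=> x0 y0 xx yy; have x'0 := le_lt_trans x0 xx; have y'0 := le_lt_trans y0 yy.
have h : y `^ q^-1 < y' `^ q^-1 by apply: gt0_ltr_powR => //; rewrite nnegrE// ltW.
have h' : x `^ p^-1 < x' `^ p^-1 by apply: gt0_ltr_powR => //; rewrite nnegrE// ltW.
by apply: ltr_pM => //; rewrite powR_ge0.
Qed.

Lemma gmean_diag x : 0 <= x -> gmean x x = x.
Proof.
by move=> x0; rewrite /gmean -powRD ?upq ?oner_eq0// powRr1.
Qed.

Lemma gmean_le_young a b : 0 <= a -> 0 <= b -> gmean a b <= p^-1 * a + q^-1 * b.
Proof.
move=> a0 b0; have Ep (x : R) : 0 <= x -> (x `^ p^-1) `^ p = x.
  by move=> x0; rewrite -powRrM mulVf ?gt_eqF// powRr1.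
have Eq (x : R) : 0 <= x -> (x `^ q^-1) `^ q = x.
  by move=> x0; rewrite -powRrM mulVf ?gt_eqF// powRr1.
have := conjugate_powR (powR_ge0 a p^-1) (powR_ge0 b q^-1) p0 q0 upq.
by rewrite (Ep _ a0) (Eq _ b0) [a / p]mulrC [b / q]mulrC.
Qed.

(* Young's inequality with the weights e^(vs), e^(-us) whose geometric mean is 1. *)
Definition young_form (s x y : R) :=
  p^-1 * expR (q^-1 * s) * x + q^-1 * expR (- (p^-1 * s)) * y.

Lemma gmean_le_young_form s x y : 0 <= x -> 0 <= y -> gmean x y <= young_form s x y.
Proof.
move=> x0 y0; have ex : 0 <= x * expR (q^-1 * s) by rewrite mulr_ge0 ?expR_ge0.
have ey : 0 <= y * expR (- (p^-1 * s)) by rewrite mulr_ge0 ?expR_ge0.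
have := gmean_le_young ex ey.
have -> : gmean (x * expR (q^-1 * s)) (y * expR (- (p^-1 * s))) = gmean x y.
  rewrite /gmean !powRM ?expR_ge0// mulrACA -[RHS]mulr1; congr (_ * _).
  rewrite /powR !gt_eqF ?expR_gt0// !expRK -expRD.
  by rewrite mulrN mulrCA [q^-1 * (p^-1 * s)]mulrCA subrr expR0.
move=> /le_trans; apply; rewrite le_eqVlt; apply/orP; left; apply/eqP.
by rewrite /young_form; ring.
Qed.

(** The geometric mean is the infimum of the Young forms. It is attained at s = ln y - ln x when x
    and y are positive, and approached as s tends to an infinite end when one of them is 0. *)
Lemma young_form_le_gmean x y z : 0 <= x -> 0 <= y -> (forall s, z <= young_form s x y) -> z <= gmean x y.
Proof.
have P (e : R) : 0 < e -> exists s, expR s = e by move=> e0; exists (ln e); rewrite lnK.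
rewrite le_eqVlt => /predU1P[<-|x0] y0 h.
  rewrite gmean0x; apply/ler_addgt0Pr => e e0; rewrite add0r.
  (* This will be e^s; at the parameter -(p s) the form reduces to q^-1 e^s y, which is then at most
     e. The 1 keeps the denominator positive when y = 0. *)
  have d0 : 0 < e / (q^-1 * y + 1) by rewrite divr_gt0// ltr_wpDl// mulr_ge0// ltW.
  have [s sE] := P _ d0; apply: le_trans (h (- (p * s))) _.
  rewrite /young_form mulr0 add0r mulrN opprK mulrA mulVf ?gt_eqF// mul1r sE.
  rewrite mulrAC mulrA ler_pdivrMr; last by rewrite ltr_wpDl// mulr_ge0// ltW.
  by rewrite [X in X <= _]mulrC; apply: ler_wpM2l; [exact: ltW|rewrite lerDl].
move: y0; rewrite le_eqVlt => /predU1P[y0|y0].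
  rewrite -y0 gmeanx0; apply/ler_addgt0Pr => e e0; rewrite add0r.
  have d0 : 0 < e / (p^-1 * x + 1) by rewrite divr_gt0// ltr_wpDl// mulr_ge0// ltW.
  have [s sE] := P _ d0; apply: le_trans (h (q * s)) _.
  rewrite /young_form -y0 mulr0 addr0 mulrA mulVf ?gt_eqF// mul1r sE.
  rewrite mulrAC mulrA ler_pdivrMr; last by rewrite ltr_wpDl// mulr_ge0// ltW.
  by rewrite [X in X <= _]mulrC; apply: ler_wpM2l; [exact: ltW|rewrite lerDl].
apply: le_trans (h (ln y - ln x)) _; rewrite gmean_expR//.
set g := p^-1 * ln x + q^-1 * ln y.
have E1 : expR (q^-1 * (ln y - ln x)) * x = expR g.
  rewrite -{2}[x]lnK ?posrE// -expRD; congr expR; rewrite /g.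
  have -> : p^-1 = 1 - q^-1 by rewrite -upq addrK.
  by ring.
have E2 : expR (- (p^-1 * (ln y - ln x))) * y = expR g.
  rewrite -{2}[y]lnK ?posrE// -expRD; congr expR; rewrite /g.
  have -> : q^-1 = 1 - p^-1 by rewrite -upq addrC addKr.
  by ring.
by rewrite /young_form -!mulrA E1 E2 -mulrDl upq mul1r.
Qed.

Notation K := (cone p q al).

Lemma coneE w : K w <-> [/\ 0 <= w 0 0, 0 <= w 0 1 &
  - al * gmean (w 0 0) (w 0 1) <= w 0 2 <= gmean (w 0 0) (w 0 1)].
Proof.
rewrite /cone /= -/(gmean _ _); split=> [[h1 h2 h3 h4]|[h3 h4 /andP[h1 h2]]].
  by split=> //; rewrite h1 h2.
by split.
Qed.

(** Presents K as an intersection of closed half-spaces, from which closedness and convexity are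
    immediate. *)
Lemma cone_young_form w : K w <-> [/\ 0 <= w 0 0, 0 <= w 0 1 &
  forall s, - al * young_form s (w 0 0) (w 0 1) <= w 0 2 <= young_form s (w 0 0) (w 0 1)].
Proof.
rewrite coneE; split=> [[x0 y0 /andP[h1 h2]]|[x0 y0 h]]; split=> //.
  move=> s; rewrite (le_trans h2 (gmean_le_young_form s x0 y0)) andbT.
  by apply: le_trans h1; rewrite !mulNr lerN2 ler_pM2l// gmean_le_young_form.
apply/andP; split; last by apply: young_form_le_gmean => // s; case/andP: (h s).
have : - w 0 2 / al <= gmean (w 0 0) (w 0 1).
  apply: young_form_le_gmean => // s; rewrite ler_pdivrMr// lerNl.
  by have /andP[+ _] := h s; rewrite mulNr mulrC.
by rewrite ler_pdivrMr// lerNl mulNr mulrC.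
Qed.

Lemma closed_cone : closed K.
Proof.
have cx (i : 'I_3) : continuous (fun w : 'rV[R]_3 => w 0 i) := @coord_continuous _ _ _ _ _.
have cs s : continuous (fun w : 'rV[R]_3 => young_form s (w 0 0) (w 0 1)).
  have lin (a b : R) : continuous ((fun w => a * w 0 0 + b * w 0 1) : 'rV[R]_3 -> R).
    have c (i : 'I_3) (e : R) (w : 'rV[R]_3) : e * w' 0 i @[w' --> w] --> e * w 0 i.
      by apply: cvgMr; exact: cx.
    by move=> w; exact: cvgD (c 0 a w) (c 1 b w).
  exact: lin.
pose A := [set w : 'rV[R]_3 | 0 <= w 0 0] `&` [set w : 'rV[R]_3 | 0 <= w 0 1].
pose B := \bigcap_(s in @setT R) ([set w : 'rV[R]_3 | 0 <= w 0 2 + al * young_form s (w 0 0) (w 0 1)]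
   `&` [set w : 'rV[R]_3 | 0 <= young_form s (w 0 0) (w 0 1) - w 0 2]).
have cl (f : 'rV[R]_3 -> R) : continuous f -> closed [set w | 0 <= f w].
  by move=> cf; apply: (@closed_comp _ _ f [set x : R | 0 <= x]) => //; exact: closed_ge.
have -> : K = A `&` B.
  apply/seteqP; split=> w.
    move=> /cone_young_form[x0 y0 h]; split; first by split.
    move=> s _; have /andP[h1 h2] := h s; split=> /=; last by rewrite subr_ge0.
    by move: h1; rewrite mulNr -subr_ge0 opprK.
  move=> [[x0 y0] h]; apply/cone_young_form; split=> // s; have [/= h1 h2] := h s I.
  by rewrite -(subr_ge0 (w 0 2)) h2 andbT mulNr -subr_ge0 opprK.
have cs' s (w : 'rV[R]_3) :
    al * young_form s (w' 0 0) (w' 0 1) @[w' --> w] --> al * young_form s (w 0 0) (w 0 1).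
  by apply: cvgMr; exact: cs.
apply: closedI; first by apply: closedI; apply: cl; exact: cx.
apply: closed_bigI => s _; apply: closedI; apply: cl => w.
  exact: cvgD (cx 2 w) (cs' s w).
exact: cvgB (cs s w) (cx 2 w).
Qed.

Lemma convex_cone : convex_set (K : set (convex_lmodType 'rV[R]_3)).
Proof.
move=> x y k; rewrite !inE => /cone_young_form[x0 y0 h] /cone_young_form[x0' y0' h'].
have k0 : 0 <= k%:num by [].
have k1 : 0 <= 1 - k%:num by rewrite subr_ge0.
have E i : (conv k (x : convex_lmodType 'rV[R]_3) y : 'rV[R]_3) 0 i =
   k%:num * x 0 i + (1 - k%:num) * y 0 i by rewrite /conv /= !mxE.
have Es s : young_form s (k%:num * x 0 0 + (1 - k%:num) * y 0 0) (k%:num * x 0 1 + (1 - k%:num) * y 0 1)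
   = k%:num * young_form s (x 0 0) (x 0 1) + (1 - k%:num) * young_form s (y 0 0) (y 0 1).
  by rewrite /young_form; ring.
apply/cone_young_form; rewrite !E; split; [by rewrite addr_ge0// mulr_ge0|by rewrite addr_ge0// mulr_ge0|].
move=> s; rewrite Es; have /andP[h1 h2] := h s; have /andP[h1' h2'] := h' s.
apply/andP; split; last by apply: lerD; exact: ler_wpM2l.
rewrite mulrDr ![- al * (_ * _)]mulrCA.
by apply: lerD; exact: ler_wpM2l.
Qed.

Definition cone_int : set 'rV[R]_3 := [set w | [/\ 0 < w 0 0, 0 < w 0 1 &
  - al * gmean (w 0 0) (w 0 1) < w 0 2 < gmean (w 0 0) (w 0 1)]].

Lemma continuous_gmean (w : 'rV[R]_3) : 0 < w 0 0 -> 0 < w 0 1 ->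
  {for w, continuous (fun w : 'rV[R]_3 => gmean (w 0 0) (w 0 1))}.
Proof.
move=> x0 y0; have cx (i : 'I_3) : {for w, continuous (fun w : 'rV[R]_3 => w 0 i)}.
  exact: coord_continuous.
have cl i r : 0 < w 0 i -> {for w, continuous (fun w : 'rV[R]_3 => w 0 i `^ r)}.
  move=> wi; apply: (@continuous_comp _ _ _ (fun w : 'rV[R]_3 => w 0 i) (fun x => x `^ r)) => //.
  exact: is_derive_continuous (is_derive1_powR r wi).
by apply: continuousM; exact: cl.
Qed.

Lemma open_cone_int : open cone_int.
Proof.
rewrite openE => w [x0 y0 /andP[h1 h2]].
have cx (i : 'I_3) : w' 0 i @[w' --> w] --> w 0 i by exact: coord_continuous.
have cg : gmean (w' 0 0) (w' 0 1) @[w' --> w] --> gmean (w 0 0) (w 0 1).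
  exact: continuous_gmean.
have c1 : w' 0 2 + al * gmean (w' 0 0) (w' 0 1) @[w' --> w] --> w 0 2 + al * gmean (w 0 0) (w 0 1).
  by apply: cvgD => //; apply: cvgMr.
have c2 : gmean (w' 0 0) (w' 0 1) - w' 0 2 @[w' --> w] --> gmean (w 0 0) (w 0 1) - w 0 2.
  exact: cvgB.
have e1 : 0 < w 0 2 + al * gmean (w 0 0) (w 0 1) by move: h1; rewrite mulNr -subr_gt0 opprK.
have e2 : 0 < gmean (w 0 0) (w 0 1) - w 0 2 by rewrite subr_gt0.
near=> w'; split.
- by near: w'; exact: (cvgr_gt _ (cx 0) _ x0).
- by near: w'; exact: (cvgr_gt _ (cx 1) _ y0).
- apply/andP; split.
    rewrite mulNr -subr_gt0 opprK; near: w'; exact: (cvgr_gt _ c1 _ e1).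
  rewrite -subr_gt0; near: w'; exact: (cvgr_gt _ c2 _ e2).
Unshelve. all: by end_near. Qed.

Lemma interior_dir (w d : 'rV[R]_3) : interior K w -> exists2 e : R, 0 < e & K (w + e *: d).
Proof.
move=> Kw; have c : w + e *: d @[e --> (0 : R)] --> w + 0 *: d.
  by apply: cvgD; [exact: cvg_cst|apply: cvgZl; exact: cvg_id].
rewrite scale0r addr0 in c; have /nbhs_ballP[e /= e0 H] := c _ Kw.
exists (e / 2); first by rewrite divr_gt0.
apply: H; rewrite -ball_normE /ball_ /= sub0r normrN gtr0_norm ?divr_gt0//.
by rewrite ltr_pdivrMr// ltr_pMr// ltr1n.
Qed.

(** From an interior point one can move a little along -e_0, -e_1, -e_2 and e_2 inside K, which
    makes each inequality strict. Conversely, [cone_int] is open. *)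
Lemma interior_cone : interior K = cone_int.
Proof.
apply/seteqP; split=> [w Kw|w Uw]; last first.
  have := open_nbhs_nbhs (conj open_cone_int Uw); apply: filterS => y [x0 y0 /andP[h1 h2]].
  by apply/coneE; split; rewrite ?ltW.
have pos (i : 'I_3) : (forall w, K w -> 0 <= w 0 i) -> 0 < w 0 i.
  move=> Ki; have [e e0 /Ki] := interior_dir (- 'e_i) Kw.
  by rewrite !mxE !eqxx /= mulrN mulr1 subr_ge0; apply: lt_le_trans.
have x0 : 0 < w 0 0 by apply: pos => y /coneE[].
have y0 : 0 < w 0 1 by apply: pos => y /coneE[].
split=> //; apply/andP; split.
- have [e e0 /coneE[_ _ /andP[+ _]]] := interior_dir (- 'e_2) Kw.
  by rewrite !mxE /= !(mulr0, addr0, oppr0) mulrN mulr1 => /le_lt_trans; apply; rewrite ltrBlDr ltrDl.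
- have [e e0 /coneE[_ _ /andP[_]]] := interior_dir ('e_2) Kw.
  by rewrite !mxE /= !(mulr0, addr0) mulr1; apply: lt_le_trans; rewrite ltrDl.
Qed.

Lemma cone_scale (a : R) x : 0 < a -> K x -> K (a *: x).
Proof.
move=> a0 /coneE[x0 y0 /andP[h1 h2]]; apply/coneE; rewrite !mxE !mulr_ge0 ?(ltW a0)//.
split=> //; rewrite gmeanZ ?(ltW a0)// mulrCA !ler_pM2l//.
by rewrite h1.
Qed.

Lemma cone_int_scale (a : R) x : 0 < a -> cone_int x -> cone_int (a *: x).
Proof.
move=> a0 [x0 y0 /andP[h1 h2]]; rewrite /cone_int /= !mxE !mulr_gt0//.
split=> //; rewrite gmeanZ ?ltW// mulrCA !ltr_pM2l//.
by rewrite h1.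
Qed.

Lemma cone_int0 : ~ cone_int 0.
Proof. by move=> []; rewrite mxE ltxx. Qed.

Lemma gmean_le_sum x y : 0 <= x -> 0 <= y -> gmean x y <= x + y.
Proof.
move=> x0 y0; apply: (@le_trans _ _ (gmean (x + y) (x + y))).
  by apply: gmean_le; rewrite ?lerDl ?lerDr.
by rewrite gmean_diag// addr_ge0.
Qed.

(** The form x + y and the direction (1, 1, 0) play the roles of [l] and [d] in the comparison
    argument. *)
Definition cone_form : 'cV[R]_3 := \col_(i < 3) [:: 1; 1; 0]`_i.
Definition cone_dir : 'rV[R]_3 := \row_(i < 3) [:: 1; 1; 0]`_i.

Lemma cone_formE (w : 'rV[R]_3) : (w *m cone_form) 0 0 = w 0 0 + w 0 1.
Proof. by rewrite mxE sum_ord3 !mxE /= !mulr1 mulr0 addr0. Qed.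

(** The norm is the maximum of the coordinates, and |z| is at most the geometric mean because [al]
    <= 1. *)
Lemma cone_norm_le w : K w -> `|w| <= 1 * (w *m cone_form) 0 0.
Proof.
move=> /coneE[x0 y0 /andP[h1 h2]]; rewrite mul1r cone_formE.
have s0 := addr_ge0 x0 y0; have gs := gmean_le_sum x0 y0.
apply: norm_rV_le => //; apply: forall_ord3.
- by rewrite ger0_norm// lerDl.
- by rewrite ger0_norm// lerDr.
- rewrite ler_norml (le_trans h2 gs) andbT; apply: le_trans h1.
  rewrite mulNr lerN2; apply: le_trans gs; apply: ler_piMl; first exact: gmean_ge0.
  by case/andP: al01.
Qed.

Lemma cone_form_gt0 w : K w -> w != 0 -> 0 < (w *m cone_form) 0 0.
Proof. by move=> /cone_norm_le; rewrite mul1r -normr_gt0 => h /lt_le_trans; apply. Qed.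

(** Raising x and y by the same amount strictly increases the geometric mean and leaves z unchanged,
    so both bounds on z become strict. *)
Lemma cone_push (e : R) w : 0 < e -> K w -> w != 0 ->
  cone_int (w + (e * (w *m cone_form) 0 0) *: cone_dir).
Proof.
move=> e0 Kw wn; have l0 := cone_form_gt0 Kw wn.
move: Kw => /coneE[x0 y0 /andP[h1 h2]].
have : 0 < e * (w *m cone_form) 0 0 by rewrite mulr_gt0.
move: (e * _) => t t0; rewrite /cone_int /= !mxE /= !mulr1 mulr0 addr0.
have lt : gmean (w 0 0) (w 0 1) < gmean (w 0 0 + t) (w 0 1 + t).
  by apply: gmean_lt; rewrite ?ltrDl.
split; rewrite ?ltr_wpDl// (le_lt_trans h2 lt) andbT; apply: lt_le_trans h1.
by rewrite !mulNr ltrN2 ltr_pM2l.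
Qed.

Lemma cone_dir_form : 0 <= (cone_dir *m cone_form) 0 0.
Proof. by rewrite cone_formE !mxE /= addr_ge0. Qed.

Lemma regular_cone : regular_convex_cone K.
Proof.
split.
- exact: convex_cone.
- exact: cone_scale.
- exact: closed_cone.
- exists cone_dir; rewrite interior_cone; rewrite /cone_int /= !mxE /= gmean_diag// mulr1.
  by split=> //; rewrite oppr_lt0 al0 ltr01.
- move=> [x [v [vn H]]].
  (* If b were nonzero, s = -(a + 1)/b would give the value -1. Applied to x, to y and, once these
     are constant along the line, to the distance of z from its upper bound. *)
  have nn (a b : R) : (forall s, 0 <= a + s * b) -> b = 0.
    move=> h; apply/eqP; apply: contraT => bn.
    by have := h (- (a + 1) / b); rewrite divfK// opprD addrA subrr add0r lerNr oppr0 ler10.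
  have v0' : v 0 0 = 0.
    by apply: (@nn (x 0 0)) => s; have /coneE[+ _ _] := H s; rewrite !mxE.
  have v1 : v 0 1 = 0.
    by apply: (@nn (x 0 1)) => s; have /coneE[_ + _] := H s; rewrite !mxE.
  have v2 : v 0 2 = 0.
    apply/eqP; rewrite -oppr_eq0; apply/eqP/(@nn (gmean (x 0 0) (x 0 1) - x 0 2)) => s.
    have /coneE[_ _ /andP[_]] := H s; rewrite !mxE v0' v1 !mulr0 !addr0 -subr_ge0.
    by rewrite mulrN opprD addrA.
  move/negP: vn; apply; apply/eqP/rowP.
  by apply: forall_ord3; rewrite mxE.
Qed.

Lemma boundary_cone b : boundary K b -> [/\ K b, 0 <= b 0 0, 0 <= b 0 1 &
  [\/ b 0 0 = 0, b 0 1 = 0 | [/\ 0 < b 0 0, 0 < b 0 1 &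
    b 0 2 = gmean (b 0 0) (b 0 1) \/ b 0 2 = - al * gmean (b 0 0) (b 0 1)]]].
Proof.
rewrite /boundary -(closure_id K).1; last exact: closed_cone.
rewrite interior_cone => -[Kb nU]; have /coneE[x0 y0 /andP[h1 h2]] := Kb; split=> //.
have [->|xn] := eqVneq (b 0 0) 0; first by constructor 1.
have [->|yn] := eqVneq (b 0 1) 0; first by constructor 2.
constructor 3; have xp : 0 < b 0 0 by rewrite lt_neqAle eq_sym xn.
have yp : 0 < b 0 1 by rewrite lt_neqAle eq_sym yn.
split=> //; have [|h2'] := eqVneq (b 0 2) (gmean (b 0 0) (b 0 1)); first by left.
right; apply/eqP/contraT => h1'; exfalso; apply: nU; split=> //.
by rewrite !lt_neqAle h1 h2 h2' eq_sym h1'.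
Qed.

Lemma boundary_coneI b : K b -> ~ cone_int b -> boundary K b.
Proof.
move=> Kb nb; rewrite /boundary interior_cone; split=> //.
exact: subset_closure.
Qed.

End cone.

(** * The potential *)

Lemma diff_scomp (R : realType) (V : normedModType R) (h : V -> R) (g : R -> R) x (a : R) :
  is_derive (h x) 1 g a -> differentiable h x -> differentiable (fun y => g (h y)) x.
Proof. by move=> /is_derive_differentiable dg dh; apply: (@differentiable_comp _ _ _ _ h g). Qed.

Lemma det3 (R : comNzRingType) (A : 'M[R]_3) : \det A =
  A 0 0 * (A 1 1 * A 2 2 - A 1 2 * A 2 1) - A 0 1 * (A 1 0 * A 2 2 - A 1 2 * A 2 0)
  + A 0 2 * (A 1 0 * A 2 1 - A 1 1 * A 2 0).
Proof.
pose f (i j : nat) := A (inord i) (inord j).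
have E i j : A i j = f i j by rewrite /f !inord_val.
rewrite (expand_det_row _ 0) !big_ord_recl big_ord0 addr0 /cofactor.
rewrite !(expand_det_row _ ord0) !big_ord_recl !big_ord0 !addr0 /cofactor !det_mx11 !mxE.
rewrite !E /= /bump /= !(addn0, add0n, expr0, expr1) (_ : (1 + 1)%N = 2%N)//; ring.
Qed.

(** The Monge-Ampere equation after removal of the frame factors: u = 1/p, v = 1/q, s = p + q, ch =
    psi', ps = psi'', ep = e^psi, and D is the derivative of t psi' = W - 1. *)
Lemma hess_identity (R : realType) (u v s W L ps ch t ep P Q D : R) :
  u + v = 1 -> s * (u * v) = 1 -> P = u * W + 1 -> Q = v * W + 1 ->
  L = 3 * W + 2 * s - 2 -> ch * t = W - 1 ->
  ps * L = s * ep ^+ 2 + ch ^+ 2 * (W + s - 2) -> D = ch + t * ps ->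
  (u ^+ 2 * Q + v ^+ 2 * P) * D * ch = P * Q * ps - ep ^+ 2.
Proof.
move=> uv suv PE QE LE cht psL DE.
have rho : u ^+ 2 * Q + v ^+ 2 * P = u * v * (W + s - 2).
  have -> : u * v * (W + s - 2) = u * v * W + s * (u * v) - 2 * (u * v) by ring.
  rewrite suv PE QE; have -> : v = 1 - u by rewrite -uv addrC addKr.
  by ring.
have PQ : P * Q = (u ^+ 2 * Q + v ^+ 2 * P) * (W - 1) + u * v * L.
  rewrite rho LE.
  have -> : u * v * (W + s - 2) * (W - 1) + u * v * (3 * W + 2 * s - 2) =
    u * v * (W ^+ 2) + (s * (u * v)) * (W + 1) by ring.
  rewrite suv PE QE; have -> : v = 1 - u by rewrite -uv addrC addKr.
  by ring.
have -> : P * Q * ps - ep ^+ 2 = (u ^+ 2 * Q + v ^+ 2 * P) * (ch * t) * ps + u * v * (ps * L) - ep ^+ 2.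
  by rewrite PQ cht; ring.
rewrite psL DE.
have -> : u * v * (s * ep ^+ 2 + ch ^+ 2 * (W + s - 2)) =
  (s * (u * v)) * ep ^+ 2 + ch ^+ 2 * (u * v * (W + s - 2)) by ring.
by rewrite suv -rho; ring.
Qed.

(** Multiplied by the positive factor (u^2 Q + v^2 P) ps, the form is a sum of three squares; the
    identity above is what gives the last one the coefficient ep^2. *)
Lemma hess_form_gt0 (R : realType) (u v ps ch t ep P Q D a b c : R) :
  0 < u -> 0 < v -> 0 < P -> 0 < Q -> 0 < ps -> 0 < ep -> D = ch + t * ps ->
  (u ^+ 2 * Q + v ^+ 2 * P) * D * ch = P * Q * ps - ep ^+ 2 ->
  [|| a != 0, b != 0 | c != 0] ->
  0 < P * a ^+ 2 + Q * b ^+ 2 + t * D * (u * a + v * b) ^+ 2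
      - 2 * D * (u * a + v * b) * c + ps * c ^+ 2.
Proof.
move=> u0 v0 P0 Q0 ps0 ep0 DE key nz.
have r0 : 0 < u ^+ 2 * Q + v ^+ 2 * P by rewrite addr_gt0 ?mulr_gt0 ?exprn_gt0.
set r := u * a + v * b; set F := (X in 0 < X).
have E : (u ^+ 2 * Q + v ^+ 2 * P) * ps * F =
  (u ^+ 2 * Q + v ^+ 2 * P) * (ps * c - D * r) ^+ 2 +
  ps * (v * P * a - u * Q * b) ^+ 2 + ep ^+ 2 * r ^+ 2.
  have -> : ep ^+ 2 = P * Q * ps - (u ^+ 2 * Q + v ^+ 2 * P) * D * ch by rewrite key; ring.
  have -> : ch = D - t * ps by rewrite DE addrK.
  by rewrite /F /r; ring.
rewrite -(pmulr_rgt0 _ (mulr_gt0 r0 ps0)) E.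
have h1 : 0 <= (u ^+ 2 * Q + v ^+ 2 * P) * (ps * c - D * r) ^+ 2.
  by rewrite mulr_ge0 ?sqr_ge0// ltW.
have h2 : 0 <= ps * (v * P * a - u * Q * b) ^+ 2 by rewrite mulr_ge0 ?sqr_ge0// ltW.
have h3 : 0 <= ep ^+ 2 * r ^+ 2 by rewrite mulr_ge0 ?sqr_ge0.
rewrite lt_neqAle !addr_ge0// andbT eq_sym; apply: contraTN nz.
rewrite !paddr_eq0// ?addr_ge0//; move=> /andP[/andP[k1 k2] k3].
have {}k1 : ps * c - D * r = 0.
  by apply/eqP; move: k1; rewrite mulf_eq0 (gt_eqF r0) expf_eq0.
have {}k2 : v * P * a - u * Q * b = 0.
  by apply/eqP; move: k2; rewrite mulf_eq0 (gt_eqF ps0) expf_eq0.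
have {}k3 : r = 0.
  by apply/eqP; move: k3; rewrite mulf_eq0 !expf_eq0 (gt_eqF ep0).
have a0 : a = 0.
  have : (u ^+ 2 * Q + v ^+ 2 * P) * a = u * Q * r + v * (v * P * a - u * Q * b).
    by rewrite /r; ring.
  rewrite k2 k3 !mulr0 addr0 => /eqP; rewrite mulf_eq0 (gt_eqF r0) => /eqP //.
have b0 : b = 0.
  move: k3; rewrite /r a0 mulr0 add0r => /eqP.
  by rewrite mulf_eq0 (gt_eqF v0) => /eqP.
have c0 : c = 0.
  move: k1; rewrite k3 mulr0 subr0 => /eqP.
  by rewrite mulf_eq0 (gt_eqF ps0) => /eqP.
by rewrite a0 b0 c0 eqxx.
Qed.

Section potential.
Context {R : realType}.
Variables (p q c x1 x2 x3 : R).
Hypothesis p2 : 2 <= p.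
Hypothesis q1 : 1 < q.
Hypothesis pq : p * q = p + q.
Hypothesis c0 : c < 0.
Hypothesis x1_01 : 0 < x1 < 1.
Hypothesis x21 : x2 < x1.
Hypothesis x31 : x3 < x1.
Hypothesis e1 : x1 + x2 + x3 = 1 - p - q.
Hypothesis e2 : x1 * x2 + x1 * x3 + x2 * x3 = 0.
Hypothesis e3 : 4 * (p + q) * (x1 * x2 * x3) = 4 * (p + q) ^+ 2 - c ^+ 2.
Variables (Th : R -> R) (la : R).

Notation W := (W x1).
Notation L := (L p q x1).
Notation S := (Defs.rad p q x1 x2 x3).
Notation phi0 := (phi0 p q x1 Th).
Notation eps := (eps p q x1 Th).
Notation T := (T p q c x1 x2 x3 Th).
Notation chi := (chi p q c x1 x2 x3 Th).
Notation al := (expR la).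
Notation u := (p^-1).
Notation v := (q^-1).
Notation U := (cone_int p q al).
Implicit Types w d : 'rV[R]_3.

Hypothesis dTh : forall z : R, is_derive z 1 Th (theta p q c x1 x2 x3 z).
Hypothesis Th_y : Th z @[z --> +oo] --> 0.
Hypothesis Th_Ny : Th z @[z --> -oo] --> la.

Let W0 z : 0 < W z := W_gt0 x1_01 z.
Let L0 z : 0 < L z := L_gt0 p2 q1 pq x1_01 z.
Let S0 z : 0 < S z := S_gt0 p2 q1 x21 x31 z.
Let s0 : 0 < p + q := sum_gt0 p2 q1 pq.
Let E0 z : 0 < eps z := eps_gt0 p q x1 Th z.
Let P0 : 0 < p := p_gt0 p2.
Let Q0 : 0 < q := q_gt0 q1.
Let uv1 : u + v = 1. Proof. by have [] := inv_pq p2 q1 pq. Qed.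
Let u0 : 0 < u. Proof. by rewrite invr_gt0. Qed.
Let v0 : 0 < v. Proof. by rewrite invr_gt0. Qed.
Let suv : (p + q) * (u * v) = 1.
Proof. by rewrite -pq; field; rewrite !gt_eqF. Qed.
Let al0 : 0 < al := expR_gt0 la.
Let al1 : al < 1. Proof. by rewrite expR_lt1; exact: (la_lt0 p2 q1 pq c0 x1_01 x21 x31 dTh Th_y Th_Ny). Qed.
Let al01 : 0 < al <= 1. Proof. by rewrite al0 (ltW al1). Qed.

Let dT (z : R) : is_derive z 1 T (L z / (S z * eps z)).
Proof. exact: is_derive_T. Qed.
Let T_mono : {homo T : x y / x < y}. Proof. exact: T_homo. Qed.
Let T_y : T z @[z --> +oo] --> (1 : R).
Proof. exact: T_cvgy. Qed.
Let T_Ny : T z @[z --> -oo] --> - al.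
Proof. exact: T_cvgNy. Qed.
Let T1 z : T z < 1. Proof. exact: T_lt1. Qed.
Let Tal z : - al < T z. Proof. exact: T_gt. Qed.
Let chiT z : chi z * T z = W z - 1. Proof. exact: chi_mul_T. Qed.

Lemma T_surj t : - al < t < 1 -> exists z, T z = t.
Proof.
move=> /andP[t1 t2].
have [a Ta] : exists a, T a < t.
  have H : \forall z \near -oo, T z < t by exact: (cvgr_lt _ T_Ny _ t1).
  by near (-oo : set_system R) => a; exists a; near: a.
have [b Tb] : exists b, t < T b.
  have H : \forall z \near +oo, t < T z by exact: (cvgr_gt _ T_y _ t2).
  by near (+oo : set_system R) => b; exists b; near: b.
have ab : a <= b.
  by rewrite leNgt; apply/negP => /T_mono; rewrite ltNge (ltW (lt_trans Ta Tb)).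
have [||z _ zE] := @IVT _ T a b t ab; last by exists z.
- apply: continuous_subspaceT => z; exact: is_derive_continuous (dT z).
- by rewrite ge_min (ltW Ta) le_max (ltW Tb) orbT.
Unshelve. all: by end_near. Qed.

(** Outside the range of T the default 0 is returned; only values in the range are ever used. *)
Definition Tinv t := xget 0 [set z | T z = t].

Lemma Tinv_inT t : - al < t < 1 -> T (Tinv t) = t.
Proof. by move=> /T_surj[z zE]; exact: (xgetPex (0 : R) (ex_intro [set z | T z = t] z zE)). Qed.

Lemma TinvK z : Tinv (T z) = z.
Proof.
have E : T (Tinv (T z)) = T z by apply: Tinv_inT; rewrite Tal T1.
by have [/T_mono|/T_mono|//] := ltgtP (Tinv (T z)) z; rewrite E ltxx.
Qed.

Definition rate z := S z * eps z / L z.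

Lemma is_derive_Tinv (t : R) : - al < t < 1 -> is_derive t 1 Tinv (rate (Tinv t)).
Proof.
move=> tt; rewrite -{1}(Tinv_inT tt).
have -> : rate (Tinv t) = (L (Tinv t) / (S (Tinv t) * eps (Tinv t)))^-1.
  by rewrite /rate invf_div.
apply: is_derive_inverse.
- by near=> x; exact: TinvK.
- by near=> x; exact: is_derive_continuous (dT x).
- exact: dT.
- by rewrite gt_eqF// divr_gt0// mulr_gt0.
Unshelve. all: by end_near. Qed.

(** The reciprocal of the geometric mean on the open quadrant, so that [tau] is z divided by it: the
    coordinate of degree 0 that is invariant under the diagonal automorphisms of the cone. *)
Definition imean (w : 'rV[R]_3) := expR (- (u * ln (w 0 0) + v * ln (w 0 1))).
Definition tau (w : 'rV[R]_3) := w 0 2 * imean w.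
Definition zeta w := Tinv (tau w).
Definition F0 (w : 'rV[R]_3) := phi0 (zeta w) - (1 + u) * ln (w 0 0) - (1 + v) * ln (w 0 1).

Lemma imean_gt0 w : 0 < imean w. Proof. exact: expR_gt0. Qed.

Lemma gmean_imean w : 0 < w 0 0 -> 0 < w 0 1 -> gmean p q (w 0 0) (w 0 1) = (imean w)^-1.
Proof. by move=> x0 y0; rewrite gmean_expR// -expRN opprK. Qed.

Lemma cone_int_tau w : U w <-> [/\ 0 < w 0 0, 0 < w 0 1 & - al < tau w < 1].
Proof.
have i0 := imean_gt0 w.
have E (x0 : 0 < w 0 0) (y0 : 0 < w 0 1) :
    (- al * gmean p q (w 0 0) (w 0 1) < w 0 2 < gmean p q (w 0 0) (w 0 1)) =
    (- al < tau w < 1).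
  rewrite gmean_imean// /tau -ltr_pdivlMr; last by rewrite invr_gt0.
  by rewrite invrK -{1}[(imean w)^-1]mul1r ltr_pdivlMr.
by split=> [[a b h]|[a b h]]; split=> //; rewrite ?E// -E.
Qed.

Lemma zetaE w : U w -> T (zeta w) = tau w.
Proof. by move=> /cone_int_tau[_ _ h]; exact: Tinv_inT. Qed.

Definition dtau (d w : 'rV[R]_3) :=
  imean w * d 0 2 - tau w * (u * (d 0 0 / w 0 0) + v * (d 0 1 / w 0 1)).

Let dco (w d : 'rV[R]_3) i : is_derive w d (fun w : 'rV[R]_3 => w 0 i) (d 0 i) := is_derive_coord w d i.

Lemma is_derive_imean w d : 0 < w 0 0 -> 0 < w 0 1 ->
  is_derive w d imean (- imean w * (u * (d 0 0 / w 0 0) + v * (d 0 1 / w 0 1))).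
Proof.
move=> x0 y0.
have d1 := is_deriveM' (is_derive_cst' w d u) (is_derive_ln' (dco w d 0) x0).
have d2 := is_deriveM' (is_derive_cst' w d v) (is_derive_ln' (dco w d 1) y0).
apply: (is_derive_eq (is_derive_expR' (is_deriveN' (is_deriveD' d1 d2)))).
rewrite -/(imean w) !mul0r !addr0; ring.
Qed.

Lemma is_derive_tau w d : 0 < w 0 0 -> 0 < w 0 1 -> is_derive w d tau (dtau d w).
Proof.
move=> x0 y0; apply: (is_derive_eq (is_deriveM' (dco w d 2) (is_derive_imean d x0 y0))).
by rewrite /dtau /tau; ring.
Qed.

Let diffco (w : 'rV[R]_3) i : differentiable (fun w : 'rV[R]_3 => w 0 i : R) w.
Proof. exact: differentiable_coord. Qed.

Let difflnco (w : 'rV[R]_3) i : 0 < w 0 i -> differentiable (fun w : 'rV[R]_3 => ln (w 0 i) : R) w.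
Proof. by move=> wi; apply: diff_scomp (is_derive1_ln wi) _; exact: diffco. Qed.

Lemma differentiable_imean w : 0 < w 0 0 -> 0 < w 0 1 -> differentiable imean w.
Proof.
move=> x0 y0; pose h w := - (u * ln (w 0 0) + v * ln (w 0 1)).
have dh : differentiable h w.
  apply: differentiableN; apply: differentiableD;
    by apply: differentiableM => //; exact: difflnco.
exact: (@diff_scomp _ _ h expR w _ (is_derive_expR (h w)) dh).
Qed.

Lemma differentiable_tau w : 0 < w 0 0 -> 0 < w 0 1 -> differentiable tau w.
Proof.
by move=> x0 y0; apply: differentiableM; [exact: diffco|exact: differentiable_imean].
Qed.

Lemma zeta_scomp (g : R -> R) (g' : R) w : U w -> is_derive (zeta w) 1 g g' ->
  differentiable (fun w => g (zeta w)) w /\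
  forall d, is_derive w d (fun w => g (zeta w)) (g' * rate (zeta w) * dtau d w).
Proof.
move=> /cone_int_tau[x0 y0 tt] dg.
have dgt : is_derive (tau w) 1 (fun t => g (Tinv t)) (g' * rate (zeta w)).
  exact (@is_derive_scomp R R Tinv g (tau w) 1 _ _ dg (is_derive_Tinv tt)).
split; first by apply: diff_scomp dgt _; exact: differentiable_tau.
by move=> d; apply: is_derive_scomp dgt _; exact: is_derive_tau.
Qed.

Definition chiz w := chi (zeta w).
Definition Wz w := W (zeta w).
Definition epz w := eps (zeta w).
Definition iLz w := (L (zeta w))^-1.
(** psi'' at [tau w], and below it [dpsi], the derivative of t psi'(t), which is also dW/dt. *)
Definition psi2 w := ((p + q) * epz w ^+ 2 + chiz w ^+ 2 * (Wz w + p + q - 2)) * iLz w.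
Definition dpsi w := chiz w + tau w * psi2 w.

Lemma chiz_tau w : U w -> chiz w * tau w = Wz w - 1.
Proof. by move=> /zetaE <-; exact: chiT. Qed.

Lemma is_derive_chiz w : U w -> differentiable chiz w /\
  forall d, is_derive w d chiz (psi2 w * dtau d w).
Proof.
move=> Uw; have dc : is_derive (zeta w) 1 chi (((p + q) * epz w + chiz w ^+ 2 * (Wz w + p + q - 2) / epz w) / S (zeta w)).
  exact: is_derive_chi.
have [h1 h2] := zeta_scomp Uw dc; split=> // d; apply: (is_derive_eq (h2 d)).
rewrite /psi2 /rate /iLz -/(epz w); congr (_ * _).
by field; rewrite !gt_eqF// ?E0.
Qed.

Lemma is_derive_Wz w : U w -> differentiable Wz w /\
  forall d, is_derive w d Wz (dpsi w * dtau d w).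
Proof.
move=> Uw; have [h1 h2] := zeta_scomp Uw (is_derive_W x1 (zeta w)); split=> // d.
apply: (is_derive_eq (h2 d)); congr (_ * _).
have dc : is_derive (zeta w) 1 chi (((p + q) * epz w + chiz w ^+ 2 * (Wz w + p + q - 2) / epz w) / S (zeta w)).
  exact: is_derive_chi.
have := is_deriveM' dc (dT (zeta w)).
have E : (fun y => chi y * T y) = (fun y => W y - 1) by apply/funext => y; exact: chiT.
rewrite E => d1; have {d1} := is_derive_unique d1 (is_deriveB' (is_derive_W x1 (zeta w)) (is_derive_cst' (zeta w) 1 1)).
rewrite subr0 => <-; rewrite zetaE// /dpsi /psi2 /rate /iLz -/(epz w) -/(chiz w).
by field; rewrite !gt_eqF// ?E0.
Qed.

Lemma is_derive_epz w : U w -> differentiable epz w /\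
  forall d, is_derive w d epz (epz w * chiz w * dtau d w).
Proof.
move=> Uw; have dp : is_derive (zeta w) 1 phi0 (chi (zeta w) * (L (zeta w) / (S (zeta w) * eps (zeta w)))).
  exact: is_derive_phi0.
have [h1 h2] := zeta_scomp Uw (is_derive_expR' dp); split=> // d; apply: (is_derive_eq (h2 d)).
rewrite /rate -/(chiz w) -/(eps _) -/(epz w); congr (_ * _).
by field; rewrite !gt_eqF// ?E0.
Qed.

Lemma is_derive_iLz w : U w -> differentiable iLz w /\
  forall d, is_derive w d iLz (- 3 * iLz w ^+ 2 * dpsi w * dtau d w).
Proof.
move=> Uw; have [dw hw] := is_derive_Wz Uw.
have LE : L = (fun z => 3 * W z + (2 * (p + q) - 2)).
  by apply/funext => z; rewrite /L addrA.
have iE : iLz = (fun w => (3 * Wz w + (2 * (p + q) - 2))^-1).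
  by apply/funext => z; rewrite /iLz LE.
have n0 : 3 * Wz w + (2 * (p + q) - 2) != 0.
  by have := L0 (zeta w); rewrite LE => /lt0r_neq0.
split=> [|d].
  rewrite iE; apply: (@diff_scomp _ _ (fun w => 3 * Wz w + (2 * (p + q) - 2)) (fun y => y^-1)).
    exact: (is_deriveV' (is_derive_id' _) n0).
  apply: differentiableD; last exact: differentiable_cst.
  by apply: differentiableM => //; exact: differentiable_cst.
rewrite {1}iE; have d1 := is_deriveD' (is_deriveM' (is_derive_cst' w d 3) (hw d)) (is_derive_cst' w d (2 * (p + q) - 2)).
apply: (is_derive_eq (is_deriveV' d1 n0)); rewrite iE.
by field; rewrite n0.
Qed.

(** The relation chi tau = W - 1 removes tau: the coefficient of dx/x is -u (W - 1) - (1 + u) = -(u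
    W + 1), and likewise for y. *)
Definition dF0 (d w : 'rV[R]_3) := - (u * Wz w + 1) * (d 0 0 / w 0 0)
  - (v * Wz w + 1) * (d 0 1 / w 0 1) + chiz w * (imean w * d 0 2).

Lemma is_derive_F0 w : U w -> differentiable F0 w /\
  forall d, is_derive w d F0 (dF0 d w).
Proof.
move=> Uw; have /cone_int_tau[x0 y0 _] := Uw.
have dp : is_derive (zeta w) 1 phi0 (chi (zeta w) * (L (zeta w) / (S (zeta w) * eps (zeta w)))).
  exact: is_derive_phi0.
have [h1 h2] := zeta_scomp Uw dp; split=> [|d].
  apply: differentiableB; first apply: differentiableB => //.
    by apply: differentiableM; [exact: differentiable_cst|exact: difflnco].
  by apply: differentiableM; [exact: differentiable_cst|exact: difflnco].
have d1 := is_deriveM' (is_derive_cst' w d (1 + u)) (is_derive_ln' (dco w d 0) x0).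
have d2 := is_deriveM' (is_derive_cst' w d (1 + v)) (is_derive_ln' (dco w d 1) y0).
apply: (is_derive_eq (is_deriveB' (is_deriveB' (h2 d) d1) d2)).
rewrite !mul0r !addr0.
have -> : chi (zeta w) * (L (zeta w) / (S (zeta w) * eps (zeta w))) * rate (zeta w) = chiz w.
  by rewrite /rate -/(chiz w); field; rewrite !gt_eqF// ?E0.
rewrite /dtau mulrBr [chiz w * (tau w * _)]mulrA chiz_tau// /dF0.
by field; rewrite !gt_eqF.
Qed.

Lemma psi2_gt0 w : 0 < psi2 w.
Proof.
rewrite /psi2 mulr_gt0 ?invr_gt0 ?L0// ltr_pwDl ?mulr_gt0 ?exprn_gt0 ?E0//.
rewrite mulr_ge0 ?sqr_ge0//; have := W0 (zeta w); have := pq_ge4 p2 q1 pq.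
by rewrite -/(Wz w); lra.
Qed.

(** In the frame dx/x, dy/y, dz divided by the geometric mean, the coefficients depend on tau
    alone. *)
Definition hess2 (d e w : 'rV[R]_3) :=
  let: (a, b, k) := (d 0 0 / w 0 0, d 0 1 / w 0 1, imean w * d 0 2) in
  let: (a', b', k') := (e 0 0 / w 0 0, e 0 1 / w 0 1, imean w * e 0 2) in
  let: (r, r') := (u * a + v * b, u * a' + v * b') in
  (u * Wz w + 1) * (a * a') + (v * Wz w + 1) * (b * b') + tau w * dpsi w * (r * r')
  - dpsi w * (r * k' + r' * k) + psi2 w * (k * k').

Lemma is_derive_dF0 w d e : U w -> is_derive w e (dF0 d) (hess2 d e w).
Proof.
move=> Uw; have /cone_int_tau[x0 y0 _] := Uw.
have dx := is_deriveM' (is_derive_cst' w e (d 0 0)) (is_deriveV' (dco w e 0) (lt0r_neq0 x0)).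
have dy := is_deriveM' (is_derive_cst' w e (d 0 1)) (is_deriveV' (dco w e 1) (lt0r_neq0 y0)).
have dW := (is_derive_Wz Uw).2 e; have dc := (is_derive_chiz Uw).2 e.
have dm := is_derive_imean e x0 y0.
have d1 := is_deriveM' (is_deriveN' (is_deriveD' (is_deriveM' (is_derive_cst' w e u) dW) (is_derive_cst' w e 1))) dx.
have d2 := is_deriveM' (is_deriveD' (is_deriveM' (is_derive_cst' w e v) dW) (is_derive_cst' w e 1)) dy.
have d3 := is_deriveM' dc (is_deriveM' dm (is_derive_cst' w e (d 0 2))).
apply: (is_derive_eq (is_deriveD' (is_deriveB' d1 d2) d3)).
rewrite /hess2 /dtau /dpsi /=.
move: (psi2 w) (chiz w) (tau w) (imean w) (Wz w) => ps ch t m om.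
by field; rewrite !gt_eqF.
Qed.

Let UF w d : U w -> 'D_d F0 w = dF0 d w.
Proof. by move=> Uw; have [_ /(_ d) h] := is_derive_F0 Uw; exact: derive_val. Qed.

Let oU : open U. Proof. exact: open_cone_int. Qed.
Let UK : interior (cone p q al) = U. Proof. exact: interior_cone. Qed.

Lemma Hessian_F0 w i j : U w -> Hessian F0 w i j = hess2 ('e_i) ('e_j) w.
Proof.
move=> Uw; rewrite mxE; have H := is_derive_dF0 ('e_i) ('e_j) Uw.
rewrite (@near_eq_derive _ _ _ _ (dF0 'e_i)); first exact: derive_val.
by apply: filterS (open_nbhs_nbhs (conj oU Uw)) => y; exact: UF.
Qed.

Let key w : U w -> (u ^+ 2 * (v * Wz w + 1) + v ^+ 2 * (u * Wz w + 1)) * dpsi w * chiz w =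
  (u * Wz w + 1) * (v * Wz w + 1) * psi2 w - epz w ^+ 2.
Proof.
move=> Uw; apply: (@hess_identity _ u v (p + q) (Wz w) (L (zeta w)) (psi2 w) (chiz w) (tau w)) => //.
  exact: chiz_tau.
rewrite /psi2 /iLz divfK ?gt_eqF// addrA; congr (_ + _ * (_ - _)); by rewrite addrA.
Qed.

Lemma posdef_F0 w : U w -> posdefmx (Hessian F0 w).
Proof.
move=> Uw; have /cone_int_tau[x0 y0 _] := Uw; split.
  by apply/matrixP => i j; rewrite mxE !Hessian_F0// /hess2; ring.
move=> d dn.
have -> : (d *m Hessian F0 w *m d^T) 0 0 = hess2 d d w.
  rewrite !mxE !sum_ord3 !mxE !sum_ord3 !Hessian_F0// /hess2 !mxE /=.
  by ring.
have W00 : 0 < Wz w by exact: W0.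
have := @hess_form_gt0 _ u v (psi2 w) (chiz w) (tau w) (epz w) (u * Wz w + 1) (v * Wz w + 1)
  (dpsi w) (d 0 0 / w 0 0) (d 0 1 / w 0 1) (imean w * d 0 2) u0 v0 _ _ (psi2_gt0 w) (E0 _)
  erefl (key Uw) _.
have -> : hess2 d d w = (u * Wz w + 1) * (d 0 0 / w 0 0) ^+ 2 + (v * Wz w + 1) * (d 0 1 / w 0 1) ^+ 2
  + tau w * dpsi w * (u * (d 0 0 / w 0 0) + v * (d 0 1 / w 0 1)) ^+ 2
  - 2 * dpsi w * (u * (d 0 0 / w 0 0) + v * (d 0 1 / w 0 1)) * (imean w * d 0 2)
  + psi2 w * (imean w * d 0 2) ^+ 2 by rewrite /hess2; ring.
apply; rewrite ?addr_gt0 ?mulr_gt0//.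
apply: contraNT dn; rewrite !negb_or !negbK !mulf_eq0 !invr_eq0.
rewrite (gt_eqF x0) (gt_eqF y0) (gt_eqF (imean_gt0 w)) !orbF /=.
move=> /and3P[/eqP d0 /eqP d1 /eqP d2]; apply/eqP/rowP.
by apply: forall_ord3; rewrite mxE.
Qed.

Lemma expF0 w : U w -> expR (F0 w) = epz w * (imean w / (w 0 0 * w 0 1)).
Proof.
move=> /cone_int_tau[x0 y0 _]; rewrite /F0.
have -> : phi0 (zeta w) - (1 + u) * ln (w 0 0) - (1 + v) * ln (w 0 1) =
  phi0 (zeta w) + (- (u * ln (w 0 0) + v * ln (w 0 1)) + (- ln (w 0 0) - ln (w 0 1))) by ring.
have EC : expR (- ln (w 0 0) - ln (w 0 1)) = (w 0 0 * w 0 1)^-1.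
  by rewrite expRD !expRN !lnK// invfM.
by rewrite expRD [X in _ * X]expRD EC.
Qed.

(** The frame contributes (imean / (x y))^2, which is the corresponding factor of e^(2 F0) by
    [expF0]; what remains is [key]. *)
Lemma det_F0 w : U w -> \det (Hessian F0 w) = expR (2 * F0 w).
Proof.
move=> Uw; have /cone_int_tau[x0 y0 _] := Uw.
have -> : 2 * F0 w = F0 w + F0 w by ring.
rewrite expRD expF0// det3 !Hessian_F0// /hess2 !mxE /=.
have K := key Uw; rewrite /dpsi in K *.
have {K} K : epz w ^+ 2 = (u * Wz w + 1) * (v * Wz w + 1) * psi2 w -
  (u ^+ 2 * (v * Wz w + 1) + v ^+ 2 * (u * Wz w + 1)) * (chiz w + tau w * psi2 w) * chiz w by rewrite K; ring.
have -> : epz w * (imean w / (w 0 0 * w 0 1)) * (epz w * (imean w / (w 0 0 * w 0 1))) =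
  epz w ^+ 2 * (imean w / (w 0 0 * w 0 1)) ^+ 2 by ring.
rewrite K; move: (psi2 w) (chiz w) (tau w) (imean w) (Wz w) => ps ch t m om.
by move: (p^-1) (q^-1) => a b; field; rewrite !gt_eqF.
Qed.

Lemma F0_homog (l : R) w : 0 < l -> U w -> F0 (l *: w) = F0 w - 3%:R * ln l.
Proof.
move=> l0 Uw; have /cone_int_tau[x0 y0 _] := Uw.
have E1 : ln ((l *: w) 0 0) = ln l + ln (w 0 0) by rewrite mxE lnM.
have E2 : ln ((l *: w) 0 1) = ln l + ln (w 0 1) by rewrite mxE lnM.
have Em : imean (l *: w) = imean w / l.
  rewrite /imean E1 E2.
  have -> : - (u * (ln l + ln (w 0 0)) + v * (ln l + ln (w 0 1))) =
    - (u * ln (w 0 0) + v * ln (w 0 1)) - (u + v) * ln l by ring.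
  by rewrite uv1 mul1r expRD [expR (- ln l)]expRN lnK.
have Et : tau (l *: w) = tau w by rewrite /tau Em mxE; field; rewrite gt_eqF.
rewrite /F0 /zeta Et E1 E2.
have -> : 3%:R * ln l = (2 + (u + v)) * ln l by rewrite uv1; ring.
by ring.
Qed.

(** Nine functions closed under differentiation on the interior. The square root is absent because
    every derivative goes through tau, where the factor [rate] cancels it. *)
Let genl : seq ('rV[R]_3 -> R) := [:: fun w => w 0 2; fun w => (w 0 0)^-1; fun w => (w 0 1)^-1;
  imean; F0; chiz; Wz; epz; iLz].
Let gen (f : 'rV[R]_3 -> R) := exists i : 'I_9, f = nth (fun=> 0) genl i.

Let gen_in i : (i < 9)%N -> falg gen (nth (fun=> 0) genl i).
Proof. by move=> i9; apply: falg_gen; exists (Ordinal i9). Qed.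

Let falg_dtau d : falg gen (dtau d).
Proof.
apply: falg_add; first by apply: falg_mul; [exact: (gen_in (i := 3))|exact: falg_cst].
apply: falg_opp; apply: falg_mul.
  by apply: falg_mul; [exact: (gen_in (i := 0))|exact: (gen_in (i := 3))].
apply: falg_add; apply: falg_mul; try exact: falg_cst.
  by apply: falg_mul; [exact: falg_cst|exact: (gen_in (i := 1))].
by apply: falg_mul; [exact: falg_cst|exact: (gen_in (i := 2))].
Qed.

Let falg_psi2 : falg gen psi2.
Proof.
apply: falg_mul; last exact: (gen_in (i := 8)).
apply: falg_add; apply: falg_mul; try exact: falg_cst.
- by apply: falg_exp; exact: (gen_in (i := 7)).
- by apply: falg_exp; exact: (gen_in (i := 5)).
apply: falg_add; last exact: falg_cst.
apply: falg_add; last exact: falg_cst.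
by apply: falg_add; [exact: (gen_in (i := 6))|exact: falg_cst].
Qed.

Let falg_dpsi : falg gen dpsi.
Proof.
apply: falg_add; first exact: (gen_in (i := 5)).
apply: falg_mul => //.
by apply: falg_mul; [exact: (gen_in (i := 0))|exact: (gen_in (i := 3))].
Qed.

Let gen_derive f : gen f -> (forall w, U w -> differentiable f w) /\
  forall d, exists2 g, falg gen g & forall w, U w -> 'D_d f w = g w.
Proof.
have K (f' : 'rV[R]_3 -> R) (g : 'rV[R]_3 -> 'rV[R]_3 -> R) :
    (forall w, U w -> differentiable f' w /\ forall d, is_derive w d f' (g d w)) ->
    (forall d, falg gen (g d)) ->
    (forall w, U w -> differentiable f' w) /\
    forall d, exists2 g, falg gen g & forall w, U w -> 'D_d f' w = g w.
  move=> h1 h2; split=> [w /h1[]//|d]; exists (g d) => // w /h1[_ /(_ d) h].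
  exact: derive_val.
have inv i : (forall w, U w -> 0 < w 0 i) -> falg gen (fun w => (w 0 i)^-1) ->
    (forall w, U w -> differentiable (fun w : 'rV[R]_3 => (w 0 i)^-1) w) /\
    forall d, exists2 g, falg gen g & forall w, U w -> 'D_d (fun w : 'rV[R]_3 => (w 0 i)^-1) w = g w.
  move=> wi gi; apply: (K _ (fun d w => - d 0 i * (w 0 i)^-1 ^+ 2)).
    move=> w Uw; have n0 := lt0r_neq0 (wi _ Uw); split=> [|d].
      exact: (@diff_scomp _ _ (fun w : 'rV[R]_3 => w 0 i) (fun y => y^-1) w _
        (is_deriveV' (is_derive_id' _) n0) (diffco w i)).
    by rewrite exprVn; exact: is_deriveV' (dco w d i) n0.
  by move=> d; apply: falg_mul; [exact: falg_cst|exact: falg_exp].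
have fd0 d : falg gen (fun w => d 0 0 / w 0 0).
  by apply: falg_mul; [exact: falg_cst|exact: (gen_in (i := 1))].
have fd1 d : falg gen (fun w => d 0 1 / w 0 1).
  by apply: falg_mul; [exact: falg_cst|exact: (gen_in (i := 2))].
move=> [[[|[|[|[|[|[|[|[|[|//]]]]]]]]] i] ->] /=.
- apply: (K _ (fun d w => d 0 2)) => [w _|d]; last exact: falg_cst.
  by split.
- by apply: inv; [move=> w []|exact: (gen_in (i := 1))].
- by apply: inv; [move=> w []|exact: (gen_in (i := 2))].
- apply: (K _ (fun d w => - imean w * (u * (d 0 0 / w 0 0) + v * (d 0 1 / w 0 1)))).
    move=> w [x0 y0 _]; split; first exact: differentiable_imean.
    by move=> d; exact: is_derive_imean.
  move=> d; apply: falg_mul; first by apply: falg_opp; exact: (gen_in (i := 3)).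
  by apply: falg_add; apply: falg_mul => //; exact: falg_cst.
- apply: (K _ dF0); first exact: is_derive_F0.
  move=> d; apply: falg_add.
    have fW a : falg gen (fun w => a * Wz w + 1).
      apply: falg_add; last exact: falg_cst.
      by apply: falg_mul; [exact: falg_cst|exact: (gen_in (i := 6))].
    apply: falg_add; first by apply: falg_mul => //; exact: falg_opp.
    by apply: falg_opp; apply: falg_mul.
  apply: falg_mul; first exact: (gen_in (i := 5)).
  by apply: falg_mul; [exact: (gen_in (i := 3))|exact: falg_cst].
- apply: (K _ (fun d w => psi2 w * dtau d w)); first exact: is_derive_chiz.
  by move=> d; exact: falg_mul.
- apply: (K _ (fun d w => dpsi w * dtau d w)); first exact: is_derive_Wz.
  by move=> d; exact: falg_mul.
- apply: (K _ (fun d w => epz w * chiz w * dtau d w)); first exact: is_derive_epz.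
  by move=> d; apply: falg_mul => //; apply: falg_mul; [exact: (gen_in (i := 7))|exact: (gen_in (i := 5))].
- apply: (K _ (fun d w => - 3 * iLz w ^+ 2 * dpsi w * dtau d w)); first exact: is_derive_iLz.
  move=> d; apply: falg_mul => //; apply: falg_mul => //.
  by apply: falg_mul; [exact: falg_cst|apply: falg_exp; exact: (gen_in (i := 8))].
Qed.

Lemma Ck_F0 k : Ck_on U k F0.
Proof.
apply: (@falg_Ck_on _ _ U oU gen gen_derive k F0 F0) => //.
exact: (gen_in (i := 4)).
Qed.

(** Needed where x or y tends to 0: there tau, and with it zeta, is not controlled. *)
Lemma phi0_lower : exists m, forall z, m <= phi0 z.
Proof.
exists ((1 + u) / 2 * ln p + (1 + v) / 2 * ln q - ln (p + q) / 2) => z.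
have W0z := W0 z; have Thz : Th z <= 0 by exact: (Th_le0 p2 q1 pq c0 x1_01 x21 x31 dTh Th_y).
have h1 : (1 + u) / 2 * ln p <= (1 + u) / 2 * ln (W z + p).
  apply: ler_wpM2l; first by rewrite divr_ge0// addr_ge0// ltW.
  have : p <= W z + p by rewrite lerDr ltW.
  by rewrite ler_ln// posrE addr_gt0.
have h2 : (1 + v) / 2 * ln q <= (1 + v) / 2 * ln (W z + q).
  apply: ler_wpM2l; first by rewrite divr_ge0// addr_ge0// ltW.
  have : q <= W z + q by rewrite lerDr ltW.
  by rewrite ler_ln// posrE addr_gt0.
by rewrite /phi0; lra.
Qed.

Lemma F0_boundary (b : 'rV[R]_3) : boundary (cone p q al) b ->
  F0 w @[w --> within (interior (cone p q al)) (nbhs b)] --> +oo.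
Proof.
move=> /(boundary_cone P0 Q0 uv1 al01)[_ b0 b1 cases]; rewrite UK.
have [m mP] := phi0_lower.
apply/cvgryPge => A; rewrite near_withinE.
have cco (i : 'I_3) : (w : 'rV[R]_3) 0 i @[w --> b] --> b 0 i by exact: coord_continuous.
have B0 : \forall w \near b, (w : 'rV[R]_3) 0 0 < b 0 0 + 1.
  by apply: (cvgr_lt _ (cco 0)); rewrite ltrDl.
have B1 : \forall w \near b, (w : 'rV[R]_3) 0 1 < b 0 1 + 1.
  by apply: (cvgr_lt _ (cco 1)); rewrite ltrDl.
have lnle (x y : R) : 0 < x -> x < y -> ln x <= ln y.
  by move=> x0 xy; rewrite ler_ln ?posrE ?(ltW xy)// (lt_trans x0).
have u1 : 0 < 1 + u by rewrite addr_gt0.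
have v1 : 0 < 1 + v by rewrite addr_gt0.
have lnexp (k x B : R) : 0 < k -> 0 < x -> x < expR (B / k) -> k * ln x <= B.
  move=> k0 xp xB; have : ln x <= B / k by rewrite -[leRHS]expRK; exact: lnle.
  by move=> /(ler_wpM2l (ltW k0)); rewrite mulrCA divff ?mulr1 ?gt_eqF.
have mulle (k x y : R) : 0 < k -> 0 < x -> x < y -> k * ln x <= k * ln y.
  by move=> k0 xp xy; apply: ler_wpM2l; [exact: ltW|exact: lnle].
case: cases => [E|E|[x0 y0 E]].
(* Here -(1 + u) ln x must do all the work: [C] is the bound on (1 + u) ln x for which F0 >= A,
   given phi0 >= m and y < b 0 1 + 1. *)
- pose C := m - A - (1 + v) * ln (b 0 1 + 1).
  have B2 : \forall w \near b, (w : 'rV[R]_3) 0 0 < expR (C / (1 + u)).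
    by apply: (cvgr_lt _ (cco 0)); rewrite E expR_gt0.
  near=> w => -[wx wy _].
  have h1 : (1 + u) * ln (w 0 0) <= C by apply: lnexp => //; near: w.
  have h2 : (1 + v) * ln (w 0 1) <= (1 + v) * ln (b 0 1 + 1).
    by apply: mulle => //; near: w.
  by have := mP (zeta w); rewrite /F0; rewrite /C in h1; lra.
- pose C := m - A - (1 + u) * ln (b 0 0 + 1).
  have B2 : \forall w \near b, (w : 'rV[R]_3) 0 1 < expR (C / (1 + v)).
    by apply: (cvgr_lt _ (cco 1)); rewrite E expR_gt0.
  near=> w => -[wx wy _].
  have h1 : (1 + v) * ln (w 0 1) <= C by apply: lnexp => //; near: w.
  have h2 : (1 + u) * ln (w 0 0) <= (1 + u) * ln (b 0 0 + 1).
    by apply: mulle => //; near: w.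
  by have := mP (zeta w); rewrite /F0; rewrite /C in h1; lra.
(* On the curved faces x and y stay bounded while tau tends to 1 or to -alpha. So |zeta| passes the
   threshold [M] of [phi0_ge], and phi0 exceeds [A']. *)
- pose A' := A + (1 + u) * ln (b 0 0 + 1) + (1 + v) * ln (b 0 1 + 1).
  pose M := 1 + expR A' * Num.sqrt (p + q).
  have M0 : 0 < M by rewrite ltr_wpDr// mulr_ge0 ?expR_ge0.
  have ct : tau w @[w --> b] --> tau b by exact: differentiable_continuous (differentiable_tau x0 y0).
  have far : \forall w \near b, U w -> M <= `|zeta w|.
    have iE := gmean_imean x0 y0; have i0 := imean_gt0 b.
    case: E => E.
    + have tb : T M < tau b.
        by rewrite /tau E iE mulVf ?gt_eqF// T1.
      have H : \forall w \near b, T M < tau w by exact: (cvgr_gt _ ct _ tb).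
      apply: filterS H => w tw Uw; have TT : T M < T (zeta w) by rewrite zetaE.
      rewrite ger0_norm; first by rewrite leNgt; apply/negP => /T_mono; rewrite ltNge (ltW TT).
      rewrite leNgt; apply/negP => z0.
      by have := T_mono (lt_trans z0 M0); rewrite ltNge (ltW TT).
    + have tb : tau b < T (- M).
        by rewrite /tau E iE -mulrA mulVf ?gt_eqF// mulr1 Tal.
      have H : \forall w \near b, tau w < T (- M) by exact: (cvgr_lt _ ct _ tb).
      apply: filterS H => w tw Uw; have TT : T (zeta w) < T (- M) by rewrite zetaE.
      have zM : zeta w <= - M.
        by rewrite leNgt; apply/negP => /T_mono; rewrite ltNge (ltW TT).
      have M1 : - M <= 0 by rewrite oppr_le0 (ltW M0).
      rewrite (ler0_norm (le_trans zM M1)) lerNr; exact: zM.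
  near=> w => Uw; have [wx wy _] := Uw.
  have h1 : (1 + u) * ln (w 0 0) <= (1 + u) * ln (b 0 0 + 1) by apply: mulle => //; near: w.
  have h2 : (1 + v) * ln (w 0 1) <= (1 + v) * ln (b 0 1 + 1) by apply: mulle => //; near: w.
  have h3 : M <= `|zeta w| by move: Uw; near: w.
  have : A' <= phi0 (zeta w).
    exact: (phi0_ge p2 q1 pq c0 x1_01 x21 x31 dTh Th_y).
  by rewrite /F0 /A'; lra.
Unshelve. all: by end_near. Qed.

Lemma canonical_potential_F0 : canonical_potential (cone p q al) F0.
Proof.
split.
- by rewrite UK; exact: Ck_F0.
- by rewrite UK; exact: posdef_F0.
- by rewrite UK; exact: det_F0.
- exact: F0_boundary.
- by rewrite UK => l w l0 Uw; exact: F0_homog.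
Qed.

Notation f := (sphere_map p q T phi0).

Let expA : (q + 1) / (3 * q) = (1 + v) / 3.
Proof. by field; rewrite gt_eqF. Qed.
Let expB : (p + 1) / (3 * p) = (1 + u) / 3.
Proof. by field; rewrite gt_eqF. Qed.
Let expC : (p - q) / (3 * (p + q)) = (v - u) / 3.
Proof. by rewrite -pq; field; rewrite !gt_eqF. Qed.

Lemma sphere_mapE s : [/\ f s 0 0 = expR (phi0 (s 0 0) / 3 + (1 + v) / 3 * s 0 1),
  f s 0 1 = expR (phi0 (s 0 0) / 3 - (1 + u) / 3 * s 0 1) &
  f s 0 2 = expR (phi0 (s 0 0) / 3 - (v - u) / 3 * s 0 1) * T (s 0 0)].
Proof.
have Ec m : - (m * (p - q) / (3 * (p + q))) = - ((v - u) / 3 * m).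
  by rewrite -expC; ring.
by rewrite /sphere_map !mxE /= expA expB Ec mulNr !expRD mulrA.
Qed.

Lemma sphere_map_coords s : [/\ U (f s), zeta (f s) = s 0 0 & F0 (f s) = 0].
Proof.
have [E0' E1' E2'] := sphere_mapE s.
have x0 : 0 < f s 0 0 by rewrite E0' expR_gt0.
have y0 : 0 < f s 0 1 by rewrite E1' expR_gt0.
have tE : tau (f s) = T (s 0 0).
  rewrite /tau /imean E0' E1' E2' !expRK mulrAC -expRD.
  rewrite [X in expR X](_ : _ = 0) ?expR0 ?mul1r//.
  have -> : v = 1 - u by rewrite -uv1 addrC addKr.
  by move: (p^-1) (phi0 _) (s 0 1) => a h m; lra.
have Us : U (f s) by apply/cone_int_tau; rewrite tE Tal T1.
have zE : zeta (f s) = s 0 0 by rewrite /zeta tE TinvK.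
split=> //; rewrite /F0 zE E0' E1' !expRK.
have -> : v = 1 - u by rewrite -uv1 addrC addKr.
by move: (p^-1) (phi0 _) (s 0 1) => a h m; lra.
Qed.

Lemma level_set_F0 : [set x | interior (cone p q al) x /\ F0 x = 0] = range f.
Proof.
rewrite UK; apply/seteqP; split=> [w /= [Uw Fw]|_ [s _ <-]]; last first.
  by have [? _ ?] := sphere_map_coords s.
have /cone_int_tau[x0 y0 _] := Uw.
(* The exponents of mu in x and y differ by ((1 + v) + (1 + u))/3 = 1, so mu = ln (x/y). *)
pose m := ln (w 0 0) - ln (w 0 1).
pose s : 'rV[R]_2 := \row_(i < 2) [:: zeta w; m]`_i; exists s => //.
have s00 : s 0 0 = zeta w by rewrite mxE.
have s01 : s 0 1 = m by rewrite mxE.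
have [] := sphere_mapE s; rewrite s00 s01 => E0' E1' E2'.
have Fp : phi0 (zeta w) = (1 + u) * ln (w 0 0) + (1 + v) * ln (w 0 1) by move: Fw; rewrite /F0; lra.
have vu : v = 1 - u by rewrite -uv1 addrC addKr.
apply/rowP; apply: forall_ord3.
- rewrite E0' Fp -[RHS]lnK//; congr expR; rewrite vu /m.
  by move: (p^-1) (ln (w 0 0)) (ln (w 0 1)) => a h k; lra.
- rewrite E1' Fp -[RHS]lnK//; congr expR; rewrite vu /m.
  by move: (p^-1) (ln (w 0 0)) (ln (w 0 1)) => a h k; lra.
- rewrite E2' zetaE// /tau mulrCA -[RHS]mulr1; congr (_ * _).
  rewrite Fp /imean -expRD [X in expR X](_ : _ = 0) ?expR0// vu /m.
  by move: (p^-1) (ln (w 0 0)) (ln (w 0 1)) => a h k; lra.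
Qed.

End potential.

(** * The affine normal and the affine metric *)

Lemma det2 (R : comNzRingType) (A : 'M[R]_2) : \det A = A 0 0 * A 1 1 - A 0 1 * A 1 0.
Proof.
pose f (i j : nat) := A (inord i) (inord j).
have E i j : A i j = f i j by rewrite /f !inord_val.
rewrite (expand_det_row _ 0) !big_ord_recl big_ord0 addr0 /cofactor !det_mx11 !mxE.
by rewrite !E /= /bump /= !(addn0, add0n, expr0, expr1); ring.
Qed.

Section jacobian_rows.
Context {R : realType}.

Lemma jacobian_entry m n (f : 'rV[R]_m -> 'rV[R]_n) (s : 'rV[R]_m) i j :
  differentiable f s -> ('J f s) i j = ('D_('e_i) f s) 0 j.
Proof.
by move=> df; rewrite deriveEjacobian// -rowE [RHS]mxE.
Qed.

Lemma jacobianZ m n (f : 'rV[R]_m -> 'rV[R]_n) (s : 'rV[R]_m) (a : R) :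
  differentiable f s -> 'J (fun s => a *: f s) s = a *: 'J f s.
Proof.
move=> df; apply/matrixP => i k.
have daf : differentiable (fun s => a *: f s) s by exact: (@differentiableZ _ _ _ f a s df).
apply: (etrans (jacobian_entry i k daf)).
rewrite [RHS]mxE (jacobian_entry i k df).
by rewrite (@deriveZ _ _ _ f a s 'e_i (diff_derivable df)) mxE.
Qed.

End jacobian_rows.

Section sphere.
Context {R : realType}.
Variables (p q c x1 x2 x3 : R).
Hypothesis p2 : 2 <= p.
Hypothesis q1 : 1 < q.
Hypothesis pq : p * q = p + q.
Hypothesis c0 : c < 0.
Hypothesis x1_01 : 0 < x1 < 1.
Hypothesis x21 : x2 < x1.
Hypothesis x31 : x3 < x1.
Hypothesis e1 : x1 + x2 + x3 = 1 - p - q.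
Hypothesis e2 : x1 * x2 + x1 * x3 + x2 * x3 = 0.
Hypothesis e3 : 4 * (p + q) * (x1 * x2 * x3) = 4 * (p + q) ^+ 2 - c ^+ 2.
Variables (Th : R -> R).

Notation W := (W x1).
Notation L := (L p q x1).
Notation S := (Defs.rad p q x1 x2 x3).
Notation phi0 := (phi0 p q x1 Th).
Notation eps := (eps p q x1 Th).
Notation T := (T p q c x1 x2 x3 Th).
Notation chi := (chi p q c x1 x2 x3 Th).
Notation u := (p^-1).
Notation v := (q^-1).
Notation f := (sphere_map p q T phi0).
Implicit Types s d e : 'rV[R]_2.

Hypothesis dTh : forall z : R, is_derive z 1 Th (theta p q c x1 x2 x3 z).

Let W0 z : 0 < W z := W_gt0 x1_01 z.
Let L0 z : 0 < L z := L_gt0 p2 q1 pq x1_01 z.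
Let S0 z : 0 < S z := S_gt0 p2 q1 x21 x31 z.
Let s0 : 0 < p + q := sum_gt0 p2 q1 pq.
Let E0 z : 0 < eps z := eps_gt0 p q x1 Th z.
Let P0 : 0 < p := p_gt0 p2.
Let Q0 : 0 < q := q_gt0 q1.
Let uv1 : u + v = 1. Proof. by have [] := inv_pq p2 q1 pq. Qed.
Let u0 : 0 < u. Proof. by rewrite invr_gt0. Qed.
Let v0 : 0 < v. Proof. by rewrite invr_gt0. Qed.
Let suv : (p + q) * (u * v) = 1.
Proof. by rewrite -pq; field; rewrite !gt_eqF. Qed.
Let vE : v = 1 - u. Proof. by rewrite -uv1 addrC addKr. Qed.
Let chiT z : chi z * T z = W z - 1. Proof. exact: chi_mul_T. Qed.

Definition dTz z := L z / (S z * eps z).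
Definition dchiz z := ((p + q) * eps z + chi z ^+ 2 * (W z + p + q - 2) / eps z) / S z.
Definition dphi z := chi z * dTz z.
Definition dS z := (p + q) * z * (2 * W z - x2 - x3) / S z.
Definition ddT z := 6 * z / (S z * eps z) - dTz z * (dS z / S z + dphi z).
Definition ddphi z := dchiz z * dTz z + chi z * ddT z.

Let isT (z : R) : is_derive z 1 T (dTz z). Proof. exact: is_derive_T. Qed.
Let isS (z : R) : is_derive z 1 S (dS z). Proof. exact: is_derive_S. Qed.
Let isphi (z : R) : is_derive z 1 phi0 (dphi z). Proof. exact: is_derive_phi0. Qed.
Let ischi (z : R) : is_derive z 1 chi (dchiz z). Proof. exact: is_derive_chi. Qed.
Let iseps (z : R) : is_derive z 1 eps (eps z * dphi z).
Proof. exact: is_derive_expR' (isphi z). Qed.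

Let isdT (z : R) : is_derive z 1 dTz (ddT z).
Proof.
have dL : is_derive z 1 L (6 * z).
  have LE : L = (fun z => 3 * W z + (2 * (p + q) - 2)).
    by apply/funext => y; rewrite /L addrA.
  rewrite LE; apply: (is_derive_eq (is_deriveD' (is_deriveM' (is_derive_cst' z 1 3) (is_derive_W x1 z)) (is_derive_cst' z 1 _))).
  by ring.
have n0 : S z * eps z != 0 by rewrite mulf_neq0 ?gt_eqF.
have d : is_derive z 1 dTz _ := is_deriveM' dL (is_deriveV' (is_deriveM' (isS z) (iseps z)) n0).
apply: (is_derive_eq d); rewrite /ddT /dTz; move: (dS z) (dphi z) => a b.
by field; rewrite !gt_eqF ?S0 ?E0.
Qed.

Lemma is_derive_dphi (z : R) : is_derive z 1 dphi (ddphi z).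
Proof.
have d : is_derive z 1 dphi _ := is_deriveM' (ischi z) (isdT z).
by apply: (is_derive_eq d); rewrite /ddphi addrC.
Qed.

(** The third factor [sz] is the geometric mean of [sx] and [sy], and the product of the three is
    eps, since the exponents of mu add up to 0. Below, [lx], [ly] and [lz] are their logarithmic
    derivatives. *)
Definition sx s := expR (phi0 (s 0 0) / 3 + (1 + v) / 3 * s 0 1).
Definition sy s := expR (phi0 (s 0 0) / 3 - (1 + u) / 3 * s 0 1).
Definition sz s := expR (phi0 (s 0 0) / 3 - (v - u) / 3 * s 0 1).

Definition lx d s := dphi (s 0 0) / 3 * d 0 0 + (1 + v) / 3 * d 0 1.
Definition ly d s := dphi (s 0 0) / 3 * d 0 0 - (1 + u) / 3 * d 0 1.
Definition lz d s := dphi (s 0 0) / 3 * d 0 0 - (v - u) / 3 * d 0 1.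

Let sx0 s : 0 < sx s := expR_gt0 _.
Let sy0 s : 0 < sy s := expR_gt0 _.
Let sz0 s : 0 < sz s := expR_gt0 _.

Let zfun (g g' : R -> R) s d : (forall z : R, is_derive z 1 g (g' z)) ->
  is_derive s d (fun s => g (s 0 0)) (g' (s 0 0) * d 0 0).
Proof.
move=> dg; exact (@is_derive_scomp R _ (fun s => s 0 0) g s d _ _ (dg (s 0 0)) (is_derive_coord s d 0)).
Qed.

Let expfun (k : R) s d : is_derive s d (fun s => expR (phi0 (s 0 0) / 3 + k * s 0 1))
  (expR (phi0 (s 0 0) / 3 + k * s 0 1) * (dphi (s 0 0) / 3 * d 0 0 + k * d 0 1)).
Proof.
have d1 := is_deriveM' (zfun s d isphi) (is_derive_cst' s d 3^-1).
have d2 := is_deriveM' (is_derive_cst' s d k) (is_derive_coord s d 1).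
apply: (is_derive_eq (is_derive_expR' (is_deriveD' d1 d2))).
by congr (_ * _); ring.
Qed.

Let is_sx s d : is_derive s d sx (sx s * lx d s). Proof. exact: expfun. Qed.
Let is_sy s d : is_derive s d sy (sy s * ly d s).
Proof.
by have := expfun (- ((1 + u) / 3)) s d; under eq_fun do rewrite mulNr; rewrite !mulNr.
Qed.
Let is_sz s d : is_derive s d sz (sz s * lz d s).
Proof.
by have := expfun (- ((v - u) / 3)) s d; under eq_fun do rewrite mulNr; rewrite !mulNr.
Qed.

Definition D1f d s : 'rV[R]_3 := \row_(k < 3) [:: sx s * lx d s; sy s * ly d s;
  sz s * (T (s 0 0) * lz d s + dTz (s 0 0) * d 0 0)]`_k.

Definition D2f d e s : 'rV[R]_3 := \row_(k < 3)
  [:: sx s * (lx d s * lx e s + ddphi (s 0 0) / 3 * (d 0 0 * e 0 0));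
      sy s * (ly d s * ly e s + ddphi (s 0 0) / 3 * (d 0 0 * e 0 0));
      sz s * (T (s 0 0) * (lz d s * lz e s + ddphi (s 0 0) / 3 * (d 0 0 * e 0 0))
        + dTz (s 0 0) * (d 0 0 * lz e s + e 0 0 * lz d s)
        + ddT (s 0 0) * (d 0 0 * e 0 0))]`_k.

Let fE s : [/\ f s 0 0 = sx s, f s 0 1 = sy s & f s 0 2 = sz s * T (s 0 0)].
Proof. exact: sphere_mapE. Qed.

Let f_0 : (fun s => f s 0 0) = sx. Proof. by apply/funext => s; have [] := fE s. Qed.
Let f_1 : (fun s => f s 0 1) = sy. Proof. by apply/funext => s; have [] := fE s. Qed.
Let f_2 : (fun s => f s 0 2) = (fun s => sz s * T (s 0 0)).
Proof. by apply/funext => s; have [] := fE s. Qed.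

Let D1f_coord k s d : is_derive s d (fun s => f s 0 k) (D1f d s 0 k).
Proof.
move: k; apply: forall_ord3; rewrite mxE /=.
- by rewrite f_0.
- by rewrite f_1.
- rewrite f_2; apply: (is_derive_eq (is_deriveM' (is_sz s d) (zfun s d isT))); ring.
Qed.

Let is_l (k : R) s d e : is_derive s e (fun s => dphi (s 0 0) / 3 * d 0 0 + k * d 0 1)
  (ddphi (s 0 0) / 3 * (d 0 0 * e 0 0)).
Proof.
have d1 := is_deriveM' (is_deriveM' (zfun s e is_derive_dphi) (is_derive_cst' s e 3^-1)) (is_derive_cst' s e (d 0 0)).
apply: (is_derive_eq (is_deriveD' d1 (is_derive_cst' s e (k * d 0 1)))); ring.
Qed.
Let is_lx s d e : is_derive s e (lx d) (ddphi (s 0 0) / 3 * (d 0 0 * e 0 0)).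
Proof. exact: is_l. Qed.
Let is_ly s d e : is_derive s e (ly d) (ddphi (s 0 0) / 3 * (d 0 0 * e 0 0)).
Proof. by have := is_l (- ((1 + u) / 3)) s d e; under eq_fun do rewrite mulNr. Qed.
Let is_lz s d e : is_derive s e (lz d) (ddphi (s 0 0) / 3 * (d 0 0 * e 0 0)).
Proof. by have := is_l (- ((v - u) / 3)) s d e; under eq_fun do rewrite mulNr. Qed.

Let D2f_coord k s d e : is_derive s e (fun s => D1f d s 0 k) (D2f d e s 0 k).
Proof.
move: k; apply: forall_ord3; rewrite mxE /=.
- have -> : (fun s => D1f d s 0 0) = (fun s => sx s * lx d s) by apply/funext => y; rewrite mxE.
  by apply: (is_derive_eq (is_deriveM' (is_sx s e) (is_lx s d e))); ring.
- have -> : (fun s => D1f d s 0 1) = (fun s => sy s * ly d s) by apply/funext => y; rewrite mxE.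
  by apply: (is_derive_eq (is_deriveM' (is_sy s e) (is_ly s d e))); ring.
- have -> : (fun s => D1f d s 0 2) = (fun s => sz s * (T (s 0 0) * lz d s + dTz (s 0 0) * d 0 0)).
    by apply/funext => y; rewrite mxE.
  have d1 := is_deriveD' (is_deriveM' (zfun s e isT) (is_lz s d e))
     (is_deriveM' (zfun s e isdT) (is_derive_cst' s e (d 0 0))).
  by apply: (is_derive_eq (is_deriveM' (is_sz s e) d1)); ring.
Qed.

Let gens : seq ('rV[R]_2 -> R) := [:: sx; sy; sz; fun s => s 0 0; fun s => T (s 0 0);
  fun s => chi (s 0 0); fun s => (S (s 0 0))^-1; fun s => eps (s 0 0); fun s => (eps (s 0 0))^-1].
Let gen (g : 'rV[R]_2 -> R) := exists i : 'I_9, g = nth (fun=> 0) gens i.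
Let gin i : (i < 9)%N -> falg gen (nth (fun=> 0) gens i).
Proof. by move=> i9; apply: falg_gen; exists (Ordinal i9). Qed.
Let fW : falg gen (fun s => W (s 0 0)).
Proof. by apply: falg_add; [apply: falg_exp; exact: (gin (i := 3))|exact: falg_cst]. Qed.
Let fdT : falg gen (fun s => dTz (s 0 0)).
Proof.
have -> : (fun s => dTz (s 0 0)) = (fun s => L (s 0 0) * ((S (s 0 0))^-1 * (eps (s 0 0))^-1)).
  by apply/funext => s; rewrite /dTz invfM.
apply: falg_mul; last by apply: falg_mul; [exact: (gin (i := 6))|exact: (gin (i := 8))].
apply: falg_add; last exact: falg_cst.
apply: falg_add; last exact: falg_cst.
by apply: falg_mul => //; exact: falg_cst.
Qed.
Let fdphi : falg gen (fun s => dphi (s 0 0)).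
Proof. by apply: falg_mul => //; exact: (gin (i := 5)). Qed.
Let fl (k : R) d : falg gen (fun s => dphi (s 0 0) / 3 * d 0 0 + k * d 0 1).
Proof.
apply: falg_add; last exact: falg_cst.
by apply: falg_mul; [apply: falg_mul => //|]; exact: falg_cst.
Qed.
Let flx d : falg gen (lx d). Proof. exact: fl. Qed.
Let fly d : falg gen (ly d).
Proof. by have := fl (- ((1 + u) / 3)) d; under eq_fun do rewrite mulNr. Qed.
Let flz d : falg gen (lz d).
Proof. by have := fl (- ((v - u) / 3)) d; under eq_fun do rewrite mulNr. Qed.
Let fdchi : falg gen (fun s => dchiz (s 0 0)).
Proof.
apply: falg_mul; last exact: (gin (i := 6)).
apply: falg_add; first by apply: falg_mul; [exact: falg_cst|exact: (gin (i := 7))].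
apply: falg_mul; last exact: (gin (i := 8)).
apply: falg_mul; first by apply: falg_exp; exact: (gin (i := 5)).
by do 3! (apply: falg_add; last exact: falg_cst).
Qed.
Let fdS : falg gen (fun s => dS (s 0 0)).
Proof.
apply: falg_mul; last exact: (gin (i := 6)).
apply: falg_mul; first by apply: falg_mul; [exact: falg_cst|exact: (gin (i := 3))].
do 2! (apply: falg_add; last exact: falg_cst).
by apply: falg_mul => //; exact: falg_cst.
Qed.

Let coord_diff s (i : 'I_2) : differentiable (fun s : 'rV[R]_2 => s 0 i) s.
Proof. exact: differentiable_coord. Qed.

Let zdiff (g g' : R -> R) s : (forall z : R, is_derive z 1 g (g' z)) ->
  differentiable (fun s => g (s 0 0)) s.
Proof. by move=> dg; exact: (@diff_scomp _ _ (fun s => s 0 0) g s _ (dg (s 0 0)) (coord_diff s 0)). Qed.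

Let expdiff (k : R) s : differentiable (fun s => expR (phi0 (s 0 0) / 3 + k * s 0 1)) s.
Proof.
pose h s := phi0 (s 0 0) / 3 + k * s 0 1.
have dh : differentiable h s.
  apply: differentiableD; apply: differentiableM => //; exact: zdiff isphi.
exact: (@diff_scomp _ _ h expR s _ (is_derive_expR (h s)) dh).
Qed.

Let gen_derive g : gen g -> (forall s, differentiable g s) /\ forall d, falg gen ('D_d g).
Proof.
have K (h : 'rV[R]_2 -> R) (h' : 'rV[R]_2 -> 'rV[R]_2 -> R) :
    (forall s, differentiable h s) -> (forall s d, is_derive s d h (h' d s)) ->
    (forall d, falg gen (h' d)) ->
    (forall s, differentiable h s) /\ forall d, falg gen ('D_d h).
  move=> h1 h2 h3; split=> // d.
  suff -> : 'D_d h = h' d by [].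
  by apply/funext => s; have := h2 s d => h2s; exact: derive_val.
have Kz (h h' : R -> R) : (forall z : R, is_derive z 1 h (h' z)) ->
    falg gen (fun s => h' (s 0 0)) ->
    (forall s, differentiable (fun s => h (s 0 0)) s) /\
    forall d, falg gen ('D_d (fun s : 'rV[R]_2 => h (s 0 0))).
  move=> dh fh; apply: (K _ (fun d s => h' (s 0 0) * d 0 0)).
  - by move=> s; exact: zdiff dh.
  - by move=> s d; exact: zfun.
  - by move=> d; apply: falg_mul => //; exact: falg_cst.
move=> [[[|[|[|[|[|[|[|[|[|//]]]]]]]]] i] ->] /=.
- apply: (K _ (fun d s => sx s * lx d s)); [by move=> s; exact: expdiff|exact: is_sx|move=> d].
  by apply: falg_mul => //; exact: (gin (i := 0)).
- apply: (K _ (fun d s => sy s * ly d s)); [move=> s|exact: is_sy|move=> d].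
    by have := expdiff (- ((1 + u) / 3)) s; under eq_fun do rewrite mulNr.
  by apply: falg_mul => //; exact: (gin (i := 1)).
- apply: (K _ (fun d s => sz s * lz d s)); [move=> s|exact: is_sz|move=> d].
    by have := expdiff (- ((v - u) / 3)) s; under eq_fun do rewrite mulNr.
  by apply: falg_mul => //; exact: (gin (i := 2)).
- by apply: (Kz id (fun=> 1)); exact: falg_cst.
- exact: (Kz T dTz).
- exact: (Kz chi dchiz).
- apply: (Kz (fun z => (S z)^-1) (fun z => - dS z * (S z)^-1 ^+ 2)).
    by move=> z; rewrite exprVn; apply: is_deriveV' => //; rewrite gt_eqF.
  by apply: falg_mul; [exact: falg_opp|apply: falg_exp; exact: (gin (i := 6))].
- apply: (Kz eps (fun z => eps z * dphi z)) => //.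
  by apply: falg_mul => //; exact: (gin (i := 7)).
- apply: (Kz (fun z => (eps z)^-1) (fun z => - (dphi z) * (eps z)^-1)).
    move=> z; have n0 : eps z != 0 by rewrite gt_eqF.
    by apply: (is_derive_eq (is_deriveV' (iseps z) n0)); field.
  by apply: falg_mul; [exact: falg_opp|exact: (gin (i := 8))].
Qed.

Lemma smooth_sphere_map : smooth f.
Proof.
apply: (falg_smooth gen_derive); apply: forall_ord3.
- by rewrite f_0; exact: (gin (i := 0)).
- by rewrite f_1; exact: (gin (i := 1)).
- by rewrite f_2; apply: falg_mul; [exact: (gin (i := 2))|exact: (gin (i := 4))].
Qed.

Lemma differentiable_sphere_map s : differentiable f s.
Proof. by have [+ _] := smooth_sphere_map 1; apply. Qed.

Lemma derive_sphere_map d : 'D_d f = D1f d.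
Proof.
apply/funext => s; apply/rowP => k.
rewrite derive_rV; last exact: differentiable_sphere_map.
by have := D1f_coord k s d => h; exact: derive_val.
Qed.

Lemma derive2_sphere_map d e s : 'D_e ('D_d f) s = D2f d e s.
Proof.
apply/rowP => k; rewrite derive_rV; last first.
  by have [_ /(_ d)[+ _]] := smooth_sphere_map 2; apply.
have -> : (fun s => 'D_d f s 0 k) = (fun s => D1f d s 0 k).
  by apply/funext => y; rewrite -derive_sphere_map.
by have := D2f_coord k s d e => h; exact: derive_val.
Qed.

(** The gradient of [F0] at the point [f s], where the geometric mean of x and y is [sz s]. *)
Definition conormal s : 'cV[R]_3 := \col_(k < 3)
  [:: - (u * W (s 0 0) + 1) / sx s; - (v * W (s 0 0) + 1) / sy s; chi (s 0 0) / sz s]`_k.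

Definition gform d e s := (dchiz (s 0 0) * dTz (s 0 0) - dphi (s 0 0) ^+ 2 / 3) * (d 0 0 * e 0 0)
  + (v - u) / 3 * dphi (s 0 0) * (d 0 0 * e 0 1 + d 0 1 * e 0 0)
  + u * v * L (s 0 0) / 3 * (d 0 1 * e 0 1).

Let conE (w : 'rV[R]_3) s : (w *m conormal s) 0 0 =
  - (u * W (s 0 0) + 1) * (w 0 0 / sx s) - (v * W (s 0 0) + 1) * (w 0 1 / sy s)
  + chi (s 0 0) * (w 0 2 / sz s).
Proof. by rewrite mxE sum_ord3 !mxE /=; ring. Qed.

Lemma conormal_D1f d s : (D1f d s *m conormal s) 0 0 = 0.
Proof.
rewrite conE !mxE /=.
rewrite ![sx s * _]mulrC ![sy s * _]mulrC ![sz s * _]mulrC !mulfK ?gt_eqF//.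
have -> : chi (s 0 0) * (T (s 0 0) * lz d s + dTz (s 0 0) * d 0 0) =
  (chi (s 0 0) * T (s 0 0)) * lz d s + dphi (s 0 0) * d 0 0 by rewrite /dphi; ring.
rewrite chiT /lx /ly /lz vE.
by move: (dphi _) (W _) (p^-1) => A om k; field.
Qed.

(** Euler's relation for the logarithmic homogeneity of F0: the constant is minus the dimension. *)
Lemma conormal_f s : (f s *m conormal s) 0 0 = - 3.
Proof.
have [a b k] := fE s; rewrite conE a b k.
rewrite !divff ?gt_eqF// [sz s * _]mulrC mulfK ?gt_eqF// chiT vE; ring.
Qed.

Lemma conormal_D2f d e s : (D2f d e s *m conormal s) 0 0 = - gform d e s.
Proof.
rewrite conE !mxE /=.
rewrite ![sx s * _]mulrC ![sy s * _]mulrC ![sz s * _]mulrC !mulfK ?gt_eqF//.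
set a := d 0 0 * e 0 0.
have -> : chi (s 0 0) * (T (s 0 0) * (lz d s * lz e s + ddphi (s 0 0) / 3 * a) +
     dTz (s 0 0) * (d 0 0 * lz e s + e 0 0 * lz d s) + ddT (s 0 0) * a) =
  (chi (s 0 0) * T (s 0 0)) * (lz d s * lz e s + ddphi (s 0 0) / 3 * a) +
  dphi (s 0 0) * (d 0 0 * lz e s + e 0 0 * lz d s) +
  (ddphi (s 0 0) - dchiz (s 0 0) * dTz (s 0 0)) * a by rewrite /dphi /ddphi; ring.
have LE : u * v * L (s 0 0) = 3 * (u * v) * W (s 0 0) + 2 - 2 * (u * v).
  rewrite /L; have -> : u * v * (3 * W (s 0 0) + 2 * (p + q) - 2) =
    3 * (u * v) * W (s 0 0) + 2 * ((p + q) * (u * v)) - 2 * (u * v) by ring.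
  by rewrite suv mulr1.
rewrite chiT /gform LE /lx /ly /lz vE /a.
move: (ddphi _) (dphi _) (dchiz _) (dTz _) (W _) (p^-1) => A B C D om k.
by field.
Qed.

Lemma jacobian_sphere_map s i k : ('J f s) i k = D1f ('e_i) s 0 k.
Proof.
rewrite jacobian_entry; last exact: differentiable_sphere_map.
by have /(congr1 (fun g => g s)) /= -> := derive_sphere_map ('e_i).
Qed.

Let sxyz s : sx s * sy s * sz s = eps (s 0 0).
Proof.
rewrite /sx /sy /sz -!expRD; congr expR; rewrite vE.
by move: (phi0 _) (p^-1) (s 0 1) => a b m; field.
Qed.

Lemma det_sphere_map (lam : R) s :
  \det (col_mx ('J f s) (lam *: f s) : 'M[R]_3) = lam * (L (s 0 0) / S (s 0 0)).
Proof.
have i0 : 0 = lshift 1 (0 : 'I_2) :> 'I_(2 + 1) by apply: val_inj.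
have i1 : 1 = lshift 1 (1 : 'I_2) :> 'I_(2 + 1) by apply: val_inj.
have i2 : 2 = rshift 2 (0 : 'I_1) :> 'I_(2 + 1) by apply: val_inj.
have r0 k : (col_mx ('J f s) (lam *: f s)) 0 k = D1f ('e_0) s 0 k.
  by rewrite i0 col_mxEu jacobian_sphere_map.
have r1 k : (col_mx ('J f s) (lam *: f s)) 1 k = D1f ('e_1) s 0 k.
  by rewrite i1 col_mxEu jacobian_sphere_map.
have r2 k : (col_mx ('J f s) (lam *: f s)) 2 k = lam * f s 0 k.
  by rewrite i2 col_mxEd mxE.
have [a b k] := fE s.
rewrite det3 !r0 !r1 !r2 a b k !mxE /= /lx /ly /lz !mxE /=.
have -> : L (s 0 0) / S (s 0 0) = sx s * sy s * sz s * dTz (s 0 0).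
  by rewrite sxyz /dTz; field; rewrite !gt_eqF ?S0 ?E0.
rewrite vE; move: (sx s) (sy s) (sz s) (dTz _) (T _) (dphi _) (p^-1) => X Y Z t1 t ph w.
by field.
Qed.

(** Adding the position vector to the Jacobian gives an invertible matrix, and one extra row raises
    the rank by at most 1. *)
Lemma row_free_sphere_map s : row_free ('J f s).
Proof.
rewrite /row_free eqn_leq rank_leq_row /=.
have : col_mx ('J f s) (1 *: f s) \in (@unitmx R 3).
  by rewrite unitmxE det_sphere_map unitfE mul1r gt_eqF// divr_gt0.
rewrite -row_free_unit => /eqP rk.
have : (\rank (col_mx ('J f s) (1 *: f s)) <= \rank ('J f s) + \rank (1 *: f s)%R)%N.
  by rewrite -addsmxE; exact: mxrank_adds_leqif.
rewrite rk => h; rewrite -(leq_add2r 1); apply: leq_trans h _.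
by rewrite leq_add2l rank_leq_row.
Qed.

Lemma immersion_sphere_map : immersion f.
Proof. by split; [exact: smooth_sphere_map|exact: row_free_sphere_map]. Qed.

(** A rewriting of the first coefficient of [gform] whose positivity is visible, since p + q >=
    4. *)
Definition g11 z := (p + q) * L z / S z ^+ 2 + dphi z ^+ 2 * (p + q - 4) / (3 * L z).

Lemma g11E z : dchiz z * dTz z - dphi z ^+ 2 / 3 = g11 z.
Proof.
rewrite /g11 /dchiz /dphi /dTz.
have -> : L z = 3 * W z + 2 * (p + q) - 2 by [].
have n0 : 3 * W z + 2 * (p + q) - 2 != 0 by rewrite gt_eqF// L0.
by move: (W z) n0 => om n0; field; rewrite n0 !gt_eqF ?S0 ?E0.
Qed.

Lemma g11_gt0 z : 0 < g11 z.
Proof.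
have s4 := pq_ge4 p2 q1 pq.
rewrite ltr_pwDl ?divr_gt0 ?mulr_gt0 ?exprn_gt0//.
apply: divr_ge0; last by apply: mulr_ge0 => //; exact: ltW.
by apply: mulr_ge0; [exact: sqr_ge0|lra].
Qed.

Let dE s d e : gform d e s = g11 (s 0 0) * (d 0 0 * e 0 0)
  + (v - u) / 3 * dphi (s 0 0) * (d 0 0 * e 0 1 + d 0 1 * e 0 0)
  + u * v * L (s 0 0) / 3 * (d 0 1 * e 0 1).
Proof. by rewrite /gform g11E. Qed.

(** The terms in dphi^2 cancel because (p + q) u v = 1 and (v - u)^2 = 1 - 4 u v. The result is a
    constant times the square of det (f_zeta, f_mu, f). *)
Let gdet z : g11 z * (u * v * L z / 3) - ((v - u) / 3 * dphi z) ^+ 2 = L z ^+ 2 / (3 * S z ^+ 2).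
Proof.
have -> : g11 z * (u * v * L z / 3) = (p + q) * (u * v) * (L z ^+ 2 / (3 * S z ^+ 2)) +
   dphi z ^+ 2 * ((p + q) * (u * v) - 4 * (u * v)) / 9.
  by rewrite /g11; move: (u * v) => w; field; rewrite !gt_eqF ?S0 ?L0.
rewrite suv mul1r -addrA -[RHS]addr0; congr (_ + _).
by rewrite vE; move: (dphi z) (p^-1) => a b; field.
Qed.

(** Completing the square in d 0 1: the left side is the determinant divided by the other diagonal
    coefficient. [gform_ge2] is the same with the roles exchanged. *)
Lemma gform_ge1 d s : (p + q) * L (s 0 0) / S (s 0 0) ^+ 2 * d 0 0 ^+ 2 <= gform d d s.
Proof.
rewrite dE; set z := s 0 0.
have g22 : 0 < u * v * L z / 3 by rewrite divr_gt0// !mulr_gt0.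
rewrite -(ler_pM2l g22) -subr_ge0.
rewrite [X in 0 <= X](_ : _ = (u * v * L z / 3 * d 0 1 + (v - u) / 3 * dphi z * d 0 0) ^+ 2).
  exact: sqr_ge0.
have := gdet z.
have -> : L z ^+ 2 / (3 * S z ^+ 2) = (p + q) * (u * v) * (L z ^+ 2 / (3 * S z ^+ 2)).
  by rewrite suv mul1r.
move=> E.
have -> : u * v * L z / 3 * ((p + q) * L z / S z ^+ 2 * d 0 0 ^+ 2) =
  (p + q) * (u * v) * (L z ^+ 2 / (3 * S z ^+ 2)) * d 0 0 ^+ 2.
  by move: (u * v) => w; field; rewrite gt_eqF.
by rewrite -E; ring.
Qed.

Lemma gform_ge2 d s : L (s 0 0) ^+ 2 / (3 * S (s 0 0) ^+ 2) / g11 (s 0 0) * d 0 1 ^+ 2 <= gform d d s.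
Proof.
rewrite dE; set z := s 0 0; have g0 := g11_gt0 z.
rewrite -(ler_pM2l g0) -subr_ge0.
rewrite [X in 0 <= X](_ : _ = (g11 z * d 0 0 + (v - u) / 3 * dphi z * d 0 1) ^+ 2).
  exact: sqr_ge0.
have -> : g11 z * (L z ^+ 2 / (3 * S z ^+ 2) / g11 z * d 0 1 ^+ 2) =
  L z ^+ 2 / (3 * S z ^+ 2) * d 0 1 ^+ 2.
  by rewrite mulrA [g11 z * _]mulrC divfK ?gt_eqF.
by rewrite -gdet; ring.
Qed.

Lemma gform_gt0 d s : d != 0 -> 0 < gform d d s.
Proof.
move=> dn; have [d0|d0] := eqVneq (d 0 0) 0; last first.
  by apply: lt_le_trans (gform_ge1 d s); rewrite mulr_gt0 ?exprn_even_gt0// divr_gt0 ?mulr_gt0 ?exprn_gt0.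
have d1 : d 0 1 != 0.
  apply: contraNneq dn => d1; apply/eqP/rowP; by apply: forall_ord2; rewrite mxE.
apply: lt_le_trans (gform_ge2 d s); rewrite mulr_gt0 ?exprn_even_gt0//.
by rewrite !divr_gt0 ?mulr_gt0 ?exprn_gt0 ?g11_gt0.
Qed.

(* The volume condition forces [lam ^+ 4 = 1/27]. *)
Definition lam : R := Num.sqrt (Num.sqrt (27^-1)).

Lemma lam_gt0 : 0 < lam. Proof. by rewrite !sqrtr_gt0 invr_gt0. Qed.

Lemma lam4 : lam ^+ 4 = 27^-1.
Proof.
have -> : lam ^+ 4 = (lam ^+ 2) ^+ 2 by ring.
by rewrite !sqr_sqrtr ?sqrtr_ge0// invr_ge0.
Qed.

Definition affine_normal s := lam *: f s.
(** Pairing the Gauss formula with the conormal gives -g = h lam (-3), whence h = g / (3 lam). *)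
Definition affine_metric s : 'M[R]_2 := \matrix_(i, j) (gform ('e_i) ('e_j) s / (3 * lam)).

Lemma affine_metricE d s : (d *m affine_metric s *m d^T) 0 0 = gform d d s / (3 * lam).
Proof.
rewrite !mxE !sum_ord2 !mxE !sum_ord2 !mxE /gform !mxE /=.
by ring.
Qed.

Let l3 : 0 < 3 * lam. Proof. by rewrite mulr_gt0 ?lam_gt0. Qed.

Lemma jacobian_affine_normal s : 'J affine_normal s = lam *: 'J f s.
Proof. exact/jacobianZ/differentiable_sphere_map. Qed.

Lemma affine_normal_metric_sphere_map : affine_normal_metric f affine_normal affine_metric.
Proof.
move=> s; split.
- split; first by apply/matrixP => i j; rewrite !mxE /gform; congr (_ / _); ring.
  by move=> d dn; rewrite affine_metricE divr_gt0// gform_gt0.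
- have K (A B : 'M[R]_1) (g : R) : A 0 0 = - g -> B 0 0 = - 3 ->
    A - (g / (3 * lam)) *: (lam *: B) = 0.
    move=> hA hB; apply/matrixP => k l; rewrite !ord1 !mxE hA hB.
    by field; rewrite gt_eqF// lam_gt0.
  move=> i j; apply: (@submx_conormal _ _ (conormal s)).
  + exact: row_free_sphere_map.
  + apply/eqP => /matrixP/(_ 0 0)/eqP; rewrite !mxE /= mulf_eq0 oppr_eq0 invr_eq0.
    by rewrite !gt_eqF// addr_gt0// mulr_gt0.
  + apply/matrixP => k l; rewrite [RHS]mxE ord1 -[RHS](conormal_D1f 'e_k s) mxE [RHS]mxE.
    by apply: eq_bigr => m _; rewrite jacobian_sphere_map.
  + rewrite derive2_sphere_map mulmxBl -scalemxAl.
    have -> : affine_normal s *m conormal s = lam *: (f s *m conormal s) by rewrite scalemxAl.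
    have A := conormal_D2f 'e_i 'e_j s; have B := conormal_f s.
    have M : affine_metric s i j = gform 'e_i 'e_j s / (3 * lam) by rewrite mxE.
    rewrite M; exact: K.
- exact: (@differentiableZ _ _ _ f lam s (differentiable_sphere_map s)).
- by rewrite jacobian_affine_normal scalemx_sub.
- rewrite det_sphere_map det2 /= !mxE.
  have E : gform 'e_0 'e_0 s * gform 'e_1 'e_1 s - gform 'e_0 'e_1 s * gform 'e_1 'e_0 s =
      L (s 0 0) ^+ 2 / (3 * S (s 0 0) ^+ 2).
    by rewrite !dE !mxE /= -gdet; ring.
  (* The factor 1/9 is written 3/27 so that 1/27 can be exchanged for lam^4, which turns the right
     side into the squared volume. *)
  have -> : gform 'e_0 'e_0 s / (3 * lam) * (gform 'e_1 'e_1 s / (3 * lam)) -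
     gform 'e_0 'e_1 s / (3 * lam) * (gform 'e_1 'e_0 s / (3 * lam)) =
     (gform 'e_0 'e_0 s * gform 'e_1 'e_1 s - gform 'e_0 'e_1 s * gform 'e_1 'e_0 s) * (27^-1 * 3 / lam ^+ 2).
    by field; rewrite gt_eqF// lam_gt0.
  by rewrite E -lam4; field; rewrite !gt_eqF ?lam_gt0 ?S0.
Qed.

End sphere.

(** * Completeness *)

Section curves.
Context {R : realType}.
Notation mu := (@lebesgue_measure R).

(** The mechanism of completeness: a function whose rate of change along the curve is at most k
    times the speed varies by at most k times the length. *)
Lemma integral_dominates_variation (y y' l : R -> R) (k J : R) :
  (forall s : R, is_derive s 1 y (y' s)) -> continuous y' -> continuous l ->
  0 <= k -> (forall s, 0 <= l s) -> (forall s, `|y' s| <= k * l s) ->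
  (\int[mu]_(s in `[0%R, +oo[) (l s)%:E <= J%:E)%E ->
  forall t, 0 <= t -> `|y t - y 0| <= k * J.
Proof.
move=> dy cy' cl k0 l0 yl lJ t; have ml : measurable_fun setT l by exact: continuous_measurable_fun.
have J0 : 0 <= J.
  by rewrite -lee_fin; apply: le_trans lJ; apply: integral_ge0 => s _; rewrite lee_fin.
rewrite le_eqVlt => /predU1P[<-|t0]; first by rewrite subrr normr0 mulr_ge0.
have [|iy <-] := @integral_segment _ y' y 0 t t0; first by move=> *; exact: cy'.
have mS (A : set R) : measurable_fun A l by exact: measurable_funTS.
have my (A : set R) : measurable_fun A y' by apply: measurable_funTS; exact: continuous_measurable_fun.
rewrite -lee_fin; apply: le_trans (_ : (\int[mu]_(s in `[0, t]) `|y' s|)%:E <= _)%E.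
  by rewrite lee_fin; apply: le_normr_Rintegral.
have iy' : mu.-integrable `[0, t] (EFin \o (fun s => `|y' s|)).
  by have := integrable_abse iy; apply: eq_integrable.
rewrite /Rintegral fineK; last exact: integrable_fin_num.
apply: le_trans (_ : (\int[mu]_(s in `[0%R, t]) (k%:E * (l s)%:E) <= _)%E).
  apply: ge0_le_integral => //.
  - by apply/measurable_EFinP; apply: measurableT_comp; [exact: normr_measurable|exact: my].
  - have -> : (fun s => k%:E * (l s)%:E)%E = EFin \o (fun s => k * l s).
      by apply/funext => s; rewrite /= EFinM.
    apply/measurable_EFinP; apply: measurable_funTS.
    by apply: continuous_measurable_fun => s; apply: cvgMr; exact: cl.
  - by move=> s _; rewrite -EFinM lee_fin.
rewrite ge0_integralZl_EFin//; last 2 first.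
- by move=> s _; rewrite lee_fin.
- by apply/measurable_EFinP; exact: mS.
rewrite EFinM; apply: lee_pmul => //.
  by apply: integral_ge0 => s _; rewrite lee_fin.
apply: le_trans lJ; apply: ge0_subset_integral => //.
- by apply/measurable_EFinP; exact: mS.
- by move=> s _; rewrite lee_fin.
- by move=> s /=; rewrite !in_itv /= => /andP[->].
Qed.

Lemma compact_norm_le n (B : R) : compact [set s : 'rV[R]_n.+1 | `|s| <= B].
Proof.
apply: bounded_closed_compact.
  by exists B; split; [exact: num_real|move=> M BM s /= sB; rewrite (le_trans sB)// ltW].
apply: (@closed_comp _ _ (fun s : 'rV[R]_n.+1 => `|s|) [set x : R | x <= B]); last exact: closed_le.
by move=> s _; exact: norm_continuous.
Qed.

Lemma is_derive_curve n (g : R -> 'rV[R]_n) (s : R) i : derivable g s 1 ->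
  is_derive s 1 (fun s => g s 0 i) (derive1 g s 0 i).
Proof.
move=> /derivable1_diffP dg; have dgi : differentiable (fun s => g s 0 i) s.
  by apply: (@differentiable_comp _ _ _ _ g (fun w : 'rV[R]_n => w 0 i)) => //; exact: differentiable_coord.
apply: DeriveDef; first exact/derivable1_diffP.
by rewrite -(derive_rV _ _ dg) derive1E.
Qed.

Lemma norm_le_sqrt (a K l : R) : 0 <= K -> 0 <= l -> a ^+ 2 <= K * l ^+ 2 -> `|a| <= Num.sqrt K * l.
Proof.
move=> K0 l0 h; rewrite -sqrtr_sqr.
have -> : Num.sqrt K * l = Num.sqrt (K * l ^+ 2) by rewrite sqrtrM// sqrtr_sqr ger0_norm.
exact: ler_wsqrtr.
Qed.

End curves.

Section completeness.
Context {R : realType}.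
Variables (p q c x1 x2 x3 : R).
Hypothesis p2 : 2 <= p.
Hypothesis q1 : 1 < q.
Hypothesis pq : p * q = p + q.
Hypothesis c0 : c < 0.
Hypothesis x1_01 : 0 < x1 < 1.
Hypothesis x21 : x2 < x1.
Hypothesis x31 : x3 < x1.
Hypothesis e1 : x1 + x2 + x3 = 1 - p - q.
Hypothesis e2 : x1 * x2 + x1 * x3 + x2 * x3 = 0.
Hypothesis e3 : 4 * (p + q) * (x1 * x2 * x3) = 4 * (p + q) ^+ 2 - c ^+ 2.
Variables (Th : R -> R).

Notation W := (W x1).
Notation L := (L p q x1).
Notation S := (Defs.rad p q x1 x2 x3).
Notation phi0 := (phi0 p q x1 Th).
Notation eps := (eps p q x1 Th).
Notation chi := (chi p q c x1 x2 x3 Th).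
Notation T := (T p q c x1 x2 x3 Th).
Notation dphi := (dphi p q c x1 x2 x3 Th).
Notation g11 := (g11 p q c x1 x2 x3 Th).
Notation gform := (gform p q c x1 x2 x3 Th).
Notation metric := (affine_metric p q c x1 x2 x3 Th).
Hypothesis dTh : forall z : R, is_derive z 1 Th (theta p q c x1 x2 x3 z).

Let W0 z : 0 < W z := W_gt0 x1_01 z.
Let L0 z : 0 < L z := L_gt0 p2 q1 pq x1_01 z.
Let S0 z : 0 < S z := S_gt0 p2 q1 x21 x31 z.
Let s0 : 0 < p + q := sum_gt0 p2 q1 pq.
Let E0 z : 0 < eps z := eps_gt0 p q x1 Th z.
Let l3 : 0 < 3 * @lam R. Proof. by rewrite mulr_gt0 ?lam_gt0. Qed.

Let L_ge z : 3 * (1 + z ^+ 2) <= L z.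
Proof. by have := pq_ge4 p2 q1 pq; case/andP: x1_01 => h _ h'; rewrite /L /W; lra. Qed.

Let L_ge3 z : 3 <= L z.
Proof. by apply: le_trans (L_ge z); have := sqr_ge0 z; lra. Qed.

(** S^2 is at most a constant times (1 + z^2)^2 and L is at least 3 (1 + z^2), so the lower bound of
    [gform_ge1] is of order 1/(1 + z^2). *)
Lemma gform_zeta_bound : exists2 K, 0 <= K & forall (d s : 'rV[R]_2),
  d 0 0 ^+ 2 <= K * (1 + s 0 0 ^+ 2) * gform d d s.
Proof.
exists ((1 + x1 - x2) * (1 + x1 - x3) / 3) => [|d s].
  by rewrite divr_ge0// mulr_ge0//; move: x21 x31; lra.
set z := s 0 0; have z0 := sqr_ge0 z; have z1 : 0 < 1 + z ^+ 2 by rewrite ltr_pwDl.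
have n2 : 0 < z ^+ 2 + x1 - x2 by move: x21; lra.
have n3 : 0 < z ^+ 2 + x1 - x3 by move: x31; lra.
have m2 : z ^+ 2 + x1 - x2 <= (1 + x1 - x2) * (1 + z ^+ 2) by move: x21; nra.
have m3 : z ^+ 2 + x1 - x3 <= (1 + x1 - x3) * (1 + z ^+ 2) by move: x31; nra.
have SE : S z ^+ 2 = (p + q) * (z ^+ 2 + x1 - x2) * (z ^+ 2 + x1 - x3).
  by rewrite sqr_sqrtr// !mulr_ge0// ltW.
have : (p + q) * L z / S z ^+ 2 * d 0 0 ^+ 2 <= gform d d s by exact: gform_ge1.
rewrite SE.
have -> : (p + q) * L z / ((p + q) * (z ^+ 2 + x1 - x2) * (z ^+ 2 + x1 - x3)) =
  L z / ((z ^+ 2 + x1 - x2) * (z ^+ 2 + x1 - x3)) by field; rewrite !gt_eqF.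
move=> h; have k0 : 0 <= (1 + x1 - x2) * (1 + x1 - x3) / 3 * (1 + z ^+ 2).
  by rewrite mulr_ge0 ?(ltW z1)// divr_ge0// mulr_ge0//; move: x21 x31; lra.
apply: le_trans (ler_wpM2l k0 h).
rewrite mulrA -[X in X <= _]mul1r; apply: ler_wpM2r; first exact: sqr_ge0.
rewrite mulrA ler_pdivlMr ?mulr_gt0// mul1r.
apply: (@le_trans _ _ (((1 + x1 - x2) * (1 + z ^+ 2)) * ((1 + x1 - x3) * (1 + z ^+ 2)))).
  by apply: ler_pM => //; exact: ltW.
have -> : (1 + x1 - x2) * (1 + z ^+ 2) * ((1 + x1 - x3) * (1 + z ^+ 2)) =
   (1 + x1 - x2) * (1 + x1 - x3) / 3 * (1 + z ^+ 2) * (3 * (1 + z ^+ 2)) by field.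
by apply: ler_wpM2l.
Qed.

(** [chi_sqr_le] bounds g11 by a constant times L / S^2, so the coefficient in [gform_ge2] is at
    least a constant times L, and L >= 3. *)
Lemma gform_mu_bound : exists2 K, 0 <= K & forall (d s : 'rV[R]_2),
  d 0 1 ^+ 2 <= K * gform d d s.
Proof.
have [C C0 chiC] : exists2 C, 0 <= C & forall z, chi z ^+ 2 <= C * eps z ^+ 2.
  exact: chi_sqr_le.
exists ((p + q) * (1 + C)) => [|d s]; first by apply: mulr_ge0; [exact: ltW|exact: addr_ge0].
set z := s 0 0; have g0 : 0 < g11 z by exact: g11_gt0.
have k0 : 0 <= (p + q) * (1 + C) by apply: mulr_ge0; [exact: ltW|exact: addr_ge0].
have h : L z ^+ 2 / (3 * S z ^+ 2) / g11 z * d 0 1 ^+ 2 <= gform d d s by exact: gform_ge2.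
apply: le_trans (ler_wpM2l k0 h); rewrite -/z.
rewrite mulrA -[X in X <= _]mul1r; apply: ler_wpM2r; first exact: sqr_ge0.
rewrite mulrA ler_pdivlMr// mul1r.
have ce : chi z ^+ 2 / eps z ^+ 2 <= C by rewrite ler_pdivrMr ?exprn_gt0.
have S2 : 0 < S z ^+ 2 by rewrite exprn_gt0.
have -> : g11 z = L z / S z ^+ 2 * ((p + q) + chi z ^+ 2 / eps z ^+ 2 * ((p + q - 4) / 3)).
  rewrite /g11 /dphi /dTz; field.
  by rewrite !gt_eqF ?S0 ?L0 ?E0.
have -> : (p + q) * (1 + C) * (L z ^+ 2 / (3 * S z ^+ 2)) =
   L z / S z ^+ 2 * ((p + q) * (1 + C) * (L z / 3)) by field; rewrite gt_eqF.
apply: ler_wpM2l; first by rewrite divr_ge0 ?ltW.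
have s4 := pq_ge4 p2 q1 pq.
apply: (@le_trans _ _ ((p + q) * (1 + C))).
  rewrite mulrDr mulr1 lerD2l.
  apply: (@le_trans _ _ (C * ((p + q - 4) / 3))).
    by apply: ler_wpM2r => //; lra.
  by rewrite mulrC; apply: ler_wpM2r => //; lra.
rewrite -[X in X <= _]mulr1; apply: ler_wpM2l => //.
by have := L_ge3 z; lra.
Qed.

(** A curve of finite length would have bounded coordinates and so stay in a compact ball, contrary
    to its leaving all compact sets. *)
Lemma complete_affine_metric : complete_metric metric.
Proof.
move=> g dg cg leave; apply: contrapT => fin.
pose l (s : R) := Num.sqrt ((derive1 g s *m metric (g s) *m (derive1 g s)^T) 0 0).
have lE s : l s = Num.sqrt (gform (derive1 g s) (derive1 g s) (g s) / (3 * @lam R)).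
  by rewrite /l affine_metricE.
have l0 s : 0 <= l s by exact: sqrtr_ge0.
have l2 s : gform (derive1 g s) (derive1 g s) (g s) = 3 * @lam R * l s ^+ 2.
  rewrite lE sqr_sqrtr; first by field; rewrite gt_eqF// lam_gt0.
  rewrite divr_ge0 ?(ltW l3)//; have [->|dn] := eqVneq (derive1 g s) 0.
    by rewrite /gform !mxE !(mulr0, mul0r, addr0).
  exact/ltW/gform_gt0.
have dz i (s : R) := is_derive_curve i (dg s).
have cz i : continuous (fun s => g s 0 i) by move=> s; exact: is_derive_continuous (dz i s).
have cz' i : continuous (fun s => derive1 g s 0 i).
  move=> s; apply: (@continuous_comp _ _ _ (derive1 g) (fun w : 'rV[R]_2 => w 0 i)); first exact: cg.
  exact: coord_continuous.
have comp (h : R -> R) : continuous h -> continuous (fun s => h (g s 0 0)).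
  by move=> ch s; apply: (@continuous_comp _ _ _ (fun s => g s 0 0) h); [exact: cz|exact: ch].
have comp2 (F h : R -> R) : continuous F -> continuous h -> continuous (fun s => h (F s)).
  by move=> cF ch s; apply: (@continuous_comp _ _ _ F h); [exact: cF|exact: ch].
have cdphi : continuous dphi.
  move=> z; have d : is_derive z 1 dphi (ddphi p q c x1 x2 x3 Th z) by exact: is_derive_dphi.
  exact: is_derive_continuous d.
have cL : continuous L.
  move=> z; have dL : is_derive z 1 L _ := is_deriveB' (is_deriveD' (is_deriveM' (is_derive_cst' z 1 3) (is_derive_W x1 z))
    (is_derive_cst' z 1 (2 * (p + q)))) (is_derive_cst' z 1 2).
  exact: is_derive_continuous dL.
have cS : continuous S by move=> z; apply: is_derive_continuous (is_derive_S p2 q1 x21 x31 z).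
have cM (h k : R -> R) : continuous h -> continuous k -> continuous (fun s => h s * k s).
  by move=> ch ck s; exact: cvgM (ch s) (ck s).
have cA (h k : R -> R) : continuous h -> continuous k -> continuous (fun s => h s + k s).
  by move=> ch ck s; exact: cvgD (ch s) (ck s).
have cV (h : R -> R) : continuous h -> (forall s, 0 < h s) -> continuous (fun s => (h s)^-1).
  by move=> ch h0 s; apply: cvgV; [rewrite gt_eqF|exact: ch].
have cC (a : R) : continuous ((fun=> a) : R -> R) by exact: cst_continuous.
have cX (h : R -> R) : continuous h -> continuous (fun s => h s ^+ 2).
  by move=> ch; under eq_fun do rewrite expr2; exact: cM.
have cg11 : continuous g11.
  apply: (cA _ _).
    by apply: (cM _ _); [exact: cM|apply: (cV _); [exact: cX|by move=> s; rewrite exprn_gt0]].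
  apply: (cM _ _); first by apply: (cM _ _) => //; exact: cX.
  by apply: (cV _); [exact: cM|by move=> s; rewrite mulr_gt0].
have cl : continuous l.
  have -> : l = (fun s => Num.sqrt ((g11 (g s 0 0) * (derive1 g s 0 0 * derive1 g s 0 0) +
      (q^-1 - p^-1) / 3 * dphi (g s 0 0) * (derive1 g s 0 0 * derive1 g s 0 1 + derive1 g s 0 1 * derive1 g s 0 0)
      + p^-1 * q^-1 * L (g s 0 0) / 3 * (derive1 g s 0 1 * derive1 g s 0 1)) * (3 * @lam R)^-1)).
    apply/funext => s; rewrite lE /gform g11E//.
  apply: (comp2 _ Num.sqrt); last exact: sqrt_continuous.
  apply: (cM _ _) => //; apply: (cA _ _); first apply: (cA _ _).
  - by apply: (cM _ _); [exact: comp|exact: cM].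
  - apply: (cM _ _); first by apply: (cM _ _) => //; exact: comp.
    by apply: (cA _ _); exact: cM.
  - apply: (cM _ _); last exact: cM.
    by apply: (cM _ _) => //; apply: (cM _ _) => //; exact: comp.
have [J lJ] : exists J : R, (\int[@lebesgue_measure R]_(s in `[0%R, +oo[) (l s)%:E <= J%:E)%E.
  have : (0 <= \int[@lebesgue_measure R]_(s in `[0%R, +oo[) (l s)%:E)%E.
    by apply: integral_ge0 => s _; rewrite lee_fin.
  move: fin; rewrite -/l; case: (integral _ _ _) => [r _ _| |] //; by exists r.
have [K1 K10 h1] := gform_zeta_bound; have [K2 K20 h2] := gform_mu_bound.
pose z s := g s 0 0; pose z' s := derive1 g s 0 0.
have q0 s : 0 < 1 + z s ^+ 2 by rewrite ltr_pwDl// sqr_ge0.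
(* ln (1 + zeta^2) is proper in zeta, and its derivative 2 zeta zeta' / (1 + zeta^2) is dominated by
   the speed, since the metric controls d zeta^2 / (1 + zeta^2). *)
have dy1 (s : R) : is_derive s 1 (fun s => ln (1 + z s ^+ 2)) (2 * z s * z' s * (1 + z s ^+ 2)^-1).
  apply: (is_derive_eq (is_derive_ln' (is_deriveD' (is_derive_cst' s 1 1) (is_deriveX' 1 (dz 0 s))) (q0 s))).
  by rewrite -/(z s) -/(z' s); field; rewrite gt_eqF.
have b1 t : 0 <= t -> `|ln (1 + z t ^+ 2) - ln (1 + z 0 ^+ 2)| <= Num.sqrt (4 * K1 * (3 * @lam R)) * J.
  apply: (integral_dominates_variation dy1 _ cl _ l0 _ lJ).
  - apply: (cM _ _); last by apply: (cV _ _ q0); exact: (cA _ _ (cC 1) (cX _ (cz 0))).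
    exact: (cM _ _ (cM _ _ (cC 2) (cz 0)) (cz' 0)).
  - exact: sqrtr_ge0.
  - move=> s; apply: norm_le_sqrt => //; first by apply: mulr_ge0; [exact: mulr_ge0|exact: ltW].
    have := h1 (derive1 g s) (g s); rewrite l2 -/(z s) -/(z' s) => h.
    rewrite exprMn exprVn ler_pdivrMr ?exprn_gt0//.
    apply: (@le_trans _ _ (4 * (1 + z s ^+ 2) * (K1 * (1 + z s ^+ 2) * (3 * @lam R * l s ^+ 2)))).
      have -> : (2 * z s * z' s) ^+ 2 = 4 * z s ^+ 2 * z' s ^+ 2 by ring.
      apply: ler_pM; [by apply: mulr_ge0; last exact: sqr_ge0|exact: sqr_ge0| |exact: h].
      by rewrite ler_pM2l// lerDr.
    by rewrite le_eqVlt; apply/orP; left; apply/eqP; ring.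
have b2 t : 0 <= t -> `|g t 0 1 - g 0 0 1| <= Num.sqrt (K2 * (3 * @lam R)) * J.
  apply: (integral_dominates_variation (dz 1) _ cl _ l0 _ lJ) => //.
  move=> s; apply: norm_le_sqrt => //; first by apply: mulr_ge0 => //; exact: ltW.
    by have := h2 (derive1 g s) (g s); rewrite l2 mulrA.
set B1 := Num.sqrt (4 * K1 * (3 * @lam R)) * J in b1.
set B2 := Num.sqrt (K2 * (3 * @lam R)) * J in b2.
(* The first summand bounds 1 + zeta^2, hence |zeta|; the second bounds |mu|. *)
pose B := expR (ln (1 + z 0 ^+ 2) + B1) + (`|g 0 0 1| + B2).
have b t : 0 <= t -> `|g t| <= B.
  move=> t0; have B20 : 0 <= B2 by apply: le_trans (b2 _ t0).
  have B0 : 0 <= `|g 0 0 1| + B2 by rewrite addr_ge0.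
  apply: norm_rV_le; first by rewrite addr_ge0 ?expR_ge0.
  apply: forall_ord2.
  - have h : 1 + z t ^+ 2 <= expR (ln (1 + z 0 ^+ 2) + B1).
      rewrite -[X in X <= _]lnK ?posrE// ler_expR.
      by have := b1 _ t0; rewrite ler_norml => /andP[_]; lra.
    apply: (@le_trans _ _ (1 + z t ^+ 2)); last by rewrite /B; lra.
    by rewrite -/(z t) ler_norml; apply/andP; split; have := sqr_ge0 (z t - 1); have := sqr_ge0 (z t + 1); nra.
  - have := b2 _ t0; have := expR_ge0 (ln (1 + z 0 ^+ 2) + B1); rewrite /B.
    by have := ler_normD (g t 0 1 - g 0 0 1) (g 0 0 1); rewrite subrK; lra.
have /= nC := leave _ (@compact_norm_le _ 1 B).
near (+oo : set_system R) => t.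
have t0 : 0 <= t by near: t; exact: nbhs_pinfty_ge.
have : ~ (`|g t| <= B) by near: t.
by apply; exact: b.
Unshelve. all: by end_near. Qed.

End completeness.

(** * Convex hull and asymptotics *)

Lemma is_derive_line (R : realType) (V : normedModType R) (F : V -> R) (y v : V) (t d : R) :
  is_derive (y + t *: v) v F d -> is_derive t 1 (fun s : R => F (y + s *: v)) d.
Proof.
move=> /is_derive_lineP dF.
have -> : (fun s : R => F (y + s *: v)) = (fun r : R => F (r *: v + (y + t *: v))) \o (fun s => s - t).
  by apply/funext => s /=; congr F; rewrite scalerBl [y + t *: v]addrC addrA subrK addrC.
have ds : is_derive t 1 (fun s : R => s - t) 1.
  by apply: (is_derive_eq (is_deriveB' (is_derive_id' t) (is_derive_cst' t 1 t))); rewrite subr0.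
have dF' : is_derive (t - t) 1 (fun r : R => F (r *: v + (y + t *: v))) d by rewrite subrr.
have := @is_derive_scomp R R (fun s => s - t) (fun r => F (r *: v + (y + t *: v))) t 1 d 1 dF' ds.
by rewrite mulr1.
Qed.

Section convexity.
Context {R : realType}.

(** The mean slopes over [0, k] and [k, 1] are values of g1 at ordered points, and g1 is
    nondecreasing by a third use of the mean value theorem. *)
Lemma convex_on_unit_interval (g g1 g2 : R -> R) (k : R) :
  (forall t : R, 0 <= t <= 1 -> is_derive t (1 : R) g (g1 t)) ->
  (forall t : R, 0 <= t <= 1 -> is_derive t (1 : R) g1 (g2 t)) ->
  (forall t : R, 0 <= t <= 1 -> 0 <= g2 t) ->
  0 <= k <= 1 -> g k <= k * g 1 + (1 - k) * g 0.
Proof.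
move=> dg dg1 g20 /andP[k0 k1].
have [a /andP[a0 ak] Ea] : exists2 a, 0 <= a <= k & g k - g 0 = g1 a * (k - 0).
  by apply: is_derive_MVT => // z /andP[z0 zk]; apply: dg; rewrite z0 (le_trans zk).
have [b /andP[kb b1] Eb] : exists2 b, k <= b <= 1 & g 1 - g k = g1 b * (1 - k).
  by apply: is_derive_MVT => // z /andP[z0 zk]; apply: dg; rewrite zk (le_trans k0).
have ab : a <= b := le_trans ak kb.
have [m /andP[am mb] Em] : exists2 m, a <= m <= b & g1 b - g1 a = g2 m * (b - a).
  by apply: is_derive_MVT => // z /andP[z0 zk]; apply: dg1; rewrite (le_trans a0 z0) (le_trans zk b1).
have h : g1 a <= g1 b.
  rewrite -subr_ge0 Em mulr_ge0 ?subr_ge0//; apply: g20.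
  by rewrite (le_trans a0 am) (le_trans mb b1).
have h2 : k * (1 - k) * g1 a <= k * (1 - k) * g1 b.
  by apply: ler_wpM2l => //; rewrite mulr_ge0// subr_ge0.
have E1 : (1 - k) * (g k - g 0) = k * (1 - k) * g1 a by rewrite Ea; ring.
have E2 : k * (g 1 - g k) = k * (1 - k) * g1 b by rewrite Eb; ring.
by move: h2; rewrite -E1 -E2; lra.
Qed.

End convexity.

Section cone_geometry.
Context {R : realType}.
Variables (p q al : R).
Hypothesis p0 : 0 < p.
Hypothesis q0 : 0 < q.
Hypothesis upq : p^-1 + q^-1 = 1.
Hypothesis al01 : 0 < al <= 1.
Notation U := (cone_int p q al).
Notation K := (cone p q al).
Notation gm := (gmean p q).

Let al0 : 0 < al. Proof. by case/andP: al01. Qed.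

(** An infimum of linear forms is concave. *)
Lemma gmean_concave k x y x' y' : 0 <= k <= 1 -> 0 <= x -> 0 <= y -> 0 <= x' -> 0 <= y' ->
  k * gm x y + (1 - k) * gm x' y' <= gm (k * x + (1 - k) * x') (k * y + (1 - k) * y').
Proof.
move=> /andP[k0 k1] x0 y0 x0' y0'; have k1' : 0 <= 1 - k by rewrite subr_ge0.
apply: (young_form_le_gmean p0 q0 upq) => [||s]; rewrite ?addr_ge0 ?mulr_ge0//.
have -> : young_form p q s (k * x + (1 - k) * x') (k * y + (1 - k) * y') =
  k * young_form p q s x y + (1 - k) * young_form p q s x' y' by rewrite /young_form; ring.
by apply: lerD; apply: ler_wpM2l => //; exact: gmean_le_young_form.
Qed.

Lemma cone_int_segment x y k : 0 <= k <= 1 -> U x -> U y -> U (y + k *: (x - y)).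
Proof.
move=> k01 [a0 b0 /andP[h1 h2]] [a0' b0' /andP[h1' h2']]; have /andP[k0 k1] := k01.
have E i : (y + k *: (x - y)) 0 i = k * x 0 i + (1 - k) * y 0 i by rewrite !mxE; ring.
have k1' : 0 <= 1 - k by rewrite subr_ge0.
have pos (a b : R) : 0 < a -> 0 < b -> 0 < k * a + (1 - k) * b.
  move=> a_gt b_gt; have [->|kn] := eqVneq k 0; first by rewrite mul0r add0r subr0 mul1r.
  have kp : 0 < k by rewrite lt_neqAle eq_sym kn.
  by rewrite ltr_pwDl ?mulr_gt0// mulr_ge0// ltW.
have g := gmean_concave k01 (ltW a0) (ltW b0) (ltW a0') (ltW b0').
rewrite /cone_int /= !E; split; [exact: pos|exact: pos|].
move: g; set G := gm (_ + _) _ => g.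
have s1 : 0 < k * (gm (x 0 0) (x 0 1) - x 0 2) + (1 - k) * (gm (y 0 0) (y 0 1) - y 0 2).
  by apply: pos; rewrite subr_gt0.
have s2 : 0 < k * (x 0 2 + al * gm (x 0 0) (x 0 1)) + (1 - k) * (y 0 2 + al * gm (y 0 0) (y 0 1)).
  by apply: pos; [move: h1|move: h1']; rewrite mulNr -subr_gt0 opprK.
have ag := ler_wpM2l (ltW al0) g.
by apply/andP; split; move: s1 s2 ag; lra.
Qed.

Lemma row3E (a b d : R) : [/\ (\row_(i < 3) [:: a; b; d]`_i) 0 0 = a,
  (\row_(i < 3) [:: a; b; d]`_i) 0 1 = b & (\row_(i < 3) [:: a; b; d]`_i) 0 2 = d].
Proof. by rewrite !mxE. Qed.

Lemma cone_boundary_row a b d : 0 <= a -> 0 <= b ->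
  d = gm a b \/ d = - al * gm a b -> boundary K (\row_(i < 3) [:: a; b; d]`_i).
Proof.
move=> a0 b0 h; have [E0 E1 E2] := row3E a b d; have g0 := gmean_ge0 p q a b.
apply: boundary_coneI => //.
  apply/coneE; rewrite E0 E1 E2; split=> //.
  by case: h => ->; rewrite lexx ?andbT//= ?(le_trans _ g0)// mulNr oppr_le0 mulr_ge0// ltW.
move=> [_ _]; rewrite E0 E1 E2.
by case: h => ->; rewrite ltxx ?andbF.
Qed.

(** Only x is lowered, with y and z kept, until the geometric mean drops to [k]: this is z on the
    upper face and -z/al on the lower one. The displacement is at most x. *)
Lemma cone_boundary_x w : U w -> exists b, boundary K b /\ `|w - b| <= w 0 0.
Proof.
move=> [x0 y0 /andP[h1 h2]].
pose k := if 0 <= w 0 2 then w 0 2 else - w 0 2 / al.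
have k0 : 0 <= k.
  rewrite /k; case: ifPn => //; rewrite -ltNge => z0.
  by rewrite divr_ge0 ?oppr_ge0 ?ltW.
have kg : k <= gm (w 0 0) (w 0 1).
  rewrite /k; case: ifPn => [_|_]; first exact: ltW.
  by rewrite ler_pdivrMr// lerNl; move: h1; rewrite mulNr [al * _]mulrC => /ltW.
pose x' := (k / (w 0 1 `^ q^-1)) `^ p.
have yv : 0 < w 0 1 `^ q^-1 by exact: powR_gt0.
have gE : gm x' (w 0 1) = k.
  rewrite /gmean /x' -powRrM divff ?gt_eqF// (powRr1 (divr_ge0 k0 (ltW yv))).
  by rewrite divfK ?gt_eqF.
have x'0 : 0 <= x' by exact: powR_ge0.
have xx : x' <= w 0 0.
  rewrite leNgt; apply/negP => lt.
  have : gm (w 0 0) (w 0 1) < gm x' (w 0 1).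
    rewrite /gmean ltr_pM2r//; apply: gt0_ltr_powR => //; rewrite ?invr_gt0// nnegrE//.
    exact: ltW.
  by rewrite gE ltNge kg.
exists (\row_(i < 3) [:: x'; w 0 1; w 0 2]`_i); split.
  apply: cone_boundary_row => //; first exact: ltW.
  rewrite gE /k; case: ifPn => _; first by left.
  by right; field; rewrite gt_eqF.
apply: norm_rV_le; first exact: ltW.
apply: forall_ord3; rewrite !mxE /= ?subrr ?normr0 ?(ltW x0)//.
by rewrite ger0_norm ?subr_ge0// gerBl.
Qed.

Lemma cone_boundary_y w : U w -> exists b, boundary K b /\ `|w - b| <= w 0 1.
Proof.
move=> [x0 y0 /andP[h1 h2]].
pose k := if 0 <= w 0 2 then w 0 2 else - w 0 2 / al.
have k0 : 0 <= k.
  rewrite /k; case: ifPn => //; rewrite -ltNge => z0.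
  by rewrite divr_ge0 ?oppr_ge0 ?ltW.
have kg : k <= gm (w 0 0) (w 0 1).
  rewrite /k; case: ifPn => [_|_]; first exact: ltW.
  by rewrite ler_pdivrMr// lerNl; move: h1; rewrite mulNr [al * _]mulrC => /ltW.
pose y' := (k / (w 0 0 `^ p^-1)) `^ q.
have xv : 0 < w 0 0 `^ p^-1 by exact: powR_gt0.
have gE : gm (w 0 0) y' = k.
  rewrite /gmean /y' -powRrM divff ?gt_eqF// (powRr1 (divr_ge0 k0 (ltW xv))).
  by rewrite mulrC divfK ?gt_eqF.
have y'0 : 0 <= y' by exact: powR_ge0.
have yy : y' <= w 0 1.
  rewrite leNgt; apply/negP => lt.
  have : gm (w 0 0) (w 0 1) < gm (w 0 0) y'.
    rewrite /gmean ltr_pM2l//; apply: gt0_ltr_powR => //; rewrite ?invr_gt0// nnegrE//.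
    exact: ltW.
  by rewrite gE ltNge kg.
exists (\row_(i < 3) [:: w 0 0; y'; w 0 2]`_i); split.
  apply: cone_boundary_row => //; first exact: ltW.
  rewrite gE /k; case: ifPn => _; first by left.
  by right; field; rewrite gt_eqF.
apply: norm_rV_le; first exact: ltW.
apply: forall_ord3; rewrite !mxE /= ?subrr ?normr0 ?(ltW y0)//.
by rewrite ger0_norm ?subr_ge0// gerBl.
Qed.

End cone_geometry.

(** * Separation of the convex hull from the origin, and asymptotics of the sphere *)

Section sphere_geometry.
Context {R : realType}.
Variables (p q c x1 x2 x3 : R).
Hypothesis p2 : 2 <= p.
Hypothesis q1 : 1 < q.
Hypothesis pq : p * q = p + q.
Hypothesis c0 : c < 0.
Hypothesis x1_01 : 0 < x1 < 1.
Hypothesis x21 : x2 < x1.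
Hypothesis x31 : x3 < x1.
Hypothesis e1 : x1 + x2 + x3 = 1 - p - q.
Hypothesis e2 : x1 * x2 + x1 * x3 + x2 * x3 = 0.
Hypothesis e3 : 4 * (p + q) * (x1 * x2 * x3) = 4 * (p + q) ^+ 2 - c ^+ 2.
Variables (Th : R -> R) (la : R).

Notation phi0 := (phi0 p q x1 Th).
Notation eps := (eps p q x1 Th).
Notation T := (T p q c x1 x2 x3 Th).
Notation al := (expR la).
Notation U := (cone_int p q al).
Notation K := (cone p q al).
Notation F0 := (F0 p q c x1 x2 x3 Th).
Notation zeta := (zeta p q c x1 x2 x3 Th).
Notation gm := (gmean p q).
Notation f := (sphere_map p q T phi0).

Hypothesis dTh : forall z : R, is_derive z 1 Th (theta p q c x1 x2 x3 z).
Hypothesis Th_y : Th z @[z --> +oo] --> 0.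
Hypothesis Th_Ny : Th z @[z --> -oo] --> la.

Let P0 : 0 < p := p_gt0 p2.
Let Q0 : 0 < q := q_gt0 q1.
Let uv1 : p^-1 + q^-1 = 1. Proof. by have [] := inv_pq p2 q1 pq. Qed.
Let al0 : 0 < al := expR_gt0 la.
Let al1 : al < 1. Proof. by rewrite expR_lt1; exact: (la_lt0 p2 q1 pq c0 x1_01 x21 x31 dTh Th_y Th_Ny). Qed.
Let al01 : 0 < al <= 1. Proof. by rewrite al0 (ltW al1). Qed.
Let T1 z : T z < 1. Proof. exact: T_lt1. Qed.
Let Tal z : - al < T z. Proof. exact: T_gt. Qed.
Let UE : interior K = U. Proof. exact: interior_cone. Qed.

Let Ck2 : Ck_on U 2 F0.
Proof. exact: Ck_F0. Qed.
Let pd w : U w -> posdefmx (Hessian F0 w).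
Proof. exact: posdef_F0. Qed.
Let hom (l : R) w : 0 < l -> U w -> F0 (l *: w) = F0 w - 3%:R * ln l.
Proof. exact: F0_homog. Qed.
Let lev : range f = [set x | U x /\ F0 x = 0].
Proof.
have E : [set x | interior K x /\ F0 x = 0] = range f by exact: level_set_F0.
by rewrite -E UE.
Qed.

Lemma F0_convex x y k : 0 <= k <= 1 -> U x -> U y ->
  F0 (y + k *: (x - y)) <= k * F0 x + (1 - k) * F0 y.
Proof.
move=> k01 Ux Uy; set v := x - y.
have seg t : 0 <= t <= 1 -> U (y + t *: v) by move=> t01; exact: cone_int_segment.
have [dF dF2] := Ck2.
have oU : open U by exact: open_cone_int.
have h1 (t : R) : 0 <= t <= 1 -> is_derive t (1 : R) (fun s => F0 (y + s *: v)) ('D_v F0 (y + t *: v)).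
  by move=> /seg Ut; apply: is_derive_along; exact: dF.
have h2 (t : R) : 0 <= t <= 1 -> is_derive t (1 : R) (fun s => 'D_v F0 (y + s *: v))
    (qform (Hessian F0 (y + t *: v)) v).
  move=> /seg Ut.
  have H : is_derive (y + t *: v) v ('D_v F0) (qform (Hessian F0 (y + t *: v)) v).
    apply: (@derive2_Hessian _ _ U) => // i.
    by have [+ _] := dF2 ('e_i); apply.
  exact: is_derive_line H.
have h3 (t : R) : 0 <= t <= 1 -> 0 <= qform (Hessian F0 (y + t *: v)) v.
  move=> /seg /pd[_ pv]; have [->|vn] := eqVneq v 0; last exact/ltW/pv.
  by rewrite /qform mul0mx mul0mx mxE.
have := convex_on_unit_interval h1 h2 h3 k01.
have E : y + v = x by rewrite /v addrC subrK.
by rewrite scale1r scale0r addr0 E.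
Qed.

(** The sublevel set F0 <= 0 inside the cone is convex and contains the sphere, hence contains its
    hull. *)
Lemma conv_hull_sphere y : conv_hull (range f) y -> U y /\ F0 y <= 0.
Proof.
apply: (@smallest_sub _ _ _ [set y | U y /\ F0 y <= 0]).
  move=> a b k; rewrite !inE => -[Ua Fa] [Ub Fb].
  have k01 : 0 <= k%:num <= 1 by apply/andP; split.
  have E : (conv k (a : convex_lmodType 'rV[R]_3) b : 'rV[R]_3) = b + k%:num *: (a - b).
    have Ei i : (conv k (a : convex_lmodType 'rV[R]_3) b : 'rV[R]_3) 0 i =
      k%:num * a 0 i + (1 - k%:num) * b 0 i by rewrite /conv /= !mxE.
    by apply/rowP => i; rewrite Ei !mxE; ring.
  rewrite E; split; first exact: cone_int_segment.
  apply: le_trans (F0_convex k01 Ua Ub) _; have /andP[k0 k1] := k01.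
  by rewrite -[leRHS]addr0; apply: lerD; rewrite mulr_ge0_le0// subr_ge0.
by rewrite lev => y' [Uy Fy]; split=> //; rewrite Fy.
Qed.

Lemma sphere_sub_hull y : range f y -> conv_hull (range f) y.
Proof. by move=> My; apply: sub_gen_smallest. Qed.

Lemma hull_zero : ~ conv_hull (range f) 0.
Proof. by move=> /conv_hull_sphere[/cone_int0]. Qed.

Lemma hull_separation y : conv_hull (range f) y -> exists s : R, 0 < s <= 1 /\ range f (s *: y).
Proof.
move=> /conv_hull_sphere[Uy Fy]; have e0 : 0 < expR (F0 y / 3) by exact: expR_gt0.
(* The dilation that brings F0 to 0, since F0 (l y) = F0 y - 3 ln l; it is at most 1 because F0 y <=
   0. *)
exists (expR (F0 y / 3)); split.
  by rewrite e0 -expR0 ler_expR mulr_le0_ge0.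
rewrite lev; split; first exact: cone_int_scale.
by rewrite hom// expRK; field.
Qed.

(** Moving from the sphere towards the origin makes F0 positive, so points outside the hull lie
    arbitrarily close. *)
Lemma sphere_sub_boundary_hull : range f `<=` boundary (conv_hull (range f)).
Proof.
move=> y My; split; first by apply: subset_closure; exact: sphere_sub_hull.
move=> yi; have My' := My; rewrite lev in My'; have [Uy Fy] := My'.
have cv : y - e *: y @[e --> (0 : R)] --> y - 0 *: y.
  by apply: cvgB; [exact: cvg_cst|apply: cvgZl; exact: cvg_id].
rewrite scale0r subr0 in cv; have /nbhs_ballP[e /= e0 H] := cv _ yi.
pose r := Num.min (e / 2) (1 / 2).
have r0 : 0 < r by rewrite lt_min !divr_gt0.
have re : r < e.
  by apply: (@le_lt_trans _ _ (e / 2)); [rewrite ge_min lexx|rewrite ltr_pdivrMr// ltr_pMr// ltr1n].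
have r1 : r < 1.
  by apply: (@le_lt_trans _ _ (1 / 2)); [rewrite ge_min lexx orbT|rewrite ltr_pdivrMr// mul1r ltr1n].
have : conv_hull (range f) (y - r *: y).
  by apply: H; rewrite -ball_normE /ball_ /= sub0r normrN gtr0_norm.
have -> : y - r *: y = (1 - r) *: y by rewrite scalerBl scale1r.
move=> /conv_hull_sphere[_]; rewrite hom// ?subr_gt0// Fy sub0r leNgt => /negP; apply.
by rewrite oppr_gt0 pmulr_rlt0// ln_lt0// subr_gt0 r1 gtrBl.
Qed.

(** If x or y is below e, lowering that coordinate reaches the boundary. Otherwise z is moved to the
    nearer end of its range; the distance is a gap of T times the geometric mean, controlled by
    [T_eps_rate] and by eps = x y gmean on the sphere. *)
Lemma asymptotic_sphere : asymptotic_to_boundary (range f) K.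
Proof.
split; first by rewrite lev UE => y [].
have [C C0 CP] := T_eps_rate p2 q1 pq c0 x1_01 x21 x31 e1 e2 e3 dTh Th_y Th_Ny.
(* If the gap were at least e, then e^3 (x y)^2 <= C (x + y). Together with e (x + y) <= 2 x y,
   valid as x, y >= e, this gives e^5 (x + y) <= 4 C. *)
move=> e e0; exists (4 * C / e ^+ 5) => w Mw; rewrite lev in Mw; have [Uw Fw] := Mw.
have [x0 y0 /andP[h1 h2]] := Uw.
have Kw : K w by apply: interior_subset; rewrite UE.
have nw : `|w| <= w 0 0 + w 0 1.
  by have := cone_norm_le P0 Q0 uv1 al01 Kw; rewrite mul1r cone_formE.
move=> wN; have [xe|xe] := ltP (w 0 0) e.
  have [b [bK bw]] := cone_boundary_x P0 al01 Uw.
  by exists b; split=> //; exact: le_lt_trans xe.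
have [ye|ye] := ltP (w 0 1) e.
  have [b [bK bw]] := cone_boundary_y Q0 al01 Uw.
  by exists b; split=> //; exact: le_lt_trans ye.
set x := w 0 0 in x0 h1 h2 nw xe *; set y := w 0 1 in y0 h1 h2 nw ye *.
have g0 : 0 < gm x y by exact: gmean_gt0.
have gi : gm x y = (imean p q w)^-1 by exact: gmean_imean.
have i0 := imean_gt0 p q w.
have Tz : T (zeta w) = tau p q w.
  by have := Uw; apply: zetaE.
have zT : w 0 2 = T (zeta w) * gm x y.
  by rewrite Tz /tau gi mulfK ?gt_eqF.
have eE : eps (zeta w) = x * y * gm x y.
  have E : expR (F0 w) = eps (zeta w) * (imean p q w / (x * y)) by have := Uw; apply: expF0.
  have n0 : imean p q w / (x * y) != 0 by rewrite mulf_neq0 ?invr_eq0 ?mulf_neq0 ?gt_eqF.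
  by apply: (mulIf n0); rewrite -E Fw expR0 gi; field; rewrite !gt_eqF.
have bound (r : R) : 0 <= r -> r ^+ 3 * eps (zeta w) ^+ 2 <= C -> r * gm x y < e.
  move=> r0 rC; rewrite ltNge; apply/negP => er.
  have gs : gm x y <= x + y by apply: gmean_le_sum => //; exact: ltW.
  have xy0 : 0 < x * y by exact: mulr_gt0.
  have a1 : e ^+ 3 * (x * y) ^+ 2 <= C * (x + y).
    apply: (@le_trans _ _ ((r * gm x y) ^+ 3 * (x * y) ^+ 2)).
      apply: ler_wpM2r; first exact: sqr_ge0.
      by apply: lerXn2r => //; rewrite nnegrE ?(ltW e0)// mulr_ge0// ltW.
    have -> : (r * gm x y) ^+ 3 * (x * y) ^+ 2 = r ^+ 3 * eps (zeta w) ^+ 2 * gm x y.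
      by rewrite eE; ring.
    by apply: ler_pM => //; rewrite ?(ltW g0)// mulr_ge0 ?exprn_ge0// ltW// expR_gt0.
  have a2 : e * (x + y) <= 2 * (x * y).
    by have := ler_wpM2l (ltW x0) ye; have := ler_wpM2r (ltW y0) xe; lra.
  have a3 : e ^+ 4 * (x * y) <= 2 * C.
    have : e * (e ^+ 3 * (x * y) ^+ 2) <= C * (2 * (x * y)).
      apply: le_trans (ler_wpM2l (ltW e0) a1) _.
      by rewrite mulrCA; apply: ler_wpM2l.
    have -> : e * (e ^+ 3 * (x * y) ^+ 2) = (e ^+ 4 * (x * y)) * (x * y) by ring.
    have -> : C * (2 * (x * y)) = (2 * C) * (x * y) by ring.
    by rewrite ler_pM2r.
  have a4 : e ^+ 5 * (x + y) <= 4 * C.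
    have -> : e ^+ 5 * (x + y) = e ^+ 4 * (e * (x + y)) by ring.
    apply: le_trans (ler_wpM2l (exprn_ge0 4 (ltW e0)) a2) _.
    by move: a3; lra.
  move: (lt_le_trans wN nw); rewrite ltr_pdivrMr ?exprn_gt0// [X in _ < X]mulrC.
  by rewrite ltNge a4.
have [z0|z0] := leP 0 (zeta w).
- exists (\row_(i < 3) [:: x; y; gm x y]`_i); split.
    by apply: cone_boundary_row => //; [exact: ltW|exact: ltW|left].
  have lt : (1 - T (zeta w)) * gm x y < e.
    by apply: bound; [rewrite subr_ge0 ltW|have [+ _] := CP (zeta w); exact].
  have t1 : 0 <= (1 - T (zeta w)) * gm x y.
    by apply: mulr_ge0; [rewrite subr_ge0 ltW|exact: ltW].
  apply: le_lt_trans lt; apply: norm_rV_le => //.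
  apply: forall_ord3; rewrite !mxE /= ?subrr ?normr0//.
  by rewrite zT distrC -[X in X - _]mul1r -mulrBl ger0_norm.
- exists (\row_(i < 3) [:: x; y; - al * gm x y]`_i); split.
    by apply: cone_boundary_row => //; [exact: ltW|exact: ltW|right].
  have t0 : 0 <= T (zeta w) + al by rewrite -lerBlDr sub0r ltW.
  have lt : (T (zeta w) + al) * gm x y < e.
    by apply: bound => //; have [_] := CP (zeta w); apply; exact: ltW.
  apply: le_lt_trans lt; have t1 : 0 <= (T (zeta w) + al) * gm x y by rewrite mulr_ge0// ltW.
  apply: norm_rV_le => //.
  apply: forall_ord3; rewrite !mxE /= ?subrr ?normr0//.
  by rewrite zT mulNr opprK -mulrDl ger0_norm.
Qed.

End sphere_geometry.

Unset Implicit Arguments.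
Set Strict Implicit.
Set Printing Implicit Defensive.

Theorem mainTheorem4 (R : realType) (p q c : R)
    (hp : 2 <= p) (hq : 1 / p + 1 / q = 1)
    (hc : - (2 * (p + q)) < c < 0) :
  (exists xi1 xi2 xi3 : R,
     xi3 < xi2 < xi1 /\
     cubic p q c =
       (4 * (p + q)) *: (('X - xi1%:P) * ('X - xi2%:P) * ('X - xi3%:P))) /\
  forall xi1 xi2 xi3 : R,
    xi3 < xi2 < xi1 ->
    root (cubic p q c) xi1 -> root (cubic p q c) xi2 ->
    root (cubic p q c) xi3 ->
    let mu := @lebesgue_measure R in
    let z0 := - Num.sqrt (1 - xi1) in
    let G := G_fun p q c xi1 xi2 xi3 in
    let alpha := alpha_of G z0 in
    let t := t_of G z0 in
    let phi := phi_of p q c xi1 xi2 xi3 t z0 in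
    let K := cone p q alpha in
    let f := sphere_map p q t phi in
    (0 < xi1 < 1) /\
    (forall z, z0 < z -> 0 < G z /\ analytic_at G z) /\
    (forall z, z < z0 -> G z < 0 /\ analytic_at G z) /\
    simple_pole_with_residue G z0 1 /\
    mu.-integrable `[0, +oo[ (EFin \o (fun s => G (s + z0) + G (- s + z0))) /\
    (forall z, z0 < z -> mu.-integrable `[z, +oo[ (EFin \o G)) /\
    (forall z, z < z0 -> mu.-integrable `]-oo, z] (EFin \o G)) /\
    (forall z, - alpha < t z < 1) /\
    (forall z, z != z0 -> 0 < phi_arg p q c xi1 xi2 xi3 t z) /\
    continuous phi /\
    alpha < 1 /\
    regular_convex_cone K /\
    immersion f /\
    complete_hyperbolic_affine_sphere f /\
    asymptotic_to_boundary (range f) K /\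
    (exists F, canonical_potential K F) /\
    (forall F, canonical_potential K F ->
       [set x | interior K x /\ F x = 0] = range f).
Proof.
have q1 : 1 < q := conj_gt1 hp hq; have pq : p * q = p + q := conj_mul hp hq.
have /andP[_ c0] := hc.
split.
  have [x1 [x2 [x3 [h _ r1 [r2 r3]]]]] := cubic_roots_exist hp hq hc.
  by exists x1, x2, x3; split=> //; exact: cubic_factor.
move=> x1 x2 x3 h r1 r2 r3.
have [e1 e2 e3] := cubic_relations hp hq h r1 r2 r3.
have x01 := largest_root_bounds hp hq hc h r1 r2 r3.
have /andP[x32 x21] := h; have x31 : x3 < x1 := lt_trans x32 x21.
have th0 := theta_gt0 hp q1 pq c0 x01 x21 x31.
have cth : continuous (theta p q c x1 x2 x3) by exact: continuous_theta.
have [C thC] : exists C, forall z, theta p q c x1 x2 x3 z <= C * (1 + z ^+ 2)^-1.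
  exact: theta_le.
(* From here on every function of the statement is expressed through [Th], and log alpha is its
   limit [la] at -oo. *)
have [Th [la [dTh Ty TNy]]] := le_oneDsqrV_antiderivative cth (fun z => ltW (th0 z)) thC.
move=> mu z0 G alpha t phi K f.
have aE : alpha = expR la by exact: alpha_ofE.
have tE : t = T p q c x1 x2 x3 Th.
  exact: (t_ofE hp q1 pq c0 x01 x21 x31 e1 e2 e3 dTh Ty TNy).
have phE : phi = phi0 p q x1 Th by rewrite /phi tE; exact: phi_ofE.
have la0 : la < 0 by exact: (la_lt0 hp q1 pq c0 x01 x21 x31 dTh Ty TNy).
have a01 : 0 < expR la <= 1 by rewrite expR_gt0 ltW// expR_lt1.
have P0 := p_gt0 hp; have Q0 := q_gt0 q1; have [uv _ _] := inv_pq hp q1 pq.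
have GE z : z != z0 -> G z = Ghat p q c x1 x2 x3 z by move=> zz; exact: G_funE.
rewrite /f /K tE phE aE.
have cF : canonical_potential (cone p q (expR la)) (F0 p q c x1 x2 x3 Th).
  exact: canonical_potential_F0.
have lev : [set x | interior (cone p q (expR la)) x /\ F0 p q c x1 x2 x3 Th x = 0] =
    range (sphere_map p q (T p q c x1 x2 x3 Th) (phi0 p q x1 Th)).
  exact: level_set_F0.
have imm : immersion (sphere_map p q (T p q c x1 x2 x3 Th) (phi0 p q x1 Th)).
  exact: immersion_sphere_map.
have asy : asymptotic_to_boundary
    (range (sphere_map p q (T p q c x1 x2 x3 Th) (phi0 p q x1 Th))) (cone p q (expR la)).
  exact: asymptotic_sphere.
have zneq z : z0 < z -> z != z0 by move=> zz; rewrite gt_eqF.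
have zneq' z : z < z0 -> z != z0 by move=> zz; rewrite lt_eqF.
split; first exact: x01.
split.
  move=> z zz; rewrite GE ?zneq//; split; first exact: Ghat_gt0.
  by apply: analytic_G => //; exact: zneq.
split.
  move=> z zz; rewrite GE ?zneq'//; split; first exact: Ghat_lt0.
  by apply: analytic_G => //; exact: zneq'.
split; first exact: pole_G.
split; first exact: (integral_G_both hp q1 pq c0 x01 x21 x31 e1 e2 e3 dTh Ty TNy).1.
split; first by move=> z zz; exact: (integrable_G_y hp q1 pq c0 x01 x21 x31 e1 e2 e3 dTh Ty).
split; first by move=> z zz; exact: (integrable_G_Ny hp q1 pq c0 x01 x21 x31 e1 e2 e3 dTh TNy).
split; first by move=> z; apply/andP; split; [exact: T_gt|exact: T_lt1].
split; first by move=> z zz; rewrite phi_argE// eps_gt0.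
split; first exact: continuous_phi0.
split; first by rewrite expR_lt1.
split; first exact: regular_cone.
split; first exact: imm.
split.
  split; first exact: imm.
  - exists (@affine_normal _ p q c x1 x2 x3 Th), (affine_metric p q c x1 x2 x3 Th); split.
    + exact: affine_normal_metric_sphere_map.
    + move=> s; exists (- (@lam R)^-1).
      by rewrite /affine_normal scalerA mulNr mulVf ?gt_eqF ?lam_gt0// scaleN1r subrr.
    + exact: complete_affine_metric.
  - exact: (sphere_sub_boundary_hull hp q1 pq c0 x01 x21 x31 e1 e2 e3 dTh Ty TNy).
  - exact: (hull_zero hp q1 pq c0 x01 x21 x31 e1 e2 e3 dTh Ty TNy).
  - exact: (hull_separation hp q1 pq c0 x01 x21 x31 e1 e2 e3 dTh Ty TNy).
split; first exact: asy.
split; first by exists (F0 p q c x1 x2 x3 Th).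
(* The level set is known for the explicit potential; uniqueness on the interior transfers it to
   [F]. *)
move=> F cF'; rewrite -lev.
have UE : interior (cone p q (expR la)) = cone_int p q (expR la) by exact: interior_cone.
have E y : cone_int p q (expR la) y -> F y = F0 p q c x1 x2 x3 Th y.
  have cK : closed (cone p q (expR la)) by exact: closed_cone.
  have i0 : ~ cone_int p q (expR la) 0 by exact: cone_int0.
  have iZ a x : 0 < a -> cone_int p q (expR la) x -> cone_int p q (expR la) (a *: x) by exact: cone_int_scale.
  have lg x : cone p q (expR la) x -> x != 0 -> 0 < (x *m cone_form) 0 0 by exact: cone_form_gt0.
  have lb x : cone p q (expR la) x -> `|x| <= 1 * (x *m cone_form) 0 0 by exact: cone_norm_le.
  have pu e x : 0 < e -> cone p q (expR la) x -> x != 0 ->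
    cone_int p q (expR la) (x + (e * (x *m cone_form) 0 0) *: cone_dir) by exact: cone_push.
  have dl : 0 <= ((cone_dir : 'rV[R]_3) *m cone_form) 0 0 by exact: cone_dir_form.
  have := canonical_potential_unique UE cK i0 iZ lg lb dl pu cF' cF.
  by apply.
rewrite UE; apply/seteqP; split=> x /= [Ux Fx]; split=> //.
  by rewrite -E.
by rewrite E.
Qed.
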